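(* Let $n\ge0$ and let $F$ be a finite subset of $|\mathrm{Glob}^{top}(\mathbf{D}^n)|\setminus|\mathrm{Glob}^{top}(\mathbf{S}^{n-1})|$. Consider a pushout diagram of multipointed $d$-spaces consisting of $i^n_F:\mathrm{Glob}^{top}(\mathbf{D}^n)\to W^n_F$, $g:\mathrm{Glob}^{top}(\mathbf{D}^n)\to A$, $f:A\to X$ and $\widehat{g}:W^n_F\to X$ (so $X=A\sqcup_{\mathrm{Glob}^{top}(\mathbf{D}^n)}W^n_F$), where $A$ is a cellular multipointed $d$-space. Identify $A^0$ with a subset of $X^0$ by $f$. Consider the set maps $(-)^+,(-)^-:X^0\to A^0$ defined by $\alpha^+=\alpha^-=\alpha$ if $\alpha\in A^0$, and $\alpha^+=g(1)=\widehat{g}(1)$ and $\alpha^-=g(0)=\widehat{g}(0)$ if $\alpha\in X^0\setminus A^0$. Let $\alpha,\beta\in X^0$. There are two mutually exclusive cases: (1) $\alpha,\beta\in X^0\setminus A^0$ and $\mathrm{I}^+(\mathrm{cat}(W^n_F))(\alpha,\beta)\neq\varnothing$; in this case, there is a homotopy equivalence $$\mathrm{I}^+(\mathrm{cat}(X))(\alpha,\beta)\simeq\{\tau_{\alpha,\beta}\}\sqcup\mathrm{I}^+(\mathrm{cat}(A))(\alpha^+,\beta^-).$$ (2) Otherwise, there is a homotopy equivalence $$\mathrm{I}^+(\mathrm{cat}(X))(\alpha,\beta)\simeq\mathrm{I}^+(\mathrm{cat}(A))(\alpha^+,\beta^-).$$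
   Context: **Multipointed $d$-spaces.** $\mathbf{Top}$ denotes either the category of $\Delta$-generated spaces or that of $\Delta$-Hausdorff $\Delta$-generated spaces (either choice); it is bicomplete and cartesian closed with internal hom $\mathbf{TOP}(-,-)$, and $\Delta$-kelleyfication is the right adjoint of the inclusion of $\Delta$-generated spaces into topological spaces. $\mathcal{M}$ is the set of nondecreasing surjective maps $[0,1]\to[0,1]$. The normalized composition $\gamma_1*_N\gamma_2$ of paths with $\gamma_1(1)=\gamma_2(0)$ is $\gamma_1(2t)$ for $t\le 1/2$ and $\gamma_2(2t-1)$ for $t\ge 1/2$. A multipointed $d$-space is a triple $X=(|X|,X^0,\mathbb{P}^{top}X)$ with $|X|$ a space (the underlying space), $X^0\subset|X|$ a set (the states) and $\mathbb{P}^{top}X$ a set of continuous maps $[0,1]\to|X|$ (the execution paths) such that $\gamma(0),\gamma(1)\in X^0$ for every execution path $\gamma$, and $\mathbb{P}^{top}X$ is closed under $\gamma\mapsto\gamma\phi$ for $\phi\in\mathcal{M}$ and under normalized composition. A map $f:X\to Y$ is a continuous map $|X|\to|Y|$ taking $X^0$ to $Y^0$ and execution paths to execution paths. $\mathbb{P}^{top}_{\alpha,\beta}X$ is the set of execution paths from $\alpha$ to $\beta$ with the $\Delta$-kelleyfication of the topology induced by $\mathbf{TOP}([0,1],|X|)$. A set $S$ is viewed as $(S,S,\varnothing)$. For $A\subset X^0$, $X{\restriction}_A$ is $(|X|,A,\{\gamma\in\mathbb{P}^{top}X\mid\gamma(0),\gamma(1)\in A\})$. The topological globe $\mathrm{Glob}^{top}(Z)$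 of a space $Z$ has underlying space the quotient of $\{0,1\}\sqcup(Z\times[0,1])$ by $(z,0)=0$, $(z,1)=1$ for all $z$, states $\{0,1\}$, and execution paths $t\mapsto(z,\phi(t))$ with $z\in Z$, $\phi\in\mathcal{M}$. $\mathbf{D}^n$ is the closed unit disk of $\mathbb{R}^n$, $\mathbf{S}^{n-1}$ its boundary sphere, $\mathbf{D}^0=\{0\}$, $\mathbf{S}^{-1}=\varnothing$. A multipointed $d$-space $X$ is cellular if $\varnothing\to X$ is a transfinite composition of pushouts of the maps $\mathrm{Glob}^{top}(\mathbf{S}^{n-1})\subset\mathrm{Glob}^{top}(\mathbf{D}^n)$ ($n\ge0$), $C:\varnothing\to\{0\}$ and $R:\{0,1\}\to\{0\}$. **Flows.** A flow is a small semicategory (category without required identities) enriched over $\mathbf{Top}$: a set of states $X^0$, spaces of execution paths $\mathbb{P}_{\alpha,\beta}X$, and a continuous strictly associative composition. $\mathrm{cat}$ takes a multipointed $d$-space $X$ to the flow with states $X^0$, with $\mathbb{P}_{\alpha,\beta}\mathrm{cat}(X)$ the quotient of $\mathbb{P}^{top}_{\alpha,\beta}X$ by the equivalence relation generated by reparametrization by $\mathcal{M}$, and with composition induced by normalized composition. $\mathrm{I}^+$ is the left adjoint of the forgetful functor from topologically enriched small categories to flows: $\mathrm{I}^+(X)(\alpha,\beta)=\mathbb{P}_{\alpha,\beta}X$ if $\alpha\ne\beta$ and $\mathrm{I}^+(X)(\alpha,\alpha)=\{\mathrm{Id}_\alpha\}\sqcup\mathbb{P}_{\alpha,\alpha}X$.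 **The object $\mathrm{Glob}^{top}(\mathbf{D}^n)_F$.** For $F$ a finite subset of $|\mathrm{Glob}^{top}(\mathbf{D}^n)|\setminus|\mathrm{Glob}^{top}(\mathbf{S}^{n-1})|$, $\mathrm{Glob}^{top}(\mathbf{D}^n)_F$ is the multipointed $d$-space with underlying space $|\mathrm{Glob}^{top}(\mathbf{D}^n)|$, set of states $\{0,1\}\cup F$, $\mathbb{P}^{top}_{\alpha,\alpha}=\varnothing$ for every state $\alpha$, and, for states $\alpha\ne\beta$, $\mathbb{P}^{top}_{\alpha,\beta}$ the set of paths from $\alpha$ to $\beta$ of the form $t\mapsto(z,\psi(t))$ with $z\in\mathbf{D}^n$ and $\psi:[0,1]\to[0,1]$ nondecreasing continuous. **The object $W^n_F$ and the map $i^n_F$.** Let $V^n_F$ be the pushout of the two inclusions $\mathrm{Glob}^{top}(\mathbf{S}^{n-1})\subset\mathrm{Glob}^{top}(\mathbf{D}^n)$ and $\mathrm{Glob}^{top}(\mathbf{S}^{n-1})\subset\mathrm{Glob}^{top}(\mathbf{D}^n)_F$. One has $V^n_F{\restriction}_{\{0,1\}}\cong\mathrm{Glob}^{top}(\mathbf{D}^n\sqcup_{\mathbf{S}^{n-1}}\mathbf{D}^n)\cong\mathrm{Glob}^{top}(\mathbf{S}^n)$ (after choosing a homeomorphism $\mathbf{D}^n\sqcup_{\mathbf{S}^{n-1}}\mathbf{D}^n\cong\mathbf{S}^n$), and $W^n_F$ is the pushout of $\mathrm{Glob}^{top}(\mathbf{S}^n)\subset\mathrm{Glob}^{top}(\mathbf{D}^{n+1})$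 along $\mathrm{Glob}^{top}(\mathbf{S}^n)\cong V^n_F{\restriction}_{\{0,1\}}\subset V^n_F$. The map $i^n_F:\mathrm{Glob}^{top}(\mathbf{D}^n)\to W^n_F$ is the composite $\mathrm{Glob}^{top}(\mathbf{D}^n)\to V^n_F\to W^n_F$. The states of $W^n_F$ are $\{0,1\}\cup F$, and $X^0=A^0\sqcup F$ via $f$ and $\widehat g$; in (1), elements of $X^0\setminus A^0$ are identified with elements of $F$. **The trace $\tau_{\alpha,\beta}$.** In case (1), $\tau_{\alpha,\beta}$ denotes the trace (class of paths modulo reparametrization by $\mathcal{M}$) of a directed path of $X$ from $\alpha$ to $\beta$ with image in $|X|\setminus A^0$, which is unique (it is the constant path if $\alpha=\beta$, and otherwise the image by $\widehat g$ of the unique element of $\mathbb{P}_{\alpha,\beta}\mathrm{cat}(W^n_F)$); $\{\tau_{\alpha,\beta}\}$ is a one-point space. *)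

(* Defs.v *)
From HB Require Import structures.
From mathcomp Require Import all_boot all_order all_algebra.
From mathcomp Require Import all_classical all_reals topology.
From mathcomp Require Import normedtype.

Set Implicit Arguments.
Unset Strict Implicit.
Unset Printing Implicit Defensive.

Import Order.TTheory GRing.Theory Num.Theory.
Import numFieldNormedType.Exports.

Local Open Scope classical_set_scope.
Local Open Scope ring_scope.
Local Open Scope quotient_scope.

Notation unitI R := (set_type (`[0%R : Real.sort R, 1%R]%classic)).

Definition simplex (R : realType) (n : nat) : topologicalType :=
  set_type [set x : 'rV[R]_n.+1 |
    (forall i, 0 <= x ord0 i) /\ \sum_i x ord0 i = 1].

Definition disk_set (R : realType) (n : nat) : set 'rV[R]_n :=
  [set x | \sum_i x ord0 i ^+ 2 <= 1].
Arguments disk_set : clear implicits.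
Definition disk (R : realType) (n : nat) : topologicalType :=
  set_type (disk_set R n).

(* [sphere R n] is S^{n-1}, the boundary of [disk R n]; it is empty if n = 0 *)
Definition sphere_set (R : realType) (n : nat) : set 'rV[R]_n :=
  [set x | \sum_i x ord0 i ^+ 2 = 1].
Arguments sphere_set : clear implicits.
Definition sphere (R : realType) (n : nat) : topologicalType :=
  set_type (sphere_set R n).

Section Interval.
Variable R : realType.
Local Notation I := (unitI R).

Lemma I0_subproof : (0 : R) \in (`[0%R : R, 1%R]%classic : set R).
Proof. by apply/mem_set; rewrite /= in_itv /= lexx ler01. Qed.
Definition I0 : I := exist _ 0 I0_subproof.

Lemma I1_subproof : (1 : R) \in (`[0%R : R, 1%R]%classic : set R).
Proof. by apply/mem_set; rewrite /= in_itv /= lexx ler01. Qed.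
Definition I1 : I := exist _ 1 I1_subproof.

Lemma clampI_subproof (x : R) :
  Num.max 0 (Num.min x 1) \in (`[0%R : R, 1%R]%classic : set R).
Proof.
apply/mem_set; rewrite /= in_itv /= le_max lexx /= ge_max ler01 /=.
by rewrite ge_min lexx orbT.
Qed.
Definition clampI (x : R) : I := 
  exist _ (Num.max 0 (Num.min x 1)) (clampI_subproof x).

Definition nondecreasingI (phi : I -> I) : Prop :=
  forall s t : I, \val s <= \val t -> \val (phi s) <= \val (phi t).

(* the set M; continuity follows from the other two conditions *)
Definition reparam : set (I -> I) :=
  [set phi | [/\ continuous phi, nondecreasingI phi &
                 forall t, exists s, phi s = t]].

(* 2t and 2t-1 are only evaluated where they lie in [0,1], so that the
   truncation [clampI] is harmless *)
Definition ncomp (T : Type) (g1 g2 : I -> T) : I -> T := fun t =>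
  if \val t <= 2^-1 then g1 (clampI (2 * \val t))
  else g2 (clampI (2 * \val t - 1)).

Lemma I_inj (s t : I) : \val s = \val t -> s = t.
Proof. exact: val_inj. Qed.

Lemma I_ge0 (t : I) : 0 <= \val t.
Proof. by case: t => t /= /set_mem; rewrite /= in_itv /= => /andP[]. Qed.

Lemma I_le1 (t : I) : \val t <= 1.
Proof. by case: t => t /= /set_mem; rewrite /= in_itv /= => /andP[]. Qed.

Lemma clampI_le0 (x : R) : x <= 0 -> clampI x = I0.
Proof.
move=> x0; apply: I_inj => /=; apply/max_idPl.
by rewrite ge_min x0.
Qed.

Lemma clampI_ge1 (x : R) : 1 <= x -> clampI x = I1.
Proof. by move=> x1; apply: I_inj => /=; rewrite (min_idPr x1); apply/max_idPr/ler01. Qed.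

Lemma clampIK (t : I) : clampI (\val t) = t.
Proof.
apply: I_inj => /=; rewrite (min_idPl (I_le1 t)); apply/max_idPr.
exact: I_ge0.
Qed.

Lemma reparam0 (phi : I -> I) : reparam phi -> phi I0 = I0.
Proof.
move=> [_ nd /(_ I0)[s s0]]; apply/I_inj/le_anti; rewrite I_ge0 andbT -[X in _ <= \val X]s0.
by apply: nd; rewrite I_ge0.
Qed.

Lemma reparam1 (phi : I -> I) : reparam phi -> phi I1 = I1.
Proof.
move=> [_ nd /(_ I1)[s s1]]; apply/I_inj/le_anti; rewrite I_le1 -[X in \val X <= _]s1.
by apply: nd; rewrite I_le1.
Qed.

Lemma reparam_comp (phi psi : I -> I) :
  reparam phi -> reparam psi -> reparam (phi \o psi).
Proof.
move=> [c1 n1 s1] [c2 n2 s2]; split.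
- by move=> x; apply: continuous_comp; [exact: c2|exact: c1].
- by move=> s t st; apply/n1/n2.
- by move=> t; have [u <-] := s1 t; have [v <-] := s2 u; exists v.
Qed.

Lemma ncomp0 (T : Type) (g1 g2 : I -> T) : ncomp g1 g2 I0 = g1 I0.
Proof. by rewrite /ncomp /= invr_ge0 ler0n mulr0 clampI_le0. Qed.

Lemma ncomp1 (T : Type) (g1 g2 : I -> T) : ncomp g1 g2 I1 = g2 I1.
Proof.
rewrite /ncomp /= lt_geF ?invf_lt1 ?ltr1n // mulr1 clampI_ge1 //.
by rewrite lerBrDr -natr1.
Qed.

Lemma ncomp_comp (T U : Type) (f : T -> U) (g1 g2 : I -> T) :
  ncomp (f \o g1) (f \o g2) = f \o ncomp g1 g2.
Proof. by apply/funext => t; rewrite /ncomp /=; case: ifP. Qed.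

Lemma clampI_le (x y : R) : x <= y -> \val (clampI x) <= \val (clampI y).
Proof. by move=> xy /=; apply: le_max2 => //; apply: le_min2. Qed.

Lemma ncomp_nondecreasing (p q : I -> I) : nondecreasingI p ->
  nondecreasingI q -> p I1 = q I0 -> nondecreasingI (ncomp p q).
Proof.
move=> np nq pq s t st; rewrite /ncomp.
have [t2|t2] := leP (\val t) 2^-1.
  rewrite (le_trans st t2); apply/np/clampI_le.
  by rewrite ler_wpM2l.
case: ifPn => _; last by apply/nq/clampI_le; rewrite lerD2r ler_wpM2l.
apply: (@le_trans _ _ (\val (p I1))); first by apply/np/I_le1.
by rewrite pq; apply/nq/I_ge0.
Qed.

Lemma val_continuous : continuous (fun t : I => \val t).
Proof. exact: initial_continuous. Qed.

Lemma clampI_continuous : continuous (@clampI).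
Proof.
apply/continuousP => _ [A oA <-].
rewrite (_ : _ @^-1` _ = (fun x : R => Num.max 0 (Num.min x 1)) @^-1` A) //.
apply: open_comp => // x _.
apply: (@continuous_max _ _ (cst 0) (fun y : R => Num.min y 1)).
  exact: cvg_cst.
apply: (@continuous_min _ _ idfun (cst 1)); first exact: cvg_id.
exact: cvg_cst.
Qed.

Lemma ncomp_continuous (p q : I -> I) : continuous p -> continuous q ->
  p I1 = q I0 -> continuous (ncomp p q).
Proof.
move=> cp cq pq.
have -> : ncomp p q = clampI \o (fun t : I => \val (p (clampI (2 * \val t))) +
    \val (q (clampI (2 * \val t - 1))) - \val (q I0)).
  apply/funext => t; rewrite /= /ncomp; have [t2|t2] := leP (\val t) 2^-1.
    rewrite [clampI (2 * \val t - 1)]clampI_le0 ?addrK ?clampIK //.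
    by rewrite subr_le0 mulrC -ler_pdivlMr // mul1r.
  rewrite [clampI (2 * \val t)]clampI_ge1; last first.
    by rewrite mulrC -ler_pdivrMr // mul1r ltW.
  by rewrite pq addrAC subrr add0r clampIK.
have cv (u : I -> I) : continuous u -> continuous (fun t => \val (u t) : R).
  by move=> cu t; apply: (@continuous_comp _ _ _ u (fun t : I => \val t));
    [exact: cu|exact: val_continuous].
have c2 : continuous (fun t : I => 2 * \val t : R).
  move=> t; apply: (@continuousM R I (cst 2) (fun t => \val t)).
    exact: cst_continuous.
  exact: val_continuous.
have c21 : continuous (fun t : I => 2 * \val t - 1 : R).
  move=> t; apply: (@continuousB R R^o I (fun t => 2 * \val t) (cst 1)).
    exact: c2.
  exact: cst_continuous.
have cc (u : I -> I) (v : I -> R) : continuous u -> continuous v ->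
    continuous (fun t => \val (u (clampI (v t))) : R).
  move=> cu cv'; apply: (cv (u \o (@clampI \o v))) => t.
  apply: continuous_comp; last exact: cu.
  by apply: continuous_comp; [exact: cv'|exact: clampI_continuous].
move=> t; apply: continuous_comp; last exact: clampI_continuous.
apply: (@continuousB R R^o I _ (cst (\val (q I0)))); last exact: cst_continuous.
by apply: (@continuousD R R^o I); apply: cc.
Qed.

End Interval.
Arguments I0 {R}.
Arguments I1 {R}.

Section Kelley.
Variable R : realType.

Definition delta_open (T : topologicalType) : set (set T) :=
  [set U | forall n (s : simplex R n -> T), continuous s -> open (s @^-1` U)].

Definition delta_generated (T : topologicalType) : Prop :=
  forall U, @delta_open T U -> open U.

Definition delta_hausdorff (T : topologicalType) : Prop :=
  forall g : unitI R -> T, continuous g -> closed (range g).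

(* Delta-kelleyfication: T with the topology [delta_open T]; R only records the
   field over which the simplices are taken *)
Definition kelley (T : Type) : Type := let _ := R in T.

Section KelleyTopology.
Variable T : topologicalType.

Lemma delta_openT : @delta_open T setT.
Proof. by move=> n s _; rewrite preimage_setT; exact: openT. Qed.

Lemma delta_openI : setI_closed (@delta_open T).
Proof.
by move=> A B oA oB n s cs; rewrite preimage_setI; apply: openI;
  [exact: oA|exact: oB].
Qed.

Lemma delta_open_bigU (J : Type) (f : J -> set T) :
  (forall i, delta_open (f i)) -> delta_open (\bigcup_i f i).
Proof.
move=> of_ n s cs; rewrite preimage_bigcup; apply: bigcup_open => i _.
exact: of_.
Qed.

HB.instance Definition _ := Choice.copy (kelley T) T.
HB.instance Definition _ := isOpenTopological.Build (kelley T)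
  delta_openT delta_openI delta_open_bigU.
End KelleyTopology.

(* the two possible choices of the category Top *)
Inductive topcat := DeltaGenerated | DeltaHausdorff.

Definition in_top (k : topcat) (T : topologicalType) : Prop :=
  match k with
  | DeltaGenerated => delta_generated T
  | DeltaHausdorff => delta_generated T /\ delta_hausdorff T
  end.

Section TopQuotient.
Variables (k : topcat) (T : topologicalType) (r : T -> T -> Prop).

(* Quotients are taken in Top: x and y are identified iff every map to a space
   of Top that is compatible with r takes the same value at x and y.  For
   Delta-generated spaces this is the equivalence relation generated by r; for
   Delta-Hausdorff ones it is the least one containing r whose quotient is
   Delta-Hausdorff. *)
Definition tquot_rel (x y : T) : bool :=
  `[< forall (Y : topologicalType) (f : T -> Y), in_top k Y -> continuous f ->
        (forall a b, r a b -> f a = f b) -> f x = f y >].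

Lemma tquot_refl : reflexive tquot_rel.
Proof. by move=> x; apply/asboolP. Qed.

Lemma tquot_sym : symmetric tquot_rel.
Proof.
by move=> x y; apply/idP/idP => /asboolP h; apply/asboolP => Y f ? ? ?;
  apply/esym; exact: h.
Qed.

Lemma tquot_trans : transitive tquot_rel.
Proof.
move=> y x z /asboolP h1 /asboolP h2; apply/asboolP => Y f ? ? ?.
by rewrite h1 // h2.
Qed.

Definition tquot_equiv := EquivRel tquot_rel tquot_refl tquot_sym tquot_trans.
Definition tquot : Type := {eq_quot tquot_equiv}.
HB.instance Definition _ := Quotient.on tquot.
HB.instance Definition _ :=
  Topological.copy tquot (quotient_topology tquot).
Definition tquot_pi : T -> tquot := \pi_tquot.
End TopQuotient.

Definition homotopic (T U : topologicalType) (f g : T -> U) : Prop :=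
  exists H : T * unitI R -> U, [/\ continuous H,
    forall x, H (x, I0) = f x & forall x, H (x, I1) = g x].

Definition homotopy_equivalent (T U : topologicalType) : Prop :=
  exists (f : T -> U) (g : U -> T), [/\ continuous f, continuous g,
    homotopic (g \o f) idfun & homotopic (f \o g) idfun].

Definition is_top_pushout (k : topcat) (S B C P : topologicalType)
    (i : S -> B) (j : S -> C) (u : B -> P) (v : C -> P) : Prop :=
  [/\ in_top k P, continuous u, continuous v, u \o i =1 v \o j &
    forall (Y : topologicalType) (a : B -> Y) (b : C -> Y), in_top k Y ->
      continuous a -> continuous b -> a \o i =1 b \o j ->
      exists! h : P -> Y, [/\ continuous h, h \o u =1 a & h \o v =1 b]].

End Kelley.
Arguments delta_open R {T}.

Definition coprod (T U : topologicalType) : topologicalType :=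
  {b : bool & (if b then T else U : topologicalType)}.
Definition inL (T U : topologicalType) (x : T) : coprod T U :=
  existT (fun b : bool => (if b then T else U : topologicalType)) true x.
Definition inR (T U : topologicalType) (x : U) : coprod T U :=
  existT (fun b : bool => (if b then T else U : topologicalType)) false x.

Record mdspace (R : realType) := MDSpace {
  carrier :> topologicalType;
  states : set carrier;
  epath : set (unitI R -> carrier);
  epath_continuous : forall g, epath g -> continuous g;
  epath_states : forall g, epath g -> states (g I0) /\ states (g I1);
  epath_reparam : forall g phi, epath g -> reparam phi -> epath (g \o phi);
  epath_ncomp : forall g1 g2, epath g1 -> epath g2 -> g1 I1 = g2 I0 ->
    epath (ncomp g1 g2)
}.
Arguments states {R} _.
Arguments epath {R} _.

Record mdmap (R : realType) (X Y : mdspace R) := MDMap {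
  mdfun :> X -> Y;
  md_continuous : continuous mdfun;
  md_states : forall x, states X x -> states Y (mdfun x);
  md_epath : forall g, epath X g -> epath Y (mdfun \o g)
}.

Section MDSpaces.
Variable R : realType.
Local Notation I := (unitI R).
Implicit Types X Y : mdspace R.

Program Definition mdcomp X Y Z (f : mdmap X Y) (g : mdmap Y Z) : mdmap X Z :=
  @MDMap R X Z (g \o f) _ _ _.
Next Obligation.
by move=> X Y Z f g x; apply: continuous_comp; exact: md_continuous.
Qed.
Next Obligation. by move=> X Y Z f g x sx /=; do 2! apply: md_states. Qed.
Next Obligation.
by move=> X Y Z f g p ep; exact: (md_epath g (md_epath f ep)).
Qed.

Definition md_iso X Y (f : mdmap X Y) : Prop :=
  exists g : mdmap Y X, cancel f g /\ cancel g f.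

Definition is_pushout (k : topcat) (B A W X : mdspace R)
    (i : mdmap B W) (g : mdmap B A) (gh : mdmap W X) (f : mdmap A X) : Prop :=
  [/\ in_top R k X, gh \o i =1 f \o g &
    forall (Y : mdspace R) (a : mdmap A Y) (w : mdmap W Y), in_top R k Y ->
      w \o i =1 a \o g ->
      exists h : mdmap X Y, [/\ h \o f =1 a, h \o gh =1 w &
        forall h' : mdmap X Y, h' \o f =1 a -> h' \o gh =1 w -> h' =1 h]].

Program Definition discrete_md (S : choiceType) : mdspace R :=
  @MDSpace R (discrete_topology S) setT set0 _ _ _ _.
Next Obligation. by []. Qed.
Next Obligation. by []. Qed.
Next Obligation. by []. Qed.
Next Obligation. by []. Qed.

Program Definition discrete_map (S T : choiceType) (f : S -> T) :
  mdmap (discrete_md S) (discrete_md T) := @MDMap R _ _ f _ _ _.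
Next Obligation.
by move=> S T f x A /=; rewrite !nbhs_principalE => /principal_filterP Afx;
  apply/principal_filterP.
Qed.
Next Obligation. by []. Qed.
Next Obligation. by []. Qed.

Program Definition restriction X (A : set X) : mdspace R :=
  @MDSpace R X (states X `&` A)
    [set g | [/\ epath X g, A (g I0) & A (g I1)]] _ _ _ _.
Next Obligation. by move=> X A g [/epath_continuous]. Qed.
Next Obligation. by move=> X A g [/epath_states[]]. Qed.
Next Obligation.
move=> X A g phi [eg A0 A1] rp; split; first exact: epath_reparam.
  by rewrite /= reparam0.
by rewrite /= reparam1.
Qed.
Next Obligation.
move=> X A g1 g2 [e1 A10 A11] [e2 A20 A21] e; split; first exact: epath_ncomp.
  by rewrite ncomp0.
by rewrite ncomp1.
Qed.

Program Definition restriction_incl X (A : set X) :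
  mdmap (restriction A) X := @MDMap R (restriction A) X id _ _ _.
Next Obligation. by move=> X A x; exact: cvg_id. Qed.
Next Obligation. by move=> X A x []. Qed.
Next Obligation. by move=> X A g []. Qed.

(* the internal hom TOP([0,1],T): the Delta-kelleyfication of the compact-open
   topology on continuous maps *)
Definition TOP (T : topologicalType) : topologicalType :=
  kelley R (set_type
    ([set g | continuous g] : set {compact-open, I -> T})).

Definition TOP_fun (T : topologicalType) (g : TOP T) : I -> T :=
  \val (g : set_type ([set g | continuous g] : set {compact-open, I -> T})).

Definition epaths X (a b : X) : topologicalType :=
  kelley R (set_type [set g : TOP X |
    [/\ epath X (TOP_fun g), TOP_fun g I0 = a & TOP_fun g I1 = b]]).

Definition epaths_fun X (a b : X) (g : epaths a b) : I -> X :=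
  TOP_fun (\val (g : set_type [set g : TOP X |
    [/\ epath X (TOP_fun g), TOP_fun g I0 = a & TOP_fun g I1 = b]])).

(* P_{a,b}cat(X); the composition of cat(X) plays no role below *)
Definition cat_hom (k : topcat) X (a b : X) : topologicalType :=
  tquot R k (fun g h : epaths a b => exists2 phi, reparam phi &
    epaths_fun h = epaths_fun g \o phi).

Definition exec_trace (k : topcat) X (a b : X) (g : epaths a b) : cat_hom k a b :=
  tquot_pi R k _ g.

(* I^+(cat X)(a,b); the first summand, the identity of a, is empty if a <> b *)
Definition Iplus_hom (k : topcat) X (a b : X) : topologicalType :=
  coprod (discrete_topology (set_type [set _ : unit | a = b])) (cat_hom k a b).

End MDSpaces.

Lemma pair_continuous (S T U : topologicalType) (f : S -> T) (g : S -> U) :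
  continuous f -> continuous g -> continuous (fun x => (f x, g x)).
Proof.
move=> cf cg x.
exact: (@cvg_pair _ _ _ (nbhs x) (nbhs (f x)) (nbhs (g x)) _ _ _ f g
  (cf x) (cg x)).
Qed.

Section Globe.
Variable R : realType.
Local Notation I := (unitI R).

Section GlobeSpace.
Variable Z : topologicalType.

(* {0,1} + Z x [0,1], where 0 and 1 are false and true.  As [0,1] is locally
   compact, the product topology is the product of Top. *)
Definition preglob : topologicalType := coprod bool (Z * I)%type.

Definition glob_nf (x : preglob) : preglob :=
  match x with
  | existT true b => inL _ b
  | existT false zt =>
      if zt.2 == I0 then inL _ false
      else if zt.2 == I1 then inL _ true
      else inR _ zt
  end.

(* the equivalence relation generated by (z,0) = 0 and (z,1) = 1 *)
Definition glob_rel (x y : preglob) : bool := glob_nf x == glob_nf y.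

Lemma glob_refl : reflexive glob_rel.
Proof. by move=> x; apply: eqxx. Qed.
Lemma glob_sym : symmetric glob_rel.
Proof. by move=> x y; apply: eq_sym. Qed.
Lemma glob_trans : transitive glob_rel.
Proof. by move=> y x z /eqP h1 /eqP h2; apply/eqP; rewrite h1. Qed.

Definition glob_equiv := EquivRel glob_rel glob_refl glob_sym glob_trans.
Definition glob : Type := {eq_quot glob_equiv}.
HB.instance Definition _ := Quotient.on glob.
HB.instance Definition _ :=
  Topological.copy glob (quotient_topology glob).

Definition glob_end (b : bool) : glob := \pi_glob (inL _ b).
Definition glob_pt (z : Z) (t : I) : glob := \pi_glob (inR _ (z, t)).

Lemma glob_eqP (x y : preglob) : \pi_glob x = \pi_glob y -> glob_nf x = glob_nf y.
Proof. by move=> e; apply/eqP; move/eqmodP: e. Qed.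

Lemma glob_eqI (x y : preglob) : glob_nf x = glob_nf y -> \pi_glob x = \pi_glob y.
Proof. by move=> e; apply/eqmodP/eqP. Qed.

Lemma inR_inj (T U : topologicalType) : injective (@inR T U).
Proof. by move=> x y e; apply: existT_inj2 e. Qed.

Lemma I0_neq_I1 : (I0 : I) <> I1.
Proof. by move=> /(congr1 val) /= /eqP; rewrite eq_sym oner_eq0. Qed.

Lemma glob_nf_end b : glob_nf (inL _ b) = inL _ b.
Proof. by []. Qed.

Lemma glob_pt0 z : glob_pt z I0 = glob_end false.
Proof. by apply: glob_eqI; rewrite /= eqxx. Qed.

Lemma glob_pt1 z : glob_pt z I1 = glob_end true.
Proof.
apply: glob_eqI; rewrite /= eqxx; case: eqP => // e.
by case: I0_neq_I1.
Qed.

Lemma glob_end_inj : injective glob_end.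
Proof. by move=> b c /glob_eqP; rewrite !glob_nf_end => e; exact: existT_inj2 e. Qed.

Definition glob_height (x : preglob) : I :=
  match glob_nf x with
  | existT true b => if b then I1 else I0
  | existT false zt => zt.2
  end.

Lemma glob_pt_height z t z' t' : glob_pt z t = glob_pt z' t' -> t = t'.
Proof.
have h u s : glob_height (inR _ (u, s)) = s.
  by rewrite /glob_height /=; case: eqP => [->//|_]; case: eqP => [->|].
by move=> /glob_eqP e; rewrite -(h z t) -(h z' t') /glob_height e.
Qed.

Lemma glob_pt_inj z z' t : t <> I0 -> t <> I1 ->
  glob_pt z t = glob_pt z' t -> z = z'.
Proof.
move=> /eqP/negbTE t0 /eqP/negbTE t1 /glob_eqP.
by rewrite /= t0 t1 => /inR_inj [].
Qed.

Lemma glob_pt_continuous z (psi : I -> I) :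
  continuous psi -> continuous (glob_pt z \o psi).
Proof.
move=> cpsi t.
apply: (@continuous_comp _ _ _ (fun t => inR _ (z, psi t)) (\pi_glob)); last first.
  exact: pi_continuous.
apply: (@continuous_comp _ _ _ (fun t => (z, psi t)) (@inR _ _)); last first.
  exact: existT_continuous.
by apply: pair_continuous => // u; exact: cst_continuous.
Qed.

End GlobeSpace.

Section GlobeMap.
Variables (Z Z' : topologicalType) (f : Z -> Z').

Definition preglob_map (x : preglob Z) : preglob Z' :=
  match x with
  | existT true b => inL _ b
  | existT false zt => inR _ (f zt.1, zt.2)
  end.

Definition glob_map (x : glob Z) : glob Z' :=
  \pi_(glob Z') (preglob_map (repr x)).

Lemma glob_map_homo (x y : preglob Z) : \pi_(glob Z) x = \pi_(glob Z) y ->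
  \pi_(glob Z') (preglob_map x) = \pi_(glob Z') (preglob_map y).
Proof.
have nf (u : preglob Z) : glob_nf (preglob_map u) = glob_nf (preglob_map (glob_nf u)).
  case: u => -[//|[z t]] /=; case: eqP => [e|e0] //=.
  case: eqP => [e|e1] //=.
  by case: eqP => // _; case: eqP.
by move=> /glob_eqP e; apply: glob_eqI; rewrite nf e -nf.
Qed.

Lemma glob_map_pi x : glob_map (\pi_(glob Z) x) = \pi_(glob Z') (preglob_map x).
Proof. by apply: glob_map_homo; rewrite reprK. Qed.

Lemma glob_map_end b : glob_map (glob_end Z b) = glob_end Z' b.
Proof. exact: glob_map_pi. Qed.

Lemma glob_map_pt z t : glob_map (glob_pt z t) = glob_pt (f z) t.
Proof. exact: glob_map_pi. Qed.

Hypothesis cf : continuous f.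

Lemma glob_map_continuous : continuous glob_map.
Proof.
have -> : glob_map = (\pi_(glob Z') \o preglob_map) \o repr by [].
apply: repr_comp_continuous.
  move=> x; apply: continuous_comp; last exact: pi_continuous.
  move: x; apply/continuousP => A oA; apply/sigT_openP => -[] /=.
    exact: (proj1 (@sigT_openP _ _ A) oA true).
  have -> : existT _ false @^-1` (preglob_map @^-1` A) =
    (fun zt : Z * I => (f zt.1, zt.2)) @^-1` (@inR bool (Z' * I)%type @^-1` A) by [].
  apply: open_comp; last exact: (proj1 (@sigT_openP _ _ A) oA false).
  move=> zt _; apply: pair_continuous => u; last exact: cvg_snd.
  by apply: (@continuous_comp _ _ _ fst f); [exact: cvg_fst|exact: cf].
by move=> x y /eqP e; apply/eqP/glob_map_homo.
Qed.
End GlobeMap.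
End Globe.

Section GlobeMD.
Variable R : realType.
Local Notation I := (unitI R).

Section Objects.
Variable Z : topologicalType.

Program Definition glob_md : mdspace R :=
  @MDSpace R (glob R Z) (range (glob_end R Z))
    [set g | exists z phi, reparam phi /\ g = glob_pt z \o phi] _ _ _ _.
Next Obligation. by move=> _ [z [phi [[c _ _] ->]]]; exact: glob_pt_continuous. Qed.
Next Obligation.
move=> _ [z [phi [rp ->]]]; rewrite /= reparam0 // reparam1 // glob_pt0 glob_pt1.
by split; [exists false|exists true].
Qed.
Next Obligation.
move=> _ psi [z [phi [rp ->]]] rpsi; exists z, (phi \o psi); split => //.
exact: reparam_comp.
Qed.
Next Obligation.
move=> _ _ [z [phi [rp ->]]] [z' [phi' [rp' ->]]] /=.
by rewrite reparam1 // reparam0 // glob_pt1 glob_pt0 => /glob_end_inj.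
Qed.

Variable F : set (glob R Z).

(* Glob(Z)_F: only pairs of distinct states are joined by execution paths *)
Definition globF_states : set (glob R Z) := range (glob_end R Z) `|` F.

Definition globF_epath : set (I -> glob R Z) :=
  [set g | (exists z (psi : I -> I),
              [/\ continuous psi, nondecreasingI psi & g = glob_pt z \o psi]) /\
           [/\ globF_states (g I0), globF_states (g I1) & g I0 <> g I1]].

Program Definition globF_md : mdspace R :=
  @MDSpace R (glob R Z) globF_states globF_epath _ _ _ _.
Next Obligation. by move=> _ [[z [psi [c _ ->]]] _]; exact: glob_pt_continuous. Qed.
Next Obligation. by move=> g [_ []]. Qed.
Next Obligation.
move=> g phi [[z [psi [c nd eg]]] [s0 s1 s01]] rp; split.
  exists z, (psi \o phi); split; last by rewrite eg.
  - case: rp => cphi _ _ x.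
    by apply: continuous_comp; [exact: cphi|exact: c].
  - by case: rp => _ ndphi _ x y xy; apply/nd/ndphi.
by rewrite /= reparam0 // reparam1.
Qed.
Next Obligation.
move=> g1 g2 [[z1 [p1 [c1 n1 e1]]] [s10 s11 s1]].
move=> [[z2 [p2 [c2 n2 e2]]] [s20 s21 s2]] e12.
have p12 : p1 I1 = p2 I0.
  by move: e12; rewrite e1 e2; exact: glob_pt_height.
have p10 : p1 I0 <> p1 I1 by move=> e; apply: s1; rewrite e1 /= e.
have p20 : p2 I0 <> p2 I1 by move=> e; apply: s2; rewrite e2 /= e.
have z12 : z1 = z2.
  apply: (@glob_pt_inj R Z z1 z2 (p1 I1)).
  - move=> e; apply: p10; apply/I_inj/le_anti; rewrite [in X in _ && X]e I_ge0 andbT.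
    by apply: n1; exact: I_ge0.
  - move=> e; apply: p20; apply/I_inj/le_anti; rewrite -[in X in _ && X]p12 e I_le1 andbT.
    by apply: n2; exact: I_ge0.
  - by move: e12; rewrite e1 e2 /= -p12.
split.
  exists z1, (ncomp p1 p2); split.
  - exact: ncomp_continuous.
  - exact: ncomp_nondecreasing.
  - by rewrite e1 e2 z12 ncomp_comp.
rewrite ncomp0 ncomp1; split => //.
rewrite e1 e2 => /glob_pt_height e; apply: p10; apply/I_inj/le_anti/andP; split.
  by apply: n1; exact: I_ge0.
by rewrite p12 e; apply: n2; exact: I_ge0.
Qed.

End Objects.

Section Maps.
Variables (Z Z' : topologicalType) (f : Z -> Z') (cf : continuous f).

Program Definition glob_mdmap : mdmap (glob_md Z) (glob_md Z') :=
  @MDMap R (glob_md Z) (glob_md Z') (glob_map f) _ _ _.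
Next Obligation. exact: glob_map_continuous. Qed.
Next Obligation. by move=> _ [b _ <-]; exists b => //; rewrite glob_map_end. Qed.
Next Obligation.
move=> _ [z [phi [rp ->]]]; exists (f z), phi; split => //.
by apply/funext => t /=; rewrite glob_map_pt.
Qed.

Variable F : set (glob R Z').

Program Definition globF_mdmap : mdmap (glob_md Z) (globF_md F) :=
  @MDMap R (glob_md Z) (globF_md F) (glob_map f) _ _ _.
Next Obligation. exact: glob_map_continuous. Qed.
Next Obligation.
by move=> _ [b _ <-]; left; exists b => //; rewrite glob_map_end.
Qed.
Next Obligation.
move=> _ [z [phi [rp ->]]].
have e : glob_map f \o (glob_pt z \o phi) = glob_pt (f z) \o phi.
  by apply/funext => t /=; rewrite glob_map_pt.
split; rewrite e; first by case: rp => c nd _; exists (f z), phi.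
rewrite /= reparam0 // reparam1 // glob_pt0 glob_pt1; split.
- by left; exists false.
- by left; exists true.
- by move=> /glob_end_inj.
Qed.
End Maps.

Lemma sphere_disk_subproof n (x : set_type (sphere_set R n)) :
  \val x \in disk_set R n.
Proof. by case: x => x /set_mem /= e; apply/mem_set; rewrite /disk_set /= e. Qed.

Definition sphere_disk n (x : sphere R n) : disk R n :=
  exist _ (\val (x : set_type (sphere_set R n))) (sphere_disk_subproof x).

Lemma sphere_disk_continuous n : continuous (@sphere_disk n).
Proof.
apply/continuousP => _ [A oA <-].
have -> : @sphere_disk n @^-1` (set_val @^-1` A) =
  (fun x : set_type (sphere_set R n) => \val x) @^-1` A by [].
by apply: open_comp oA => x _; exact: initial_continuous.
Qed.

Definition glob_incl n : mdmap (glob_md (sphere R n)) (glob_md (disk R n)) :=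
  glob_mdmap (@sphere_disk_continuous n).

Definition globF_incl n (F : set (glob R (disk R n))) :
  mdmap (glob_md (sphere R n)) (globF_md F) :=
  globF_mdmap (@sphere_disk_continuous n) F.

Definition map_C : mdmap (discrete_md R void) (discrete_md R unit) :=
  discrete_map R (fun=> tt).
Definition map_R : mdmap (discrete_md R bool) (discrete_md R unit) :=
  discrete_map R (fun=> tt).

Variable k : topcat.

Definition cell_attachment (X Y : mdspace R) (h : mdmap X Y) : Prop :=
  [\/ exists n (a : mdmap (glob_md (sphere R n)) X)
        (b : mdmap (glob_md (disk R n)) Y), is_pushout k (glob_incl n) a b h,
      exists (a : mdmap (discrete_md R void) X)
        (b : mdmap (discrete_md R unit) Y), is_pushout k map_C a b h |
      exists (a : mdmap (discrete_md R bool) X)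
        (b : mdmap (discrete_md R unit) Y), is_pushout k map_R a b h].

(* a diagram indexed by a well-ordered set, i.e. by an ordinal; the images of
   the identities are left implicit *)
Record tower := Tower {
  tw_idx : Type;
  tw_lt : tw_idx -> tw_idx -> Prop;
  tw_wf : well_founded tw_lt;
  tw_trans : forall a b c, tw_lt a b -> tw_lt b c -> tw_lt a c;
  tw_total : forall a b, [\/ tw_lt a b, a = b | tw_lt b a];
  tw_ob : tw_idx -> mdspace R;
  tw_map : forall a b, tw_lt a b -> mdmap (tw_ob a) (tw_ob b);
  tw_map_comp : forall a b c (ab : tw_lt a b) (bc : tw_lt b c) (ac : tw_lt a c),
    tw_map bc \o tw_map ab =1 tw_map ac
}.

Definition is_cocone (D : tower) (P : tw_idx D -> Prop) (X : mdspace R)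
    (c : forall a, P a -> mdmap (tw_ob a) X) : Prop :=
  forall a b (Pa : P a) (Pb : P b) (ab : tw_lt a b), c b Pb \o tw_map ab =1 c a Pa.

(* colimit of the restriction of D to the indices satisfying P *)
Definition is_colimit (D : tower) (P : tw_idx D -> Prop) (X : mdspace R)
    (c : forall a, P a -> mdmap (tw_ob a) X) : Prop :=
  [/\ in_top R k X, is_cocone c &
    forall (Y : mdspace R) (d : forall a, P a -> mdmap (tw_ob a) Y),
      in_top R k Y -> is_cocone d ->
      exists h : mdmap X Y, (forall a Pa, h \o c a Pa =1 d a Pa) /\
        forall h' : mdmap X Y, (forall a Pa, h' \o c a Pa =1 d a Pa) -> h' =1 h].

(* The empty set -> X is a transfinite composition of cell attachments: the
   tower starts with the empty object, its successor steps are cell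
   attachments, it is continuous at limit elements, and X is its colimit. *)
Definition cellular (X : mdspace R) : Prop :=
  exists D : tower, [/\
    forall a : tw_idx D, (forall b, ~ tw_lt b a) -> tw_ob a -> False,
    forall (b a : tw_idx D) (ba : tw_lt b a),
      (forall c, tw_lt b c -> ~ tw_lt c a) -> cell_attachment (tw_map ba),
    forall a : tw_idx D, (exists b, tw_lt b a) ->
      (forall b, tw_lt b a -> exists2 c, tw_lt b c & tw_lt c a) ->
      is_colimit (fun b (ba : tw_lt b a) => tw_map ba) &
    exists c : forall a : tw_idx D, True -> mdmap (tw_ob a) X, is_colimit c].

(* W^n_F together with the choices made to construct it *)
Record Wdata (n : nat) (F : set (glob R (disk R n))) := {
  Vsp : mdspace R;
  v_glob : mdmap (glob_md (disk R n)) Vsp;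
  v_globF : mdmap (globF_md F) Vsp;
  v_pushout : is_pushout k (glob_incl n) (globF_incl F) v_glob v_globF;
  (* the homeomorphism from the union of two disks along their boundary to S^n,
     as a pair of maps exhibiting S^n as this pushout *)
  hemi1 : disk R n -> sphere R n.+1;
  hemi2 : disk R n -> sphere R n.+1;
  hemi_pushout :
    is_top_pushout R k (@sphere_disk n) (@sphere_disk n) hemi1 hemi2;
  theta : mdmap (glob_md (sphere R n.+1))
    (restriction (X := Vsp) (range (v_glob \o glob_end R _)));
  theta_iso : md_iso theta;
  theta1 : forall z t, theta (glob_pt (hemi1 z) t) = v_glob (glob_pt z t);
  theta2 : forall z t, theta (glob_pt (hemi2 z) t) = v_globF (glob_pt z t);
  Wsp : mdspace R;
  w_glob : mdmap (glob_md (disk R n.+1)) Wsp;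
  w_V : mdmap Vsp Wsp;
  w_pushout :
    is_pushout k (glob_incl n.+1) (mdcomp theta (restriction_incl _)) w_glob w_V
}.

(* the map i^n_F *)
Definition Wincl n (F : set (glob R (disk R n))) (D : Wdata F) :
  mdmap (glob_md (disk R n)) (Wsp D) := mdcomp (v_glob D) (w_V D).

(* the state of W^n_F given by an element x of F *)
Definition Wstate n (F : set (glob R (disk R n))) (D : Wdata F)
  (x : glob R (disk R n)) : Wsp D := w_V D (v_globF D x).

Section Statement.
Variables (n : nat) (A X : mdspace R).
Variables (g : mdmap (glob_md (disk R n)) A) (f : mdmap A X).

(* A^0 as a subset of X^0 *)
Definition old_states : set X := f @` states A.

(* [state_plus] and [state_minus] are the maps (-)^+ and (-)^- *)
Definition state_plus (a : X) : A :=
  xget (g (glob_end R _ true)) (states A `&` f @^-1` [set a]).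
Definition state_minus (a : X) : A :=
  xget (g (glob_end R _ false)) (states A `&` f @^-1` [set a]).

(* y is the trace of a directed path from a to b avoiding A^0: either the
   constant path or an execution path *)
Definition avoiding (a b : X) (y : Iplus_hom k a b) : Prop :=
  match y with
  | existT true _ => ~ old_states a
  | existT false q => exists2 p : epaths a b, q = exec_trace k p &
                        forall t, ~ old_states (epaths_fun p t)
  end.

(* the first of the two cases: a and b come from F, and there is an arrow
   between the corresponding states of I^+(cat(W^n_F)) *)
Definition new_case (F : set (glob R (disk R n))) (D : Wdata F)
    (gh : mdmap (Wsp D) X) (a b : X) : Prop :=
  [/\ ~ old_states a, ~ old_states b &
    exists x y, [/\ F x, F y, gh (Wstate D x) = a, gh (Wstate D y) = b &
      exists _ : Iplus_hom k (Wstate D x) (Wstate D y), True]].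

End Statement.
End GlobeMD.

(* Main.v *)
(* |W| is the globe of D^(n+1), with the states F on its lower hemisphere, and A is
   glued along the upper one.  Folding D^(n+1) onto the upper hemisphere makes A a
   deformation retract of X.  Every execution path of X is, up to reparametrization,
   a piece of a line between two states of F, or
   a concatenation of a piece of a line from a state of F up to g(1), of paths that
   the retraction and the homotopy send to execution paths, and of a piece of a line
   from g(0) up to a state of F; in particular this gives the equivalence between two
   states of A.  For a path leaving a state of F, the first piece is erased
   continuously by pushing the path up along the lines, by an amount proportional to
   the running minimum of a function mu that is 0 on A and positive on the open lines
   through F; the path then waits at g(1) until the original one reaches it.  The
   opposite d-space deals with the paths that end at a state of F.

   The two components that split off, the trace tau and the identity, are open and
   closed because a simplex is connected: on tau the minimum of mu is a positive
   constant, whereas it is 0 on the paths that meet A, and the identity of g(1) is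
   separated from the execution paths by a marking, a map A -> [0,1] that is 0 on the
   states and takes the value 1 on every execution path.  Markings exist on cellular
   A by extension over cells.  As the spaces involved are Delta-generated, continuity
   is tested on families indexed by simplices, and only the universal properties of
   the pushouts are used. *)
Require Import Defs.
From mathcomp Require Import all_boot all_order all_algebra.
From mathcomp Require Import all_classical all_reals topology.
From mathcomp Require Import normedtype realfun derive ring lra.

Set Implicit Arguments.
Unset Strict Implicit.
Unset Printing Implicit Defensive.

Import Order.TTheory GRing.Theory Num.Theory.
Import numFieldNormedType.Exports.

Local Open Scope classical_set_scope.
Local Open Scope ring_scope.
Local Open Scope quotient_scope.

(** * Simplices, disks and Delta-generated spaces *)

(** A map out of a space of traces must be continuous, compatible with reparametrization, and
    independent of how a path was decomposed. The instant at which a path reaches g(1) need not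
    depend continuously on the path, so nothing is cut. The running minimum commutes with
    reparametrizations and vanishes from the first visit to A on; pushing by it alters the initial
    piece only, and the wait it creates is absorbed by a reparametrization. Removing a piece is
    therefore a homeomorphism on traces, and homotopies are needed only between two states of A.

    A second obstacle is that X has no explicit description by points. Homotopies on X are built as
    maps from X to the path space of X, which must therefore be shown to lie in Top,
    Delta-Hausdorffness included. Points of the cell are told apart by functions to [0,1] produced
    by the universal property. Quotients taken in Top only receive maps to spaces whose points are
    separated by Top, whence the repeated checks of [top_separated]. *)

Lemma continuous_funD (R : realType) (T : topologicalType) (f g : T -> R) :
  continuous f -> continuous g -> continuous (fun x => f x + g x).
Proof. by move=> cf cg x; apply: (@continuousD R R^o T); [exact: cf|exact: cg]. Qed.

Lemma continuous_funB (R : realType) (T : topologicalType) (f g : T -> R) :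
  continuous f -> continuous g -> continuous (fun x => f x - g x).
Proof. by move=> cf cg x; apply: (@continuousB R R^o T); [exact: cf|exact: cg]. Qed.

Lemma continuous_funM (R : realType) (T : topologicalType) (f g : T -> R) :
  continuous f -> continuous g -> continuous (fun x => f x * g x).
Proof. by move=> cf cg x; apply: continuousM; [exact: cf|exact: cg]. Qed.

Lemma continuous_funV (R : realType) (T : topologicalType) (f : T -> R) :
  (forall x, f x != 0) -> continuous f -> continuous (fun x => (f x)^-1).
Proof. by move=> f0 cf x; apply: continuousV => //; exact: cf. Qed.

Lemma continuous_funmin (R : realType) (T : topologicalType) (f g : T -> R) :
  continuous f -> continuous g -> continuous (fun x => Num.min (f x) (g x)).
Proof. by move=> cf cg x; apply: (@continuous_min _ T f g); [exact: cf|exact: cg]. Qed.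

Lemma continuous_funmax (R : realType) (T : topologicalType) (f g : T -> R) :
  continuous f -> continuous g -> continuous (fun x => Num.max (f x) (g x)).
Proof. by move=> cf cg x; apply: (@continuous_max _ T f g); [exact: cf|exact: cg]. Qed.

Lemma continuous_funsum (R : realType) (T : topologicalType) (J : finType)
    (f : J -> T -> R) :
  (forall i, continuous (f i)) -> continuous (fun x => \sum_i f i x).
Proof.
move=> cf; elim: index_enum => [|j s IHs].
  by under eq_fun do rewrite big_nil; exact: cst_continuous.
by under eq_fun do rewrite big_cons; exact: continuous_funD.
Qed.

Lemma continuous_fun_comp (S T U : topologicalType) (f : S -> T) (g : T -> U) :
  continuous f -> continuous g -> continuous (fun x => g (f x)).
Proof. by move=> cf cg x; apply: continuous_comp; [exact: cf|exact: cg]. Qed.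

Lemma continuous_funX (R : realType) (T : topologicalType) (f : T -> R) n :
  continuous f -> continuous (fun x => f x ^+ n).
Proof. by move=> cf; exact: continuous_fun_comp cf (@exprn_continuous R n). Qed.

Lemma continuous_eq (S T : topologicalType) (f g : S -> T) :
  f =1 g -> continuous g -> continuous f.
Proof. by move=> /funext ->. Qed.

Lemma set_type_continuous (T X : topologicalType) (A : set X) (f : T -> set_type A) :
  continuous (fun x => \val (f x)) -> continuous f.
Proof.
move=> /continuousP cf; apply/continuousP => _ [B oB <-].
exact: cf oB.
Qed.

Lemma set_val_continuous (X : topologicalType) (A : set X) :
  continuous (fun x : set_type A => \val x).
Proof. exact: initial_continuous. Qed.

Lemma fst_continuous (S T : topologicalType) : continuous (@fst S T).
Proof. by move=> x; exact: cvg_fst. Qed.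

Lemma snd_continuous (S T : topologicalType) : continuous (@snd S T).
Proof. by move=> x; exact: cvg_snd. Qed.

Lemma continuous_fun_fst (U S T : topologicalType) (f : U -> S * T) :
  continuous f -> continuous (fun x => (f x).1).
Proof. by move=> cf; exact: continuous_fun_comp cf (@fst_continuous _ _). Qed.

Lemma continuous_fun_snd (U S T : topologicalType) (f : U -> S * T) :
  continuous f -> continuous (fun x => (f x).2).
Proof. by move=> cf; exact: continuous_fun_comp cf (@snd_continuous _ _). Qed.

Lemma id_continuous (T : topologicalType) : continuous (fun x : T => x).
Proof. by move=> x; exact: cvg_id. Qed.

Lemma coord_continuousE (R : realType) n (i : 'I_n) :
  continuous (fun x : 'rV[R]_n => x ord0 i).
Proof. by move=> x; exact: coord_continuous. Qed.

Lemma rV_continuous (R : realType) (T : topologicalType) n (f : T -> 'rV[R]_n) :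
  (forall i, continuous (fun x => f x ord0 i)) -> continuous f.
Proof.
move=> cf x B [P fP PB]; apply: (filterS PB).
apply: (@filterS _ (nbhs x) _ (fun y => forall j, P ord0 j (f y ord0 j))).
  by move=> y h i j; rewrite (ord1 i).
by apply: filter_forall => j; exact: (cf j x _ (fP ord0 j)).
Qed.

(** * The unit interval and currying along it *)

Section UnitInterval.
Variable R : realType.
Local Notation I := (unitI R).

Lemma I_compact : compact [set: I].
Proof.
have -> : [set: I] = clampI (R := R) @` `[0, 1].
  apply/seteqP; split => // t _; exists (\val t); last exact: clampIK.
  by rewrite /= in_itv /= I_ge0 I_le1.
apply: continuous_compact; last exact: segment_compact.
by apply: continuous_subspaceT => x; exact: clampI_continuous.
Qed.

Lemma I_regular : regular_space I.
Proof. exact: uniform_regular. Qed.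

Lemma I_hausdorff : hausdorff_space I.
Proof.
move=> s t st; apply: I_inj; apply: (@Rhausdorff R) => A B As Bt.
have [x [? ?]] := st _ _ (@val_continuous R s _ As) (@val_continuous R t _ Bt).
by exists (\val x).
Qed.

Lemma I_locally_compact : locally_compact [set: I].
Proof.
move=> t _; exists setT; first exact: filterT.
by split; [exact: I_compact|exact: closedT].
Qed.

(** The interval is locally compact and regular, so evaluation is continuous for the compact-open
    topology. Homotopies on coproducts and on spaces of traces are built as maps to function spaces
    and uncurried by this lemma. *)
Lemma continuous_uncurryI (T U : topologicalType) (f : T -> I -> U) :
  continuous (f : T -> {compact-open, I -> U}) -> (forall x, continuous (f x)) ->
  continuous (fun z : T * I => f z.1 z.2).
Proof.
move=> cf cfx.
have -> : (fun z : T * I => f z.1 z.2) = uncurry f by apply/funext => -[].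
exact: continuous_uncurry_regular I_locally_compact I_regular cf cfx.
Qed.

Lemma clampI_val (x : R) : 0 <= x -> x <= 1 -> \val (clampI x) = x.
Proof. by move=> x0 x1; rewrite /= (min_idPl x1) (max_idPr x0). Qed.

Lemma continuous_clampI (T : topologicalType) (f : T -> R) :
  continuous f -> continuous (fun x => clampI (f x)).
Proof. by move=> cf; apply: continuous_fun_comp cf _; exact: clampI_continuous. Qed.

Lemma continuous_valI (T : topologicalType) (f : T -> I) :
  continuous f -> continuous (fun x => \val (f x)).
Proof. by move=> cf; apply: continuous_fun_comp cf _; exact: val_continuous. Qed.

End UnitInterval.

(** A hook of [continuity], extended once the norm and the disks are available. *)
Ltac continuity_norm := fail.

Ltac continuity := lazymatch goal with
  | |- continuous (fun _ => ?c) => exact: cst_continuous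
  | |- continuous (fun x => x) => exact: id_continuous
  | |- continuous (fun x => (_, _)) => apply: pair_continuous; continuity
  | |- continuous (pair ?x) =>
      apply: (pair_continuous (f := fun=> x) (g := fun y => y)); continuity
  | |- continuous (fun x => fst _) => apply: continuous_fun_fst; continuity
  | |- continuous (fun x => snd _) => apply: continuous_fun_snd; continuity
  | |- continuous (fun x => (_ - _)%R) => apply: continuous_funB; continuity
  | |- continuous (fun x => (_ + _)%R) => apply: continuous_funD; continuity
  | |- continuous (fun x => (_ * _)%R) => apply: continuous_funM; continuity
  | |- continuous (fun x => (_ ^+ _)%R) => apply: continuous_funX; continuity
  | |- continuous (fun x => Num.min _ _) => apply: continuous_funmin; continuity
  | |- continuous (fun x => Num.max _ _) => apply: continuous_funmax; continuity
  | |- continuous (fun x => clampI _) => apply: continuous_clampI; continuity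
  | |- continuous (fun x => fun_of_matrix _ _ ?i) =>
      apply: (continuous_fun_comp _ (@coord_continuousE _ _ i)); continuity
  | cf : continuous ?f |- continuous (fun x => ?f _) =>
      apply: (continuous_fun_comp _ cf); continuity
  | _ => first [exact: fst_continuous | exact: snd_continuous | assumption
      | continuity_norm; continuity | apply: continuous_valI; continuity | idtac]
  end.

(** * Retracts of simplices *)

Section SimplexRetract.
Variable R : realType.
Local Notation I := (unitI R).

Definition scoord n (x : simplex R n) : 'rV[R]_n.+1 :=
  \val (x : set_type [set x : 'rV[R]_n.+1 |
    (forall i, 0 <= x ord0 i) /\ \sum_i x ord0 i = 1]).

Lemma scoord_continuous n : continuous (@scoord n).
Proof. exact: set_val_continuous. Qed.

Lemma scoord_ge0 n (x : simplex R n) i : 0 <= scoord x ord0 i.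
Proof. by case: x => x xP; have [x0 _] := set_mem xP; exact: x0. Qed.

Lemma scoord_sum n (x : simplex R n) : \sum_i scoord x ord0 i = 1.
Proof. by case: x => x xP; have [_] := set_mem xP. Qed.

Lemma simplex_lift (T : topologicalType) n (f : T -> 'rV[R]_n.+1) :
  (forall x i, 0 <= f x ord0 i) -> (forall x, \sum_i f x ord0 i = 1) ->
  continuous f ->
  exists2 s : T -> simplex R n, continuous s & forall x, scoord (s x) = f x.
Proof.
move=> f0 f1 cf.
have fP x : f x \in [set x : 'rV[R]_n.+1 |
  (forall i, 0 <= x ord0 i) /\ \sum_i x ord0 i = 1] by apply/mem_set; split.
exists (fun x => exist _ (f x) (fP x)) => //.
exact: set_type_continuous.
Qed.

(** A convenient certificate of Delta-generatedness: one simplex tests all open sets. It covers the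
    interval, the disks, and their products with the interval. *)
Definition simplex_retract (T : topologicalType) : Prop :=
  exists n (s : T -> simplex R n) (p : simplex R n -> T),
    [/\ continuous s, continuous p & cancel s p].

Lemma simplex_retract_delta T : simplex_retract T -> delta_generated R T.
Proof.
move=> [n [s [p [/continuousP cs cp sK]]]] U /(_ n p cp) /cs.
by congr open; apply/funext => x; rewrite /preimage /= sK.
Qed.

Lemma simplex_retract_simplex n : simplex_retract (simplex R n).
Proof. by exists n, id, id; split => // x; exact: cvg_id. Qed.

Lemma simplex_retract_comp (S T : topologicalType) (s : T -> S) (p : S -> T) :
  simplex_retract S -> continuous s -> continuous p -> cancel s p ->
  simplex_retract T.
Proof.
move=> [n [s' [p' [cs' cp' sK']]]] cs cp sK; exists n, (s' \o s), (p \o p').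
split; [exact: continuous_fun_comp|exact: continuous_fun_comp|].
by move=> x /=; rewrite sK' sK.
Qed.

(** The pair (x, t) goes to the row ((1 - t) x, t x), a point of a simplex with twice as many
    coordinates. Adding the two halves recovers x, and the total of the second half recovers t. *)
Lemma simplex_retract_prodI T : simplex_retract T -> simplex_retract (T * I)%type.
Proof.
move=> [n [s [p [cs cp sK]]]].
pose f (z : T * I) : 'rV[R]_(n.+1 + n.+1) :=
  row_mx ((1 - \val z.2) *: scoord (s z.1)) (\val z.2 *: scoord (s z.1)).
have cS := @scoord_continuous n.
have fl z j : f z ord0 (lshift n.+1 j) = (1 - \val z.2) * scoord (s z.1) ord0 j.
  by rewrite /f row_mxEl mxE.
have fr z j : f z ord0 (rshift n.+1 j) = \val z.2 * scoord (s z.1) ord0 j.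
  by rewrite /f row_mxEr mxE.
have [S cS' SE] : exists2 S : T * I -> simplex R (n + n.+1), continuous S &
    forall z, scoord (S z) = f z.
  apply: simplex_lift.
  - move=> z i; case: (@split_ordP n.+1 n.+1 i) => j ->.
      by rewrite fl mulr_ge0 ?scoord_ge0// subr_ge0 I_le1.
    by rewrite fr mulr_ge0 ?scoord_ge0// I_ge0.
  - move=> z; rewrite (@big_split_ord _ _ _ n.+1 n.+1) /=.
    under eq_bigr do rewrite fl; under [X in _ + X]eq_bigr do rewrite fr.
    by rewrite -!mulr_sumr scoord_sum !mulr1 subrK.
  - apply: rV_continuous => i; case: (@split_ordP n.+1 n.+1 i) => j ->.
      by apply: continuous_eq (fl ^~ j) _; continuity.
    by apply: continuous_eq (fr ^~ j) _; continuity.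
pose c (y : simplex R (n + n.+1)) : 'rV[R]_(n.+1 + n.+1) := scoord y.
have cc i : continuous (fun y => c y ord0 i).
  exact: continuous_fun_comp (@scoord_continuous _) (@coord_continuousE R _ i).
have [q cq qE] : exists2 q : simplex R (n + n.+1) -> simplex R n, continuous q &
    forall y, scoord (q y) = lsubmx (c y) + rsubmx (c y).
  apply: simplex_lift.
  - by move=> y i; rewrite !mxE addr_ge0// scoord_ge0.
  - move=> y; rewrite -[RHS](scoord_sum y) [RHS](@big_split_ord _ _ _ n.+1 n.+1) /=.
    by under eq_bigr do rewrite !mxE; rewrite big_split.
  - apply: rV_continuous => i; under eq_fun do rewrite !mxE.
    by apply: continuous_funD; exact: cc.
exists (n + n.+1)%N, S, (fun y => (p (q y), clampI (\sum_i rsubmx (c y) ord0 i))).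
split => //.
  apply: pair_continuous; first exact: continuous_fun_comp.
  apply: continuous_clampI; apply: continuous_funsum => i.
  by under eq_fun do rewrite mxE; exact: cc.
move=> -[x t]; have cE : c (S (x, t)) = f (x, t) by exact: SE.
congr pair.
  rewrite -[RHS]sK; congr p; apply: val_inj; rewrite -[LHS]/(scoord _) qE cE.
  by rewrite row_mxKl row_mxKr -scalerDl subrK scale1r.
rewrite cE row_mxKr; under eq_bigr do rewrite mxE.
by rewrite -mulr_sumr scoord_sum mulr1 clampIK.
Qed.

Lemma simplex_retract_I : simplex_retract I.
Proof.
have := simplex_retract_prodI (simplex_retract_simplex 0).
(* Only provides a point of the 0-simplex. *)
have [x0 _ _] : exists2 s : R -> simplex R 0, continuous s &
    forall x, scoord (s x) = const_mx 1.
  apply: simplex_lift; first by move=> x i; rewrite mxE.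
    by move=> x; rewrite big_ord_recl big_ord0 mxE addr0.
  exact: cst_continuous.
move=> h; apply: (simplex_retract_comp (s := fun t => (x0 0, t)) (p := snd) h) => //.
  by continuity.
exact: snd_continuous.
Qed.

End SimplexRetract.

(** * The Euclidean norm and the disks *)

Section Norm.
Variable R : realType.
Local Notation I := (unitI R).

Definition enorm n (v : 'rV[R]_n) : R := Num.sqrt (\sum_i v ord0 i ^+ 2).

Lemma sum_sqr_ge0 n (v : 'rV[R]_n) : 0 <= \sum_i v ord0 i ^+ 2.
Proof. by apply: sumr_ge0 => i _; exact: sqr_ge0. Qed.

Lemma sqr_enorm n (v : 'rV[R]_n) : enorm v ^+ 2 = \sum_i v ord0 i ^+ 2.
Proof. by rewrite sqr_sqrtr// sum_sqr_ge0. Qed.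

Lemma enorm_ge0 n (v : 'rV[R]_n) : 0 <= enorm v.
Proof. exact: sqrtr_ge0. Qed.

Lemma enormZ n a (v : 'rV[R]_n) : enorm (a *: v) = `|a| * enorm v.
Proof.
rewrite /enorm -sqrtr_sqr -sqrtrM ?sqr_ge0// mulr_sumr; congr Num.sqrt.
by apply: eq_bigr => i _; rewrite mxE exprMn.
Qed.

Lemma coord_le_enorm n (v : 'rV[R]_n) i : `|v ord0 i| <= enorm v.
Proof.
rewrite -sqrtr_sqr ler_sqrt ?sum_sqr_ge0// (bigD1 i)//= lerDl.
by apply: sumr_ge0 => j _; exact: sqr_ge0.
Qed.

Lemma enorm_continuous n : continuous (@enorm n).
Proof.
apply: (continuous_fun_comp _ (@sqrt_continuous R)).
apply: continuous_funsum => i.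
by apply: continuous_funM; exact: coord_continuousE.
Qed.

Lemma disk_enorm n (v : 'rV[R]_n) : disk_set R n v <-> enorm v <= 1.
Proof.
by rewrite /disk_set /= -sqr_enorm -[X in _ <= X](expr1n _ 2) ler_sqr ?nnegrE ?enorm_ge0.
Qed.

Lemma sphere_enorm n (v : 'rV[R]_n) : sphere_set R n v <-> enorm v = 1.
Proof.
rewrite /sphere_set /= -sqr_enorm; split => [/eqP|->]; last by rewrite expr1n.
by rewrite sqrp_eq1 ?enorm_ge0// => /eqP.
Qed.

Lemma disk_convex n (x y : 'rV[R]_n) (s : R) : 0 <= s <= 1 ->
  disk_set R n x -> disk_set R n y -> disk_set R n ((1 - s) *: x + s *: y).
Proof.
move=> /andP[s0 s1]; rewrite /disk_set /= => dx dy.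
apply: (@le_trans _ _ (\sum_i ((1 - s) * x ord0 i ^+ 2 + s * y ord0 i ^+ 2))).
  apply: ler_sum => i _; rewrite !mxE; move: (x ord0 i) (y ord0 i) => a b.
  have -> : (1 - s) * a ^+ 2 + s * b ^+ 2 =
    ((1 - s) * a + s * b) ^+ 2 + s * (1 - s) * (a - b) ^+ 2 by ring.
  by rewrite lerDl mulr_ge0 ?sqr_ge0// mulr_ge0// subr_ge0.
rewrite big_split /= -!mulr_sumr; nra.
Qed.

Definition diskval n (x : disk R n) : 'rV[R]_n := \val (x : set_type (disk_set R n)).
Definition spherev n (x : sphere R n) : 'rV[R]_n :=
  \val (x : set_type (sphere_set R n)).

Lemma diskval_continuous n : continuous (@diskval n).
Proof. exact: set_val_continuous. Qed.

Lemma diskvalP n (x : disk R n) : disk_set R n (diskval x).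
Proof. by case: x => x xP; exact: set_mem xP. Qed.

Lemma spherevP n (x : sphere R n) : sphere_set R n (spherev x).
Proof. by case: x => x xP; exact: set_mem xP. Qed.

Lemma diskval_inj n : injective (@diskval n).
Proof. exact: val_inj. Qed.

Lemma spherev_inj n : injective (@spherev n).
Proof. exact: val_inj. Qed.

Lemma disk_lift (T : topologicalType) n (f : T -> 'rV[R]_n) :
  (forall x, disk_set R n (f x)) -> continuous f ->
  exists2 s : T -> disk R n, continuous s & forall x, diskval (s x) = f x.
Proof.
move=> fD cf; have fP x : f x \in disk_set R n by apply/mem_set.
exists (fun x => exist _ (f x) (fP x)) => //.
exact: set_type_continuous.
Qed.

End Norm.

Ltac continuity_norm ::= first [exact: enorm_continuous | exact: diskval_continuous
  | lazymatch goal with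
    | |- continuous (fun x => enorm _) =>
        apply: (continuous_fun_comp _ (@enorm_continuous _ _))
    | |- continuous (fun x => diskval _) =>
        apply: (continuous_fun_comp _ (@diskval_continuous _ _))
    end].

Section Disk.
Variable R : realType.

(** Dividing by max(1, |v|) turns any continuous map to vectors into a map to the disk, so that maps
    to the disk can be built coordinate by coordinate. *)
Lemma disk_proj n : exists2 p : 'rV[R]_n -> disk R n, continuous p &
  forall x, p (diskval x) = x.
Proof.
pose f (v : 'rV[R]_n) := (Num.max 1 (enorm v))^-1 *: v.
have m0 v : Num.max 1 (enorm v) != 0 :> R.
  by rewrite gt_eqF// lt_max ltr01.
have [p cp pE] : exists2 p : 'rV[R]_n -> disk R n, continuous p &
    forall v, diskval (p v) = f v.
  apply: disk_lift.
    move=> v; apply/disk_enorm; rewrite enormZ ger0_norm; last first.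
      by rewrite invr_ge0 le_max ler01.
    by rewrite mulrC ler_pdivrMr ?mul1r ?le_max ?lexx ?orbT// lt_max ltr01.
  apply: rV_continuous => i.
  under eq_fun do rewrite mxE.
  apply: continuous_funM; last by continuity.
  by apply: continuous_funV => //; continuity.
exists p => // x; apply: diskval_inj; rewrite pE /f.
have /disk_enorm/max_idPl -> := diskvalP x.
by rewrite invr1 scale1r.
Qed.

Lemma simplex_retract_disk n : simplex_retract R (disk R n).
Proof.
(* [d] is the common coordinate of the barycenter; the scale d^2 keeps all coordinates nonnegative
   because d n <= 1. *)
pose d : R := n.+1%:R^-1.
have d0 : 0 < d by rewrite invr_gt0 ltr0n.
(* the disk is embedded affinely around the barycenter of the simplex *)
pose h (y : 'rV[R]_n) (j : option 'I_n) : R :=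
  if j is Some j then d + d ^+ 2 * y ord0 j else d - d ^+ 2 * \sum_j y ord0 j.
pose f (x : disk R n) : 'rV[R]_n.+1 := \row_i h (diskval x) (unlift ord0 i).
have f0 x : f x ord0 ord0 = d - d ^+ 2 * \sum_j diskval x ord0 j.
  by rewrite mxE unlift_none.
have fl x j : f x ord0 (lift ord0 j) = d + d ^+ 2 * diskval x ord0 j.
  by rewrite mxE liftK.
have c1 (x : disk R n) j : `|diskval x ord0 j| <= 1.
  by apply: le_trans (coord_le_enorm _ _) _; exact/disk_enorm/diskvalP.
have dn : d * n.+1%:R = 1 by rewrite mulVf// pnatr_eq0.
have [s cs sE] : exists2 s : disk R n -> simplex R n, continuous s &
    forall x, scoord (s x) = f x.
  apply: simplex_lift.
  - move=> x i; case: (unliftP ord0 i) => [j|] ->.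
      have := c1 x j; rewrite fl ler_norml => /andP[a b].
      have d1 : d <= 1 by rewrite invf_le1 ?ltr0n// ler1n.
      nra.
    rewrite f0; have : \sum_j diskval x ord0 j <= n%:R.
      rewrite -[X in _ <= X%:R]card_ord -sumr_const; apply: ler_sum => j _.
      by have := c1 x j; rewrite ler_norml => /andP[].
    move: dn; rewrite -natr1; nra.
  - move=> x; rewrite big_ord_recl.
    rewrite (eq_bigr (fun j => d + d ^+ 2 * diskval x ord0 j)); last first.
      by move=> j _; exact: fl.
    rewrite f0 big_split /= -mulr_sumr sumr_const card_ord -[d *+ n]mulr_natr.
    by rewrite -[RHS]dn -natr1; ring.
  - apply: rV_continuous => i; case: (unliftP ord0 i) => [j|] ->.
      by apply: continuous_eq (fl ^~ j) _; continuity.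
    by apply: continuous_eq f0 _; continuity; apply: continuous_funsum => j; continuity.
have [p cp pK] := disk_proj n.
pose q (y : simplex R n) : 'rV[R]_n := \row_j ((scoord y ord0 (lift ord0 j) - d) / d ^+ 2).
exists n, s, (p \o q); split => //.
  apply: continuous_fun_comp cp; apply: rV_continuous => i.
  have cS := @scoord_continuous R n.
  by apply: continuous_eq (fun y => mxE _ _ _ _) _; continuity.
move=> x /=; rewrite -[RHS]pK; congr p; apply/rowP => j.
rewrite mxE sE fl; field.
by rewrite gt_eqF.
Qed.

End Disk.

(** * Delta-kelleyfication and path spaces *)

Section Delta.
Variable R : realType.
Local Notation I := (unitI R).

Lemma hausdorff_delta_hausdorff (T : topologicalType) :
  hausdorff_space T -> delta_hausdorff R T.
Proof.
move=> hT g cg; apply: compact_closed => //.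
by apply: continuous_compact (@I_compact R); exact: continuous_subspaceT.
Qed.

Lemma I_in_top k : in_top R k I.
Proof.
have dg := simplex_retract_delta (simplex_retract_I R).
by case: k => //; split => //; exact: hausdorff_delta_hausdorff (@I_hausdorff R).
Qed.

Lemma in_top_delta k (T : topologicalType) : in_top R k T -> delta_generated R T.
Proof. by case: k => // -[]. Qed.

Lemma delta_continuous (S T : topologicalType) (f : S -> T) :
  delta_generated R S ->
  (forall n (s : simplex R n -> S), continuous s -> continuous (f \o s)) ->
  continuous f.
Proof.
move=> dS cf; apply/continuousP => A oA; apply: dS => n s cs.
by have /continuousP := cf n s cs; apply.
Qed.

Lemma kelley_openE (T : topologicalType) (U : set T) :
  open (U : set (kelley R T)) = delta_open R U.
Proof. by []. Qed.

Lemma kelley_lift (S T : topologicalType) (f : S -> T) :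
  delta_generated R S -> continuous f -> continuous (f : S -> kelley R T).
Proof.
move=> dS cf; apply/continuousP => A oA; apply: dS => n s cs.
exact: (oA n (f \o s) (continuous_fun_comp cs cf)).
Qed.

Lemma kelley_id_continuous (T : topologicalType) : continuous (id : kelley R T -> T).
Proof.
apply/continuousP => A oA; rewrite kelley_openE.
by move=> n s /continuousP; apply.
Qed.

Lemma kelley_unlift (S T : topologicalType) (f : S -> kelley R T) :
  continuous f -> continuous (f : S -> T).
Proof. by move=> cf; exact: continuous_fun_comp cf (@kelley_id_continuous T). Qed.

Lemma kelley_delta (T : topologicalType) : delta_generated R (kelley R T).
Proof.
move=> U dU; rewrite kelley_openE => n s cs; apply: dU; apply: kelley_lift => //.
exact/simplex_retract_delta/simplex_retract_simplex.
Qed.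

Lemma simplex_delta n : delta_generated R (simplex R n).
Proof. exact/simplex_retract_delta/simplex_retract_simplex. Qed.

Section TOP.
Variable T : topologicalType.

Lemma TOP_fun_continuous (g : TOP R T) : continuous (TOP_fun g).
Proof. by case: g => g gP; exact: set_mem gP. Qed.

Lemma TOP_fun_inj : injective (@TOP_fun R T).
Proof. exact: val_inj. Qed.

Definition TOP_mk (g : I -> T) (cg : continuous g) : TOP R T :=
  exist _ g (mem_set cg).

Lemma TOP_uncurry (S : topologicalType) (f : S -> TOP R T) :
  continuous f -> continuous (fun z : S * I => TOP_fun (f z.1) z.2).
Proof.
move=> cf; apply: (@continuous_uncurryI R S T (fun x => TOP_fun (f x))).
  exact: (continuous_fun_comp (kelley_unlift cf) (@set_val_continuous _ _)).
by move=> x; exact: TOP_fun_continuous.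
Qed.

Lemma TOP_curry (S : topologicalType) (f : S -> TOP R T) :
  delta_generated R S -> continuous (fun z : S * I => TOP_fun (f z.1) z.2) ->
  continuous f.
Proof.
move=> dS cf; apply: kelley_lift => //; apply: set_type_continuous.
exact: (@continuous_curry_fun _ _ _ _ cf).
Qed.

Lemma TOP_lift (S : topologicalType) (f : S * I -> T) :
  delta_generated R S -> continuous f ->
  exists2 h : S -> TOP R T, continuous h & forall x t, TOP_fun (h x) t = f (x, t).
Proof.
move=> dS cf.
have cfx x : continuous (fun t => f (x, t)).
  by continuity.
exists (fun x => TOP_mk (cfx x)) => //; apply: TOP_curry => //.
by apply: (continuous_eq (g := f)) => // -[].
Qed.

Lemma clampI_dist (x : R) (t : I) : `|\val (clampI x) - \val t| <= `|x - \val t|.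
Proof.
have := I_ge0 t; have := I_le1 t; move: (\val t) => y y1 y0.
have [x0|x0] := leP x 0.
  by rewrite clampI_le0//= sub0r normrN (ger0_norm y0) ler0_norm; lra.
have [x1|x1] := leP 1 x; last by rewrite clampI_val// ltW.
by rewrite clampI_ge1//= (@ger0_norm _ (1 - y)) ?ger0_norm; lra.
Qed.

(** Delta-Hausdorffness only makes images of the interval closed, so neighbourhoods in the interval
    are needed in the form of ranges of continuous maps. *)
Lemma I_nbhs_segment (t : I) (O : set I) : nbhs t O ->
  exists h : I -> I, [/\ continuous h, range h `<=` O & nbhs t (range h)].
Proof.
move=> /nbhs_interior; rewrite {1}nbhsE => -[_ [[B oB <-] Bt] BO].
have /nbhs_ballP[e /= e0 eB] := open_nbhs_nbhs (conj oB Bt).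
pose h (w : I) : I := clampI (\val t + e * (\val w - 2^-1)).
exists h; split.
- by rewrite /h; continuity; exact: val_continuous.
- move=> _ [w _ <-]; apply: interior_subset; apply: BO; apply: eB.
  rewrite -ball_normE /= /h distrC (le_lt_trans (clampI_dist _ _))//.
  have := I_ge0 w; have := I_le1 w; move: (\val w) => y y1 y0.
  rewrite addrAC subrr add0r normrM (gtr0_norm e0) gtr_pMr//.
  by rewrite ltr_norml; apply/andP; split; lra.
- have : nbhs (\val t) [set y | `|\val t - y| < e / 2].
    have := @nbhsx_ballx _ R^o (\val t) (e / 2); rewrite -ball_normE; apply.
    by rewrite divr_gt0.
  move=> /(@val_continuous R t) ht.
  have ht' : nbhs t [set s : I | `|\val t - \val s| < e / 2] by exact: ht.
  apply: (filterS _ ht') => s /= st.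
  have se : `|(\val s - \val t) / e| <= 2^-1.
    by rewrite normrM normfV (gtr0_norm e0) ler_pdivrMr// mulrC distrC ltW.
  exists (clampI ((\val s - \val t) / e + 2^-1)) => //.
  rewrite /h clampI_val.
  - by rewrite addrK mulrCA divff ?gt_eqF// mulr1 addrC subrK clampIK.
  - by move: se; rewrite ler_norml => /andP[]; lra.
  - by move: se; rewrite ler_norml => /andP[]; lra.
Qed.

(** If a path x differs from every g t, then for each t it differs from g t at some instant u, and a
    segment J around t keeps g(J)(u) away from x(u). The image g(J)(u) is closed in T, so the paths
    near x avoid g(J); compactness of the interval then handles all t at once. This puts path spaces
    in Top in the Delta-Hausdorff case, as lifting homotopies through a pushout requires. *)
Lemma TOP_delta_hausdorff : delta_hausdorff R T -> delta_hausdorff R (TOP R T).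
Proof.
move=> hT g cg.
have pt_closed (y : T) : closed [set y].
  have -> : [set y] = range (fun _ : I => y).
    by apply/seteqP; split => [_ ->|_ [? _ <-]] //; exists I0.
  by apply: hT; exact: cst_continuous.
rewrite -openC; apply: kelley_delta => n s cs.
rewrite openE => x /= gx.
have cF := TOP_uncurry cs; have cG := TOP_uncurry cg.
have cu (S : topologicalType) (f : S * I -> T) (u : I) : continuous f ->
    continuous (fun x => f (x, u)).
  by move=> cf; continuity.
suff : \forall x' \near x, [set: I] `<=` (fun t => s x' <> g t).
  move=> hx; change (nbhs x (s @^-1` ~` range g)); apply: filterS hx.
  by move=> x' h [t _ e]; exact: (h t).
have /compact_near_coveringP/(_ _ (nbhs x) (fun x' t => s x' <> g t)) := @I_compact R.
apply => t _.
have [u ne] : exists u, TOP_fun (s x) u <> TOP_fun (g t) u.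
  apply: contrapT => /forallNP h; apply: gx; exists t => //.
  by apply/TOP_fun_inj/funext => u; have /contrapT -> := h u.
have gt : nbhs t ((fun t => TOP_fun (g t) u) @^-1` ~` [set TOP_fun (s x) u]).
  apply: (cu _ _ u cG); apply: open_nbhs_nbhs.
  by split; [exact: closed_openC|move=> /= /esym].
have [h [ch hO ht]] := I_nbhs_segment gt.
have cJ : closed (range (fun w => TOP_fun (g (h w)) u)).
  exact/hT/(continuous_fun_comp ch (cu _ _ u cG)).
exists (range h, (fun x => TOP_fun (s x) u) @^-1` ~` range (fun w => TOP_fun (g (h w)) u)).
  split => //=; apply: (cu _ _ u cF); apply: open_nbhs_nbhs.
  split; first exact: closed_openC.
  by move=> [w _ e]; apply: (hO (h w)); [exists w|exact: e].
move=> [t' x'] /= [[w _ <-] nx'] e; apply: nx'; exists w => //.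
by rewrite e.
Qed.

Lemma TOP_in_top k : in_top R k T -> in_top R k (TOP R T).
Proof.
case: k => /=; first by move=> _; exact: kelley_delta.
by move=> [_ hT]; split; [exact: kelley_delta|exact: TOP_delta_hausdorff].
Qed.

End TOP.
End Delta.

(** * Homeomorphisms and coproducts *)

Section Homeo.
Variable R : realType.
Local Notation I := (unitI R).

Definition homeo (T U : topologicalType) : Prop :=
  exists (f : T -> U) (g : U -> T),
    [/\ continuous f, continuous g, cancel f g & cancel g f].

Lemma homeo_sym T U : homeo T U -> homeo U T.
Proof. by move=> [f [g [cf cg fK gK]]]; exists g, f. Qed.

Lemma homeo_trans T U V : homeo T U -> homeo U V -> homeo T V.
Proof.
move=> [f [g [cf cg fK gK]]] [f' [g' [cf' cg' fK' gK']]].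
exists (f' \o f), (g \o g'); split; [| |exact: can_comp|exact: can_comp].
- exact: continuous_fun_comp cf cf'.
- exact: continuous_fun_comp cg' cg.
Qed.

Lemma homeo_homotopy_equivalent T U V :
  homeo T U -> homotopy_equivalent R U V -> homotopy_equivalent R T V.
Proof.
move=> [p [q [cp cq pK qK]]] [f [g [cf cg [H [cH H0 H1]] [G [cG G0 G1]]]]].
exists (f \o p), (q \o g); split.
- exact: continuous_fun_comp cp cf.
- exact: continuous_fun_comp cg cq.
- exists (fun z => q (H (p z.1, z.2))); split.
  + by continuity.
  + by move=> x; rewrite H0.
  + by move=> x; rewrite H1 /= pK.
- by exists G; split => // x; rewrite G0 /= qK.
Qed.

Definition coprod_case (T U Z : topologicalType) (f : T -> Z) (g : U -> Z)
    (w : coprod T U) : Z :=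
  match w with existT true x => f x | existT false y => g y end.

Lemma coprod_ind (T U : topologicalType) (P : coprod T U -> Prop) :
  (forall x, P (inL U x)) -> (forall y, P (inR T y)) -> forall w, P w.
Proof. by move=> pL pR [[]]. Qed.

Lemma coprod_case_continuous (T U Z : topologicalType) (f : T -> Z) (g : U -> Z) :
  continuous f -> continuous g -> continuous (coprod_case f g).
Proof.
move=> /continuousP cf /continuousP cg; apply/continuousP => A oA.
by apply/sigT_openP => -[]; [exact: cf|exact: cg].
Qed.

Lemma inL_continuous T U : continuous (@inL T U).
Proof. exact: (@existT_continuous _ (fun b : bool => if b then T else U) true). Qed.

Lemma inR_continuous T U : continuous (@inR T U).
Proof. exact: (@existT_continuous _ (fun b : bool => if b then T else U) false). Qed.

Definition coprod_map (T T' U U' : topologicalType) (f : T -> T') (g : U -> U') :=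
  coprod_case (fun x => inL U' (f x)) (fun y => inR T' (g y)).

Lemma coprod_map_continuous (T T' U U' : topologicalType) (f : T -> T') (g : U -> U') :
  continuous f -> continuous g -> continuous (coprod_map f g).
Proof.
move=> cf cg; apply: coprod_case_continuous.
- exact: continuous_fun_comp cf (@inL_continuous _ _).
- exact: continuous_fun_comp cg (@inR_continuous _ _).
Qed.

Lemma homeo_coprod0 (T U : topologicalType) :
  (T -> False) -> homeo (coprod T U) U.
Proof.
move=> T0; exists (coprod_case (fun x => False_rect U (T0 x)) id), (@inR T U).
split; [|exact: inR_continuous| |by []].
  by apply: coprod_case_continuous => x; [case: (T0 x)|exact: cvg_id].
by elim/coprod_ind => x //; case: (T0 x).
Qed.

Lemma continuous_curryI (T U : topologicalType) (H : T * I -> U) :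
  continuous H -> continuous ((fun x t => H (x, t)) : T -> {compact-open, I -> U}).
Proof. exact: continuous_curry_fun. Qed.

Lemma continuous_pairl (S T U : topologicalType) (f : S * T -> U) (x : S) :
  continuous f -> continuous (fun t => f (x, t)).
Proof. by move=> cf; continuity. Qed.

Lemma continuous_pairr (S T U : topologicalType) (f : S * T -> U) (y : T) :
  continuous f -> continuous (fun x => f (x, y)).
Proof. by move=> cf; continuity. Qed.

(** The product of a coproduct with the interval is not split into summands; the homotopy is defined
    by cases as a map to a function space and then uncurried. *)
Lemma homotopic_coprod_inR (T U : topologicalType) (f : U -> U) (F : coprod T U -> coprod T U) :
  F =1 coprod_map id f ->
  homotopic R f idfun -> homotopic R F idfun.
Proof.
move=> FE [H [cH H0 H1]].
pose m := @coprod_case T U {compact-open, I -> coprod T U}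
  (fun x t => inL U x) (fun y t => inR T (H (y, t))).
have cm : continuous m.
  apply: coprod_case_continuous.
    apply: (@continuous_curryI _ _ (fun z : T * I => inL U z.1)).
    exact: continuous_fun_comp (@fst_continuous _ _) (@inL_continuous _ _).
  apply: (@continuous_curryI _ _ (fun z : U * I => inR T (H z))).
  exact: continuous_fun_comp cH (@inR_continuous _ _).
have cmx w : continuous (m w).
  elim/coprod_ind: w => x; first exact: cst_continuous.
  change (continuous (fun t => inR T (H (x, t)))).
  apply: (@continuous_fun_comp I U (coprod T U) (fun t => H (x, t)) (@inR T U)).
    exact: (@continuous_pairl U I U H x cH).
  exact: inR_continuous.
exists (fun z => m z.1 z.2); split; first exact: continuous_uncurryI.
  by elim/coprod_ind => x; rewrite FE //= H0.
by elim/coprod_ind => x //=; rewrite H1.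
Qed.

Lemma homotopy_equivalent_coprodr (T U V : topologicalType) :
  homotopy_equivalent R U V -> homotopy_equivalent R (coprod T U) (coprod T V).
Proof.
have cid (S : topologicalType) : continuous (id : S -> S) by move=> x; exact: cvg_id.
move=> [f [g [cf cg hgf hfg]]]; exists (coprod_map id f), (coprod_map id g).
split; [exact: coprod_map_continuous|exact: coprod_map_continuous| |].
- by apply: homotopic_coprod_inR hgf; elim/coprod_ind.
- by apply: homotopic_coprod_inR hfg; elim/coprod_ind.
Qed.

End Homeo.

(** * Maps out of the quotients taken in Top *)

Section Separated.
Variables (R : realType) (k : topcat).
Local Notation I := (unitI R).

(* points are separated by the continuous maps to the spaces of Top, so that
   maps to Z factor through the quotients taken in Top *)
Definition top_separated (Z : topologicalType) : Prop :=
  forall x y : Z, (forall (Y : topologicalType) (h : Z -> Y), in_top R k Y ->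
    continuous h -> h x = h y) -> x = y.

Lemma top_separated_coprod T U :
  top_separated T -> top_separated U -> top_separated (coprod T U).
Proof.
move=> sT sU x y; elim/coprod_ind: x => x; elim/coprod_ind: y => y h.
- congr inL; apply: sT => Y f Yk cf.
  apply: (h Y (coprod_case f (fun=> f x)) Yk).
  by apply: coprod_case_continuous => //; exact: cst_continuous.
- exfalso; apply: (@I0_neq_I1 R).
  apply: (h _ (coprod_case (fun=> I0 : I) (fun=> I1 : I)) (I_in_top R k)).
  by apply: coprod_case_continuous; exact: cst_continuous.
- exfalso; apply: (@I0_neq_I1 R); apply/esym.
  apply: (h _ (coprod_case (fun=> I0 : I) (fun=> I1 : I)) (I_in_top R k)).
  by apply: coprod_case_continuous; exact: cst_continuous.
- congr inR; apply: sU => Y f Yk cf.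
  apply: (h Y (coprod_case (fun=> f x) f) Yk).
  by apply: coprod_case_continuous => //; exact: cst_continuous.
Qed.

(** Evaluations are continuous and separate functions. With this, a whole homotopy can be descended
    to a quotient as one map. *)
Lemma top_separated_compact_open Z :
  top_separated Z -> top_separated {compact-open, I -> Z}.
Proof.
move=> sZ f g h; apply/funext => t; apply: sZ => Y u Yk cu.
apply: (h Y (fun f => u (f t)) Yk).
apply: (@continuous_fun_comp _ Z Y (fun f : {compact-open, I -> Z} => f t) u) cu.
apply/continuousP => A oA.
have -> : (fun f : {compact-open, I -> Z} => f t) @^-1` A =
    [set f : {compact-open, I -> Z} | f @` [set t] `<=` A].
  by apply/seteqP; split => f' /=; [move=> ? _ [_ -> <-]|apply; exists t].
by apply: compact_open_open => //; exact: compact_set1.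
Qed.

Section TopQuotient.
Variables (T : topologicalType) (r : T -> T -> Prop).

Lemma tquot_piP (x y : T) : tquot_pi R k r x = tquot_pi R k r y <->
  forall (Y : topologicalType) (f : T -> Y), in_top R k Y -> continuous f ->
    (forall a b, r a b -> f a = f b) -> f x = f y.
Proof.
split; first by move=> /eqmodP /asboolP.
by move=> h; apply/eqmodP/asboolP.
Qed.

Lemma tquot_pi_continuous : continuous (tquot_pi R k r).
Proof. exact: pi_continuous. Qed.

Lemma tquot_pi_surj (q : tquot R k r) : exists x, q = tquot_pi R k r x.
Proof. by exists (repr q); rewrite /tquot_pi reprK. Qed.

Lemma tquot_lift (Z : topologicalType) (G : T -> Z) :
  top_separated Z -> continuous G -> (forall a b, r a b -> G a = G b) ->
  exists2 F : tquot R k r -> Z, continuous F & forall x, F (tquot_pi R k r x) = G x.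
Proof.
move=> sZ cG rG.
have h x y : tquot_pi R k r x = tquot_pi R k r y -> G x = G y.
  move=> /tquot_piP e; apply: sZ => Y f Yk cf.
  apply: (e Y (f \o G) Yk); first exact: continuous_fun_comp cG cf.
  by move=> a b /rG /= ->.
exists (G \o repr).
  have := @repr_comp_continuous T (tquot R k r) Z G cG; apply.
  by move=> x y /eqP e; apply/eqP/h.
by move=> x /=; apply: h; rewrite /tquot_pi reprK.
Qed.

Lemma top_separated_tquot : top_separated (tquot R k r).
Proof.
move=> p q; have [x ->] := tquot_pi_surj p; have [y ->] := tquot_pi_surj q => h.
apply/tquot_piP => Y f Yk cf rf.
pose g : tquot R k r -> Y := f \o repr.
have e z : g (tquot_pi R k r z) = f z.
  rewrite /g /=; have /tquot_piP/(_ Y f Yk cf rf) // :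
    tquot_pi R k r (repr (tquot_pi R k r z)) = tquot_pi R k r z.
  by rewrite /tquot_pi reprK.
rewrite -!e; apply: h => //.
have := @repr_comp_continuous T (tquot R k r) Y f cf; apply.
by move=> u v /eqP uv; apply/eqP; have /tquot_piP := uv; apply.
Qed.

End TopQuotient.

End Separated.

(** * Reparametrizations *)

Section Reparam.
Variable R : realType.
Local Notation I := (unitI R).

Lemma continuous_clamp_ext (f : I -> R) : continuous f ->
  continuous (fun x : R => f (clampI x)).
Proof. by move=> cf; exact: continuous_fun_comp (@clampI_continuous R) cf. Qed.

Lemma I_IVT (f : I -> R) (v : R) : continuous f -> f I0 <= v -> v <= f I1 ->
  exists t, f t = v.
Proof.
move=> cf f0 f1; have h : {within `[0, 1], continuous (fun x : R => f (clampI x))}.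
  by apply: continuous_subspaceT => x; exact: continuous_clamp_ext.
have e0 : clampI (0 : R) = I0 by exact: clampI_le0.
have e1 : clampI (1 : R) = I1 by exact: clampI_ge1.
have [|c _ <-] := @IVT R _ 0 1 v ler01 h; last by exists (clampI c).
by rewrite e0 e1 ge_min f0 le_max f1 orbT.
Qed.

Lemma reparam_of (phi : I -> I) : continuous phi -> nondecreasingI phi ->
  phi I0 = I0 -> phi I1 = I1 -> reparam phi.
Proof.
move=> cphi nphi e0 e1; split => // t.
have [s sE] : exists s, \val (phi s) = \val t.
  by apply: I_IVT; rewrite ?e0 ?e1 ?I_ge0 ?I_le1//; exact: continuous_valI.
by exists s; exact: I_inj.
Qed.

Lemma reparam_id : reparam (id : I -> I).
Proof. by apply: reparam_of => // t; exact: cvg_id. Qed.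

Lemma continuous_affine_val (a b : R) : continuous (fun t : I => a * \val t + b).
Proof. by continuity; exact: val_continuous. Qed.

(** The halves t/2 and (t + 1)/2 of the interval; paths are compared half by half through [eq_half].
    The summand 0 gives both maps the shape of [continuous_affine_val]. *)
Definition Ileft (t : I) : I := clampI (2^-1 * \val t + 0).
Definition Iright (t : I) : I := clampI (2^-1 * \val t + 2^-1).

Arguments Ileft : simpl never.
Arguments Iright : simpl never.

Lemma val_Ileft t : \val (Ileft t) = \val t / 2.
Proof. by have := I_ge0 t; have := I_le1 t => *; rewrite clampI_val; lra. Qed.

Lemma val_Iright t : \val (Iright t) = (\val t + 1) / 2.
Proof. by have := I_ge0 t; have := I_le1 t => *; rewrite clampI_val; lra. Qed.

Lemma Ileft_continuous : continuous Ileft.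
Proof. by apply: continuous_clampI; exact: continuous_affine_val. Qed.

Lemma Iright_continuous : continuous Iright.
Proof. by apply: continuous_clampI; exact: continuous_affine_val. Qed.

Lemma Ileft_nondecreasing : nondecreasingI Ileft.
Proof. by move=> s t; rewrite !val_Ileft; lra. Qed.

Lemma Iright_nondecreasing : nondecreasingI Iright.
Proof. by move=> s t; rewrite !val_Iright; lra. Qed.

Lemma Ileft0 : Ileft I0 = I0.
Proof. by apply: I_inj; rewrite val_Ileft mul0r. Qed.

Lemma Iright1 : Iright I1 = I1.
Proof. by apply: I_inj; rewrite val_Iright /=; lra. Qed.

Lemma nondecreasingI_comp (f g : I -> I) :
  nondecreasingI f -> nondecreasingI g -> nondecreasingI (f \o g).
Proof. by move=> nf ng s t st; apply/nf/ng. Qed.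

Let cL := Ileft_continuous.
Let cR := Iright_continuous.
Let nL := Ileft_nondecreasing.
Let nR := Iright_nondecreasing.

Definition reparam_cat (phi psi : I -> I) : I -> I :=
  ncomp (Ileft \o phi) (Iright \o psi).

Lemma Ileft1_Iright0 : Ileft I1 = Iright I0.
Proof. by apply: I_inj; rewrite val_Ileft val_Iright /= add0r. Qed.

Lemma reparam_catP phi psi : reparam phi -> reparam psi ->
  reparam (reparam_cat phi psi).
Proof.
move=> rphi rpsi; have [c1 n1 _] := rphi; have [c2 n2 _] := rpsi.
have e : (Ileft \o phi) I1 = (Iright \o psi) I0.
  by rewrite /= reparam1// reparam0// Ileft1_Iright0.
apply: reparam_of.
- by apply: ncomp_continuous => //; exact: continuous_fun_comp.
- by apply: ncomp_nondecreasing => //; exact: nondecreasingI_comp.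
- by rewrite /reparam_cat ncomp0 /= reparam0// Ileft0.
- by rewrite /reparam_cat ncomp1 /= reparam1// Iright1.
Qed.

Section Paths.
Variable T : Type.
Implicit Types p q : I -> T.

Lemma ncomp_Ileft p q t : ncomp p q (Ileft t) = p t.
Proof.
have := I_ge0 t; have := I_le1 t => t1 t0; rewrite /ncomp val_Ileft.
rewrite ifT; last lra.
by congr p; rewrite mulrC divfK ?pnatr_eq0// clampIK.
Qed.

Lemma ncomp_Iright p q t : p I1 = q I0 -> ncomp p q (Iright t) = q t.
Proof.
have := I_ge0 t; have := I_le1 t => t1 t0 pq; rewrite /ncomp val_Iright.
have e2 : 2 * ((\val t + 1) / 2) = \val t + 1 by rewrite mulrC divfK ?pnatr_eq0.
case: ifPn => h; rewrite e2.
  have t00 : \val t = 0 by lra.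
  by rewrite t00 add0r clampI_ge1// pq; congr q; apply: I_inj; rewrite t00.
by rewrite addrK clampIK.
Qed.

Lemma I_halfP (t : I) : (exists s, t = Ileft s) \/ (exists s, t = Iright s).
Proof.
have := I_ge0 t; have := I_le1 t => t1 t0.
have [h|h] := leP (\val t) 2^-1; [left|right].
  exists (clampI (2 * \val t)); apply: I_inj.
  by rewrite val_Ileft clampI_val; lra.
exists (clampI (2 * \val t - 1)); apply: I_inj.
by rewrite val_Iright clampI_val; lra.
Qed.

Lemma eq_half p q : (forall t, p (Ileft t) = q (Ileft t)) ->
  (forall t, p (Iright t) = q (Iright t)) -> p = q.
Proof. by move=> h1 h2; apply/funext => t; have [[s ->]|[s ->]] := I_halfP t. Qed.

End Paths.

Lemma reparam_cat_Ileft phi psi t : reparam_cat phi psi (Ileft t) = Ileft (phi t).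
Proof. exact: ncomp_Ileft. Qed.

Lemma reparam_cat_Iright phi psi t : phi I1 = I1 -> psi I0 = I0 ->
  reparam_cat phi psi (Iright t) = Iright (psi t).
Proof.
by move=> e1 e2; rewrite /reparam_cat ncomp_Iright//= e1 e2 Ileft1_Iright0.
Qed.

Section MorePaths.
Variable T : Type.
Implicit Types p q : I -> T.

Lemma ncomp_reparam p q phi psi : reparam phi -> reparam psi -> p I1 = q I0 ->
  ncomp (p \o phi) (q \o psi) = ncomp p q \o reparam_cat phi psi.
Proof.
move=> rphi rpsi pq; apply: eq_half => t /=.
  by rewrite reparam_cat_Ileft !ncomp_Ileft.
rewrite reparam_cat_Iright ?reparam1 ?reparam0// !ncomp_Iright//=.
by rewrite reparam1// reparam0.
Qed.

(** A constant path followed by q is q composed with [skip]: waiting at the start is a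
    reparametrization. *)
Definition skip (t : I) : I := clampI (2 * \val t - 1).

Arguments skip : simpl never.

Lemma skip_reparam : reparam skip.
Proof.
apply: reparam_of.
- by apply: continuous_clampI; exact: continuous_affine_val.
- by move=> s t st; apply: clampI_le; lra.
- by rewrite /skip clampI_le0//=; lra.
- by rewrite /skip clampI_ge1//=; lra.
Qed.

Lemma skip_Ileft t : skip (Ileft t) = I0.
Proof. by rewrite /skip clampI_le0// val_Ileft; have := I_le1 t; lra. Qed.

Lemma skip_Iright t : skip (Iright t) = t.
Proof. by rewrite /skip -[RHS]clampIK; congr clampI; rewrite val_Iright; lra. Qed.

Definition assocr (t : I) : I := ncomp (ncomp Ileft (Iright \o Ileft)) (Iright \o Iright) t.

Lemma assocr_reparam : reparam assocr.
Proof.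
have e1 : Ileft I1 = (Iright \o Ileft) I0 by rewrite /= Ileft0 Ileft1_Iright0.
have e2 : ncomp Ileft (Iright \o Ileft) I1 = (Iright \o Iright) I0.
  by rewrite ncomp1 /= Ileft1_Iright0.
apply: reparam_of.
- apply: ncomp_continuous => //; last exact: continuous_fun_comp cR cR.
  by apply: ncomp_continuous => //; exact: continuous_fun_comp cL cR.
- apply: ncomp_nondecreasing => //; last exact: nondecreasingI_comp.
  by apply: ncomp_nondecreasing => //; exact: nondecreasingI_comp.
- by rewrite /assocr !ncomp0 Ileft0.
- by rewrite /assocr ncomp1 /= !Iright1.
Qed.

Lemma ncomp_assocr p q r : p I1 = q I0 -> q I1 = r I0 ->
  ncomp (ncomp p q) r = ncomp p (ncomp q r) \o assocr.
Proof.
move=> pq qr.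
have a1 : Ileft I1 = (Iright \o Ileft) I0 by rewrite /= Ileft0 Ileft1_Iright0.
have a2 : ncomp Ileft (Iright \o Ileft) I1 = (Iright \o Iright) I0.
  by rewrite ncomp1 /= Ileft1_Iright0.
have e1 : p I1 = ncomp q r I0 by rewrite ncomp0.
have e2 : ncomp p q I1 = r I0 by rewrite ncomp1.
apply: eq_half => t /=; rewrite /assocr.
  rewrite !ncomp_Ileft; have [[s ->]|[s ->]] := I_halfP t.
    by rewrite !ncomp_Ileft.
  by rewrite (ncomp_Iright s a1) /= !ncomp_Iright// ncomp_Ileft.
by rewrite (ncomp_Iright t a2) /= !ncomp_Iright.
Qed.

Definition Irev (t : I) : I := clampI (-1 * \val t + 1).

Arguments Irev : simpl never.

Lemma val_Irev t : \val (Irev t) = 1 - \val t.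
Proof. by have := I_ge0 t; have := I_le1 t => *; rewrite clampI_val; lra. Qed.

Lemma IrevK : involutive Irev.
Proof. by move=> t; apply: I_inj; rewrite !val_Irev; lra. Qed.

Lemma Irev0 : Irev I0 = I1.
Proof. by apply: I_inj; rewrite val_Irev subr0. Qed.

Lemma Irev1 : Irev I1 = I0.
Proof. by apply: I_inj; rewrite val_Irev subrr. Qed.

Lemma Irev_continuous : continuous Irev.
Proof. by apply: continuous_clampI; exact: continuous_affine_val. Qed.

Lemma Irev_Ileft t : Irev (Ileft t) = Iright (Irev t).
Proof. by apply: I_inj; rewrite val_Irev val_Ileft val_Iright val_Irev; lra. Qed.

Lemma Irev_Iright t : Irev (Iright t) = Ileft (Irev t).
Proof. by apply: I_inj; rewrite val_Irev val_Ileft val_Iright val_Irev; lra. Qed.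

Lemma ncomp_rev p q : p I1 = q I0 ->
  ncomp p q \o Irev = ncomp (q \o Irev) (p \o Irev).
Proof.
move=> pq; have e : (q \o Irev) I1 = (p \o Irev) I0 by rewrite /= Irev0 Irev1.
apply: eq_half => t /=; first by rewrite Irev_Ileft ncomp_Ileft ncomp_Iright.
by rewrite Irev_Iright ncomp_Ileft ncomp_Iright.
Qed.

End MorePaths.

Lemma reparam_rev phi : reparam phi -> reparam (Irev \o phi \o Irev).
Proof.
move=> rphi; have [cphi nphi _] := rphi; apply: reparam_of.
- apply: (@continuous_fun_comp _ _ _ (phi \o Irev) Irev); last exact: Irev_continuous.
  exact: continuous_fun_comp Irev_continuous cphi.
- move=> s t st.
  change (\val (Irev (phi (Irev s))) <= \val (Irev (phi (Irev t)))).
  rewrite 2!val_Irev lerD2l lerN2; apply: nphi.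
  by rewrite !val_Irev lerD2l lerN2.
- by rewrite /= Irev0 reparam1// Irev1.
- by rewrite /= Irev1 reparam0// Irev0.
Qed.

(** Reversal exchanges the two bracketings of a triple concatenation, so this one is the conjugate
    of [assocr]. *)
Definition assocl : I -> I := Irev \o assocr \o Irev.

Lemma assocl_reparam : reparam assocl.
Proof. by apply: reparam_rev; exact: assocr_reparam. Qed.

Lemma ncomp_assocl T (p q r : I -> T) : p I1 = q I0 -> q I1 = r I0 ->
  ncomp p (ncomp q r) = ncomp (ncomp p q) r \o assocl.
Proof.
move=> pq qr; have e : ncomp p q I1 = r I0 by rewrite ncomp1.
have pe : p I1 = ncomp q r I0 by rewrite ncomp0.
have IK (u : I -> T) : (u \o Irev) \o Irev = u by apply/funext => t /=; rewrite IrevK.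
rewrite -[LHS]IK (ncomp_rev pe) (ncomp_rev qr) ncomp_assocr /= ?Irev0 ?Irev1//.
by rewrite -(ncomp_rev pq) -(ncomp_rev e).
Qed.

Section Affine.
Implicit Types u v t : I.

Definition affineI u v t : I := clampI ((\val v - \val u) * \val t + \val u).

Lemma val_affineI u v t : \val (affineI u v t) = (\val v - \val u) * \val t + \val u.
Proof.
rewrite /affineI; have := I_ge0 u; have := I_le1 u; have := I_ge0 v; have := I_le1 v.
have := I_ge0 t; have := I_le1 t; move: (\val u) (\val v) (\val t) => a b x *.
have -> : (b - a) * x + a = (1 - x) * a + x * b by ring.
have yx : (1 - x) * a <= 1 - x by rewrite ler_piMr// subr_ge0.
have xb : x * b <= x by rewrite ler_piMr.
apply: clampI_val; last by lra.
by apply: addr_ge0; apply: mulr_ge0 => //; rewrite subr_ge0.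
Qed.

Lemma affineI_continuous u v : continuous (affineI u v).
Proof. by apply: continuous_clampI; exact: continuous_affine_val. Qed.

Lemma affineI0 u v : affineI u v I0 = u.
Proof. by rewrite /affineI /= mulr0 add0r clampIK. Qed.

Lemma affineI1 u v : affineI u v I1 = v.
Proof. by rewrite /affineI /= mulr1 subrK clampIK. Qed.

Lemma affineI_nondecreasing u v : \val u <= \val v -> nondecreasingI (affineI u v).
Proof.
move=> uv s t st; apply: clampI_le; rewrite lerD2r; apply: ler_wpM2l => //.
by rewrite subr_ge0.
Qed.

(** Consequently all nondecreasing paths along a line with the same two distinct ends have the same
    trace. *)
Lemma nondecreasing_affineI (psi : I -> I) : continuous psi -> nondecreasingI psi ->
  \val (psi I0) < \val (psi I1) ->
  exists2 phi, reparam phi & psi = affineI (psi I0) (psi I1) \o phi.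
Proof.
move=> cpsi npsi; set u := psi I0; set v := psi I1; rewrite -subr_gt0 => d0.
pose phi t : I := clampI ((\val v - \val u)^-1 * (\val (psi t) - \val u)).
exists phi.
  apply: reparam_of.
  - by rewrite /phi; continuity.
  - move=> s t st; apply: clampI_le; rewrite ler_wpM2l ?invr_ge0 ?(ltW d0)//.
    by rewrite lerD2r; exact: npsi.
  - by rewrite /phi subrr mulr0 clampI_le0.
  - by rewrite /phi mulVf ?gt_eqF// clampI_ge1.
apply/funext => t; apply: I_inj; rewrite val_affineI /phi clampI_val.
- by rewrite mulrA mulfV ?gt_eqF// mul1r subrK.
- by rewrite mulr_ge0 ?invr_ge0 ?(ltW d0)// subr_ge0; apply/npsi/I_ge0.
- by rewrite mulrC ler_pdivrMr// mul1r lerD2r; apply/npsi/I_le1.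
Qed.

End Affine.

End Reparam.

(** * Minima along paths and connectedness of simplices *)

Section InfI.
Variable R : realType.
Local Notation I := (unitI R).

Definition infI (q : I -> R) : R := inf (range q).

Lemma infI_min (q : I -> R) : continuous q ->
  exists2 t, infI q = q t & forall s, q t <= q s.
Proof.
move=> cq; have ne : [set: I] !=set0 by exists I0.
have [|t _ h] := compact_EVT_min ne (@I_compact R) (f := q).
  exact: continuous_subspaceT.
have tmin s : q t <= q s by apply: h; exact: in_setT.
exists t => //; apply/le_anti/andP; split.
  by apply: ge_inf; [exists (q t) => _ [s _ <-]|exists t].
by apply: lb_le_inf => [|_ [s _ <-]]; first by exists (q t), t.
Qed.

(** By compactness of the interval, F (y, -) is uniformly close to F (x, -) for y near x, and so are
    the minima. *)
Lemma infI_continuous (S : topologicalType) (F : S * I -> R) :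
  continuous F -> continuous (fun x => infI (fun t => F (x, t))).
Proof.
move=> cF x; apply/(@cvgrPdist_lt R R^o) => e e0.
have cFx y : continuous (fun t => F (y, t)) by exact: continuous_pairl.
suff : \forall y \near x, [set: I] `<=` (fun t => `|F (x, t) - F (y, t)| < e).
  apply: filterS => y h.
  have [t -> tmin] := infI_min (cFx x); have [s -> smin] := infI_min (cFx y).
  have := h t Logic.I; have := h s Logic.I; have := tmin s; have := smin t.
  by rewrite !ltr_norml => ? ? /andP[? ?] /andP[? ?]; apply/andP; split; lra.
have /compact_near_coveringP/(_ _ (nbhs x) (fun y t => `|F (x, t) - F (y, t)| < e)) :=
  @I_compact R.
apply => t _.
have e2 : 0 < e / 2 by rewrite divr_gt0.
have /(@cvgrPdist_lt R R^o)/(_ _ e2) h := cF (x, t).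
have /(@cvgrPdist_lt R R^o)/(_ _ e2) h' := cFx x t.
have [[A B] /= [xA tB] AB] := h.
exists (B `&` [set s | `|F (x, t) - F (x, s)| < e / 2], A) => /=.
  by split => //; apply: filterI.
move=> [s y] /= [[Bs xs] Ay]; have /= := AB (y, s) (conj Ay Bs).
by move: xs; rewrite !ltr_norml => /andP[? ?] /andP[? ?]; apply/andP; split; lra.
Qed.

(** The infimum already lies in [0,1]; [clampI] only records this in the type. *)
Definition runmin (q : I -> I) (t : I) : I :=
  clampI (inf [set \val (q u) | u in [set u : I | \val u <= \val t]]).

Lemma minI_le (u t : I) : \val (clampI (Num.min (\val u) (\val t))) = Num.min (\val u) (\val t).
Proof. by rewrite clampI_val ?le_min ?ge_min ?I_ge0 ?I_le1. Qed.

(** The infimum over the variable domain [0, t] becomes one over the whole interval, t entering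
    through min(u, t), so that [infI_continuous] applies. *)
Lemma runminE (q : I -> I) t :
  runmin q t = clampI (infI (fun u => \val (q (clampI (Num.min (\val u) (\val t)))))).
Proof.
congr (clampI (inf _)); apply/seteqP; split => [_ [u ut <-]|_ [u _ <-]].
  by exists u => //; rewrite (min_idPl ut) clampIK.
exists (clampI (Num.min (\val u) (\val t))) => //.
by change (\val (clampI (Num.min (\val u) (\val t))) <= \val t); rewrite minI_le ge_min lexx orbT.
Qed.

Lemma runmin_continuous (S : topologicalType) (F : S * I -> I) :
  continuous F -> continuous (fun z : S * I => runmin (fun t => F (z.1, t)) z.2).
Proof.
move=> cF; apply: (continuous_eq (g := fun z : S * I => clampI (infI (fun u =>
    \val (F (z.1, clampI (Num.min (\val u) (\val z.2)))))))).
  by move=> z; rewrite runminE.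
apply: continuous_clampI.
apply: (@infI_continuous (S * I)%type
  (fun w => \val (F (w.1.1, clampI (Num.min (\val w.2) (\val w.1.2)))))).
by continuity.
Qed.

(** A nondecreasing surjection maps [0, t] onto [0, phi t]. *)
Lemma runmin_reparam (q : I -> I) (phi : I -> I) : reparam phi ->
  runmin (q \o phi) = runmin q \o phi.
Proof.
move=> rphi; have [_ nphi sphi] := rphi; apply/funext => t /=.
congr (clampI (inf _)); apply/seteqP; split => [_ [u ut <-]|_ [v vt <-]].
  by exists (phi u) => //; exact: nphi.
have [u uv] := sphi v; have [ut|tu] := leP (\val u) (\val t).
  by exists u => //=; rewrite uv.
exists t => //=; congr (\val (q _)); apply/I_inj/le_anti; rewrite vt andbT -uv.
exact/nphi/ltW.
Qed.

Lemma runmin_Ileft (p q : I -> I) t :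
  runmin (ncomp p q) (Ileft t) = runmin p t.
Proof.
congr (clampI (inf _)); apply/seteqP; split => [_ [u + <-]|_ [v vt <-]]; last first.
  exists (Ileft v); last by rewrite ncomp_Ileft.
  exact: Ileft_nondecreasing.
have [[s ->]|[s ->]] := I_halfP u => ut.
  have {}ut : \val (Ileft s) <= \val (Ileft t) := ut.
  exists s; last by rewrite ncomp_Ileft.
  by change (\val s <= \val t); move: ut; rewrite !val_Ileft; lra.
(* The right half meets [0, t/2] in the midpoint at most. *)
have {}ut : \val (Iright s) <= \val (Ileft t) := ut.
have [s0 t1] : \val s = 0 /\ \val t = 1.
  move: ut; rewrite val_Ileft val_Iright; have := I_ge0 s; have := I_le1 t.
  by move=> ? ? ?; split; lra.
exists I1; first by change (1 <= \val t); rewrite t1.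
have -> : Iright s = Ileft I1.
  by rewrite Ileft1_Iright0; congr Iright; apply: I_inj; rewrite s0.
by rewrite ncomp_Ileft.
Qed.

Lemma runmin0 (q : I -> I) t u : \val u <= \val t -> q u = I0 -> runmin q t = I0.
Proof.
move=> ut q0; rewrite /runmin clampI_le0//.
have : \val (q u) <= 0 by rewrite q0.
by apply: le_trans; apply: ge_inf; [exists 0 => _ [v _ <-]; exact: I_ge0|exists u].
Qed.

Lemma runmin_glb (q : I -> I) t (r : R) : 0 <= r <= 1 ->
  (forall u, \val u <= \val t -> r <= \val (q u)) -> r <= \val (runmin q t).
Proof.
move=> /andP[r0 r1] h.
have ri : r <= inf [set \val (q u) | u in [set u : I | \val u <= \val t]].
  apply: lb_le_inf; first by exists (\val (q I0)), I0; rewrite //= I_ge0.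
  by move=> _ [u ut <-]; exact: h.
by apply: le_trans (clampI_le ri); rewrite clampI_val.
Qed.

Lemma I_two_valued (v : I -> R) (a b : R) : continuous v ->
  (forall t, v t = a \/ v t = b) -> v I0 = v I1.
Proof.
wlog le01 : v a b / v I0 <= v I1 => [th cv hv|].
  have [|/ltW le10] := leP (v I0) (v I1); first by move=> le01; exact: (th v a b).
  apply: oppr_inj; apply: (th (fun t => - v t) (- a) (- b)); first by rewrite lerN2.
    apply: (continuous_eq (g := fun t : I => 0 - v t)); first by move=> t; rewrite sub0r.
    by apply: continuous_funB => //; exact: cst_continuous.
  by move=> t; have [->|->] := hv t; [left|right].
move=> cv hv; move: le01; rewrite le_eqVlt => /orP[/eqP//|lt01].
have [t tE] : exists t, v t = (v I0 + v I1) / 2 by apply: I_IVT => //; lra.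
have := hv t; have := hv I0; have := hv I1; rewrite tE; move: lt01.
by move: (v I0) (v I1) => c d; lra.
Qed.

(** Any two points are joined by a segment, on which the intermediate value theorem forbids a jump.
    On a simplex of paths this makes a quantity with two possible values constant. *)
Lemma simplex_two_valued n (u : simplex R n -> R) (a b : R) : continuous u ->
  (forall x, u x = a \/ u x = b) -> forall x y, u x = u y.
Proof.
move=> cu h x y.
pose f (t : I) : 'rV[R]_n.+1 := (1 - \val t) *: scoord x + \val t *: scoord y.
have [s cs sE] : exists2 s : I -> simplex R n, continuous s & forall t, scoord (s t) = f t.
  apply: simplex_lift => [t i|t|].
  - rewrite !mxE addr_ge0// mulr_ge0// ?scoord_ge0 ?I_ge0//.
    by rewrite subr_ge0 I_le1.
  - under eq_bigr do rewrite !mxE.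
    by rewrite big_split /= -!mulr_sumr !scoord_sum !mulr1 subrK.
  - apply: rV_continuous => i.
    apply: (continuous_eq (g := fun t : I => (scoord y ord0 i - scoord x ord0 i) * \val t
      + scoord x ord0 i)); last exact: continuous_affine_val.
    by move=> t; rewrite !mxE; ring.
have s0 : s I0 = x.
  by apply: val_inj; rewrite -[LHS]/(scoord _) sE /f /= subr0 scale1r scale0r addr0.
have s1 : s I1 = y.
  by apply: val_inj; rewrite -[LHS]/(scoord _) sE /f /= subrr scale1r scale0r add0r.
have cus : continuous (u \o s) by exact: continuous_fun_comp cs cu.
rewrite -s0 -s1; apply: (@I_two_valued (u \o s) a b cus) => t; exact: h.
Qed.

End InfI.

(** * Spaces of traces *)

Section Epaths.
Variables (R : realType) (X : mdspace R) (a b : X).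
Local Notation I := (unitI R).

Lemma epathsP (p : epaths a b) :
  [/\ epath X (epaths_fun p), epaths_fun p I0 = a & epaths_fun p I1 = b].
Proof. by case: p => p pP; exact: set_mem pP. Qed.

Lemma epaths_fun_inj : injective (@epaths_fun R X a b).
Proof. by move=> p q /TOP_fun_inj /val_inj. Qed.

Lemma epaths_mk (q : I -> X) : epath X q -> q I0 = a -> q I1 = b ->
  exists p : epaths a b, epaths_fun p = q.
Proof.
move=> eq q0 q1.
have qP : TOP_mk (epath_continuous eq) \in [set g : TOP R X |
    [/\ epath X (TOP_fun g), TOP_fun g I0 = a & TOP_fun g I1 = b]].
  by apply/mem_set; split.
by exists (exist (fun g => g \in _) _ qP).
Qed.

Lemma epaths_uncurry (S : topologicalType) (f : S -> epaths a b) :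
  continuous f -> continuous (fun z : S * I => epaths_fun (f z.1) z.2).
Proof.
move=> cf; apply: (@TOP_uncurry R X S (fun x => \val (f x : set_type [set g : TOP R X |
    [/\ epath X (TOP_fun g), TOP_fun g I0 = a & TOP_fun g I1 = b]]))).
exact: (continuous_fun_comp (kelley_unlift cf) (@set_val_continuous _ _)).
Qed.

Lemma epaths_curry (S : topologicalType) (f : S -> epaths a b) :
  delta_generated R S -> continuous (fun z : S * I => epaths_fun (f z.1) z.2) ->
  continuous f.
Proof.
move=> dS cf; apply: kelley_lift => //; apply: set_type_continuous.
exact: TOP_curry.
Qed.

Lemma epaths_delta_continuous (Z : topologicalType) (G : epaths a b -> Z) :
  (forall n (s : simplex R n -> epaths a b), continuous s -> continuous (G \o s)) ->
  continuous G.
Proof. by apply: delta_continuous; exact: kelley_delta. Qed.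

End Epaths.

Section Iplus.
Variables (R : realType) (k : topcat) (X : mdspace R) (a b : X).
Local Notation I := (unitI R).

Definition Iid (e : a = b) : Iplus_hom k a b :=
  @inL (discrete_topology (set_type [set _ : unit | a = b])) (cat_hom k a b)
    (exist _ tt (mem_set e) : set_type [set _ : unit | a = b]).

Definition Itr (p : epaths a b) : Iplus_hom k a b := inR _ (exec_trace k p).

Lemma Iplus_ind (P : Iplus_hom k a b -> Prop) :
  (forall e, P (Iid e)) -> (forall p, P (Itr p)) -> forall y, P y.
Proof.
move=> pid ptr; elim/coprod_ind => [[[] e]|q].
  by rewrite (_ : inL _ _ = Iid (set_mem e)) //; congr inL; exact: val_inj.
by have [p ->] := tquot_pi_surj q; exact: ptr.
Qed.

Lemma Iid_irr (e e' : a = b) : Iid e = Iid e'.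
Proof. by congr inL; exact: val_inj. Qed.

Lemma Itr_reparam (p q : epaths a b) phi : reparam phi ->
  epaths_fun q = epaths_fun p \o phi -> Itr q = Itr p.
Proof.
move=> rphi e; congr inR; apply/tquot_piP => Y f _ _ rf.
by apply/esym/rf; exists phi.
Qed.

Lemma Itr_continuous : continuous Itr.
Proof. exact: continuous_fun_comp (@tquot_pi_continuous _ _ _ _) (@inR_continuous _ _). Qed.

Lemma top_separated_subsingleton (T : topologicalType) :
  (forall x y : T, x = y) -> top_separated R k T.
Proof. by move=> h x y _. Qed.

Lemma top_separated_Iplus : top_separated R k (Iplus_hom k a b).
Proof.
apply: top_separated_coprod; last exact: top_separated_tquot.
by apply: top_separated_subsingleton => -[[] ?] [[] ?]; exact: val_inj.
Qed.

Lemma Iplus_lift (Z : topologicalType) (z : a = b -> Z) (G : epaths a b -> Z) :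
  top_separated R k Z -> continuous G ->
  (forall p q phi, reparam phi -> epaths_fun q = epaths_fun p \o phi -> G p = G q) ->
  exists F : Iplus_hom k a b -> Z, [/\ continuous F,
    forall e, F (Iid e) = z e & forall p, F (Itr p) = G p].
Proof.
move=> sZ cG rG.
have [|F cF FE] := tquot_lift (r := fun g h : epaths a b => exists2 phi,
  reparam phi & epaths_fun h = epaths_fun g \o phi) sZ cG.
  by move=> p q [phi]; exact: rG.
pose Z0 (x : discrete_topology (set_type [set _ : unit | a = b])) : Z :=
  z (set_mem (valP (x : set_type [set _ : unit | a = b]))).
exists (coprod_case Z0 F); split.
- apply: coprod_case_continuous => // x A /nbhs_singleton Ax.
  by rewrite /= nbhs_principalE; apply/principal_filterP.
- by move=> e /=; rewrite /Z0; congr z; exact: Prop_irrelevance.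
- by move=> p; exact: FE.
Qed.

End Iplus.

(** The gluing lemma for two closed halves; truncation extends both formulas to all of S x [0,1]. *)
Lemma continuous_ncomp (R : realType) (X S : topologicalType)
    (F G : S * unitI R -> X) : continuous F -> continuous G ->
  (forall x, F (x, I1) = G (x, I0)) ->
  continuous (fun z : S * unitI R =>
    ncomp (fun t => F (z.1, t)) (fun t => G (z.1, t)) z.2).
Proof.
move=> cF cG FG; set f := (X in continuous X).
pose A := [set z : S * unitI R | \val z.2 <= 2^-1].
pose B := [set z : S * unitI R | 2^-1 <= \val z.2].
have c2 : continuous (fun z : S * unitI R => \val z.2 : R).
  by continuity.
have clA : closed A by exact: (closed_comp (fun z _ => c2 z) (@closed_le R 2^-1)).
have clB : closed B by exact: (closed_comp (fun z _ => c2 z) (@closed_ge R 2^-1)).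
have AB : A `|` B = setT.
  by apply/seteqP; split => // z _; have [h|/ltW h] := leP (\val z.2) 2^-1; [left|right].
have cc (a d : R) (H : S * unitI R -> X) : continuous H ->
    continuous (fun z : S * unitI R => H (z.1, clampI (a * \val z.2 + d))).
  by move=> cH; continuity.
apply/continuous_subspace_setT; rewrite -AB.
apply: withinU_continuous => //.
  apply: (@subspace_eq_continuous _ A _
      (fun z : S * unitI R => F (z.1, clampI (2 * \val z.2 + 0)))).
    by move=> z /set_mem zA; rewrite /f /ncomp; rewrite /from_subspace; cbv beta; rewrite ifT// addr0.
  by apply: continuous_subspaceT => z; exact: cc.
apply: (@subspace_eq_continuous _ B _
    (fun z : S * unitI R => G (z.1, clampI (2 * \val z.2 - 1)))).
  move=> z /set_mem zB; rewrite /f /ncomp /from_subspace; cbv beta; case: ifPn => // zA.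
  have z2 : \val z.2 = 2^-1 by apply/le_anti; rewrite zA.
  by rewrite z2 mulfV ?pnatr_eq0// subrr (clampI_ge1 (lexx 1)) clampI_le0.
by apply: continuous_subspaceT => z; exact: cc.
Qed.

(** * Removal of the initial piece of a path *)

Section HeadRemoval.
Variables (R : realType) (k : topcat) (X : mdspace R) (a b c : X).
Local Notation I := (unitI R).
Variables (hd : I -> X) (mu : X -> I) (K : X * I -> X) (omega : X -> I).
Variables (mid : set (I -> X)) (Tau : set (Iplus_hom k a b)) (eps : R).

(* every path from a starts with hd, except those in mid, on which mu has minimum
   eps > 0; Tau consists of the identity and of the class of mid, so that at most
   one of the two is present *)
Hypothesis hdP : epath X hd.
Hypothesis hd0 : hd I0 = a.
Hypothesis hd1 : hd I1 = c.
Hypothesis mu_continuous : continuous mu.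
Hypothesis mu_c : mu c = I0.
Hypothesis K_continuous : continuous K.
Hypothesis K0 : forall x, K (x, I0) = x.
Hypothesis K_hd : forall t, K (hd t, runmin (mu \o hd) t) = c.
Hypothesis omega_continuous : continuous omega.
Hypothesis omega_c : omega c = I0.
Hypothesis omega_loop : c = b -> forall p, epath X p -> p I0 = c -> p I1 = c ->
  exists t, omega (p t) = I1.
Hypothesis eps_gt0 : 0 < eps.
Hypothesis mid_reparam : forall p phi, mid p -> reparam phi -> mid (p \o phi).
Hypothesis mid_eps : forall p, mid p -> infI (fun t => \val (mu (p t))) = eps.
Hypothesis epathP : forall p, epath X p -> p I0 = a -> p I1 = b ->
  [\/ mid p, exists2 phi, reparam phi & p = hd \o phi |
    exists q phi, [/\ epath X q, q I0 = c, q I1 = b, reparam phi &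
      p = ncomp hd q \o phi]].
Hypothesis Tau_id : forall e, Tau (Iid k e).
Hypothesis Tau_mid : forall p : epaths a b, mid (epaths_fun p) -> Tau (Itr k p).
Hypothesis Tau_ind : forall y, Tau y -> (exists e, y = Iid k e) \/
  exists2 p : epaths a b, mid (epaths_fun p) & y = Itr k p.
Hypothesis Tau_uniq : forall y y', Tau y -> Tau y' -> y = y'.

(* for a path p from a to b that is not in mid, the path that waits at c until
   p leaves its initial piece hd, and follows p from then on *)
Definition behead (p : I -> X) (t : I) : X := K (p t, runmin (mu \o p) t).

Lemma behead_reparam p phi : reparam phi -> behead (p \o phi) = behead p \o phi.
Proof.
move=> rphi; apply/funext => t; rewrite /behead compA runmin_reparam //=.
Qed.

Lemma behead_hd : behead hd = fun=> c.
Proof. by apply/funext => t; exact: K_hd. Qed.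

Lemma behead_ncomp q : q I0 = c -> behead (ncomp hd q) = q \o @skip R.
Proof.
move=> q0; apply: eq_half => t; rewrite /behead.
  rewrite -ncomp_comp runmin_Ileft ncomp_Ileft /= skip_Ileft q0.
  exact: K_hd.
rewrite (runmin0 (u := Ileft I1)) ?K0.
- by rewrite ncomp_Iright ?hd1//= skip_Iright.
- rewrite val_Ileft val_Iright; have := I_ge0 t; have : \val (I1 : I) = 1 by []; lra.
- by rewrite /= ncomp_Ileft hd1.
Qed.

Let Z := coprod (set_type Tau) (Iplus_hom k c b).

(** [epathP] only asserts that some decomposition exists, so the image of p is first a relation. The
    third case involves q and phi, but its value depends on [behead] of p alone. *)
Let spec (p : epaths a b) (z : Z) : Prop :=
  [\/ mid (epaths_fun p) /\ exists y, z = inL _ y,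
      (exists2 phi, reparam phi & epaths_fun p = hd \o phi) /\
        (exists e, z = inR _ (Iid k e)) |
      exists (r : epaths c b) q phi, [/\ epath X q /\ q I0 = c, reparam phi,
        epaths_fun p = ncomp hd q \o phi, epaths_fun r = behead (epaths_fun p) &
        z = inR _ (Itr k r)]].

Let spec_ex p : exists z, spec p z.
Proof.
have [pe p0 p1] := epathsP p.
have [pm|[phi rphi pE]|[q [phi [qe q0 q1 rphi pE]]]] := epathP pe p0 p1.
- have y : set_type Tau := exist (fun y => y \in Tau) _ (mem_set (Tau_mid pm)).
  by exists (inL _ y); apply: Or31; split => //; exists y.
- have e : c = b by rewrite -p1 pE /= reparam1.
  by exists (inR _ (Iid k e)); apply: Or32; split; [exists phi|exists e].
- have bE : behead (epaths_fun p) = (q \o @skip R) \o phi.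
    by rewrite pE behead_reparam// behead_ncomp.
  have sphi : reparam (@skip R \o phi) by apply: reparam_comp => //; exact: skip_reparam.
  have [r rE] : exists r : epaths c b, epaths_fun r = behead (epaths_fun p).
    apply: epaths_mk; rewrite bE -compA; first exact: epath_reparam.
      by rewrite -[LHS]/(q ((@skip R \o phi) I0)) reparam0.
    by rewrite -[LHS]/(q ((@skip R \o phi) I1)) reparam1.
  by exists (inR _ (Itr k r)); apply: Or33; exists r, q, phi.
Qed.

(** Equal to eps on [mid] and to 0 on every path that meets c, this recognizes [mid]
    continuously. *)
Let N (p : I -> X) : R := infI (fun t => \val (mu (p t))).

Let N_eq0 p : (exists t, p t = c) -> continuous p -> N p = 0.
Proof.
move=> [t pt] cp; have cq : continuous (fun t => \val (mu (p t))).
  by apply: continuous_valI; exact: continuous_fun_comp cp mu_continuous.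
have [s Ns smin] := infI_min cq; rewrite /N Ns; apply/le_anti.
rewrite I_ge0 andbT; apply: le_trans (smin t) _.
by rewrite pt mu_c.
Qed.

Let ec (p : epaths a b) : continuous (epaths_fun p).
Proof. by have [/epath_continuous] := epathsP p. Qed.

Let N_hd (p : epaths a b) phi : reparam phi -> epaths_fun p = hd \o phi ->
  N (epaths_fun p) = 0.
Proof.
move=> rphi pE; apply: N_eq0; last exact: ec.
by exists I1; rewrite pE /= reparam1.
Qed.

Let N_ncomp (p : epaths a b) q phi : reparam phi ->
  epaths_fun p = ncomp hd q \o phi -> N (epaths_fun p) = 0.
Proof.
move=> [_ _ sphi] pE; apply: N_eq0; last exact: ec.
by have [s sE] := sphi (Ileft I1); exists s; rewrite pE /= sE ncomp_Ileft.
Qed.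

(** An execution loop at c reaches the value 1 of [omega], which the constant path at c never does.
    Hence beheading cannot confuse [hd] with [hd] followed by a path. *)
Let omega_const (r : epaths c b) : c = b -> epaths_fun r <> (fun=> c).
Proof.
move=> e rE; have [re r0 r1] := epathsP r.
have [t] := omega_loop e re r0 (etrans r1 (esym e)).
by rewrite rE omega_c => /(@I0_neq_I1 R).
Qed.

Let spec_uniq p z z' : spec p z -> spec p z' -> z = z'.
Proof.
have dis u : mid (epaths_fun p) -> spec p u -> exists y, u = inL _ y.
  move=> /mid_eps pm [[]//|[[phi rphi pE] _]|[r [q [phi [_ rphi pE _ _]]]]].
    by exfalso; have := N_hd rphi pE; rewrite /N pm => /eqP; rewrite gt_eqF.
  by exfalso; have := N_ncomp rphi pE; rewrite /N pm => /eqP; rewrite gt_eqF.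
move=> h h'.
case: (h) => [[pm [y zE]]|[[phi rphi pE] [e zE]]|[r [q [phi [qe rphi pE rE zE]]]]].
- have [y' ->] := dis _ pm h'; rewrite zE; congr inL.
  by apply: val_inj; apply: Tau_uniq; exact: set_mem (valP _).
- case: h' => [[pm _]|[_ [e' ->]]|[r [q [phi' [_ rphi' _ rE _]]]]].
  + by have [y] := dis _ pm h; rewrite zE.
  + by rewrite zE; congr inR; exact: Iid_irr.
  + by case: (omega_const (r := r) e); rewrite rE pE behead_reparam// behead_hd.
- case: h' => [[pm _]|[[phi' rphi' pE'] [e' _]]|[r' [q' [phi' [_ _ _ rE' ->]]]]].
  + by have [y] := dis _ pm h; rewrite zE.
  + by case: (omega_const (r := r) e'); rewrite rE pE' behead_reparam// behead_hd.
  + by rewrite zE; congr (inR _ (Itr k _)); apply: epaths_fun_inj; rewrite rE rE'.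
Qed.

Let behead_curry n (s : simplex R n -> epaths a b) : continuous s ->
  continuous (fun z : simplex R n * I => behead (epaths_fun (s z.1)) z.2).
Proof.
move=> cs; apply: continuous_fun_comp K_continuous; apply: pair_continuous.
  exact: epaths_uncurry.
apply: (@runmin_continuous R _ (fun z => mu (epaths_fun (s z.1) z.2))).
exact: continuous_fun_comp (epaths_uncurry cs) mu_continuous.
Qed.

(** Over a simplex of paths the case of [spec] is constant: [N] singles out [mid], and, if c = b,
    the maximum of [omega] along the beheaded path tells the identity from the traces. *)
Let spec_continuous (G : epaths a b -> Z) : (forall p, spec p (G p)) -> continuous G.
Proof.
move=> GP; apply: epaths_delta_continuous => n s cs.
have cN : continuous (fun x => N (epaths_fun (s x))).
  apply: (@infI_continuous R _ (fun z => \val (mu (epaths_fun (s z.1) z.2)))).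
  by apply: continuous_valI; exact: continuous_fun_comp (epaths_uncurry cs) mu_continuous.
have N2 x : N (epaths_fun (s x)) = eps \/ N (epaths_fun (s x)) = 0.
  have [[/mid_eps pm _]|[[phi rphi pE] _]|[r [q [phi [_ rphi pE _ _]]]]] := GP (s x).
  - by left.
  - by right; exact: N_hd rphi pE.
  - by right; exact: N_ncomp rphi pE.
have Ncst := simplex_two_valued cN N2.
have cst_cont (z : Z) : (forall x, G (s x) = z) -> continuous (G \o s).
  by move=> h; apply: (continuous_eq (g := fun=> z)) => //; exact: cst_continuous.
(* As soon as one path of the family is in [mid], all are, and then G is constant because [Tau] has
   at most one element. *)
have [[x0 x0m]|nomid] := pselect (exists x, mid (epaths_fun (s x))).
  have allmid x : exists y, G (s x) = inL _ y.
    have [[]//|[[phi rphi pE] _]|[r [q [phi [_ rphi pE _ _]]]]] := GP (s x);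
      exfalso; have := mid_eps x0m; rewrite -/(N _) (Ncst x0 x).
      by rewrite (N_hd rphi pE) => /eqP; rewrite lt_eqF.
    by rewrite (N_ncomp rphi pE) => /eqP; rewrite lt_eqF.
  have [y0 y0E] := allmid x0; apply: (cst_cont (inL _ y0)) => x.
  have [y ->] := allmid x; congr inL.
  by apply: val_inj; apply: Tau_uniq; exact: set_mem (valP _).
have GP' x : ((exists2 phi, reparam phi & epaths_fun (s x) = hd \o phi) /\
        (exists e, G (s x) = inR _ (Iid k e))) \/
      exists r : epaths c b, epaths_fun r = behead (epaths_fun (s x)) /\
        G (s x) = inR _ (Itr k r).
  have [[pm _]|h|[r [q [phi [_ rphi pE rE GE]]]]] := GP (s x); last 2 first.
  - by left.
  - by right; exists r.
  - by case: nomid; exists x.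
(* The minimum of 1 - omega along the beheaded path is 0 on execution loops and, by [beh_hd], 1 on
   the constant path. *)
have beh_loop x r : c = b -> epaths_fun (r : epaths c b) = behead (epaths_fun (s x)) ->
    infI (fun t => 1 - \val (omega (behead (epaths_fun (s x)) t))) = 0.
  move=> e <-; have [re r0 r1] := epathsP r.
  have [t tE] := omega_loop e re r0 (etrans r1 (esym e)).
  have cq : continuous (fun t => 1 - \val (omega (epaths_fun r t))).
    by have := epath_continuous re; move=> cre; continuity.
  have [u -> umin] := infI_min cq; apply/le_anti; rewrite subr_ge0 I_le1 andbT.
  by apply: le_trans (umin t) _; rewrite tE subrr.
have beh_hd x phi : reparam phi -> epaths_fun (s x) = hd \o phi ->
    infI (fun t => 1 - \val (omega (behead (epaths_fun (s x)) t))) = 1.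
  move=> rphi ->; rewrite behead_reparam// behead_hd.
  have -> : (fun t => 1 - \val (omega (((fun=> c) \o phi) t))) = fun=> 1.
    by apply/funext => t; rewrite /= omega_c subr0.
  by have [|t -> _] := @infI_min R (fun=> 1); first exact: cst_continuous.
have cW : continuous (fun x => infI (fun t => 1 - \val (omega (behead (epaths_fun (s x)) t)))).
  apply: (@infI_continuous R _ (fun z => 1 - \val (omega (behead (epaths_fun (s z.1)) z.2)))).
  by have cb := behead_curry cs; continuity.
(* One identity in the family forces c = b, so the two values of the minimum exclude any trace in
   the rest of the family. *)
have [[x0 [[phi0 rphi0 x0E] [e x0G]]]|noid] := pselect (exists x,
    (exists2 phi, reparam phi & epaths_fun (s x) = hd \o phi) /\
        (exists e, G (s x) = inR _ (Iid k e))).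
  have W2 x : infI (fun t => 1 - \val (omega (behead (epaths_fun (s x)) t))) = 1 \/
      infI (fun t => 1 - \val (omega (behead (epaths_fun (s x)) t))) = 0.
    have [[[phi rphi xE] _]|[r [rE _]]] := GP' x; first by left; exact: beh_hd rphi xE.
    by right; exact: beh_loop rE.
  apply: (cst_cont (inR _ (Iid k e))) => x.
  have [[_ [e' ->]]|[r [rE _]]] := GP' x; first by congr inR; exact: Iid_irr.
  have := simplex_two_valued cW W2 x0 x; rewrite (beh_hd x0 _ rphi0 x0E) (beh_loop _ _ e rE).
  by move=> /eqP; rewrite oner_eq0.
(* Neither [Tau] nor the identity occurs in the family: G is the trace of the beheaded path, which
   varies continuously. *)
have /choice[r rP] : forall x, exists r : epaths c b,
    epaths_fun r = behead (epaths_fun (s x)) /\ G (s x) = inR _ (Itr k r).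
  by move=> x; have [h|//] := GP' x; case: noid; exists x.
have cr : continuous r.
  apply: epaths_curry; first exact: simplex_delta.
  apply: continuous_eq (behead_curry cs) => z.
  by have [->] := rP z.1.
apply: (continuous_eq (g := fun x => inR _ (Itr k (r x)))) => [x|].
  by have [_ <-] := rP x.
apply: (continuous_fun_comp _ (@inR_continuous _ _)).
exact: continuous_fun_comp cr (@Itr_continuous _ _ _ _ _).
Qed.

Let spec_reparam p p' phi z : reparam phi -> epaths_fun p' = epaths_fun p \o phi ->
  spec p z -> spec p' z.
Proof.
move=> rphi pE [[pm zE]|[[psi rpsi qE] zE]|[r [q [psi [qe rpsi qE rE zE]]]]].
- by apply: Or31; split => //; rewrite pE; exact: mid_reparam.
- apply: Or32; split => //; exists (psi \o phi); first exact: reparam_comp.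
  by rewrite pE qE.
- apply: Or33; have bE : behead (epaths_fun p') = epaths_fun r \o phi.
    by rewrite pE behead_reparam// rE.
  have [re r0 r1] := epathsP r.
  have [r' r'E] : exists r' : epaths c b, epaths_fun r' = behead (epaths_fun p').
    apply: epaths_mk; rewrite bE; first exact: epath_reparam.
      by rewrite /= reparam0.
    by rewrite /= reparam1.
  exists r', q, (psi \o phi); split => //.
  + exact: reparam_comp.
  + by rewrite pE qE.
  + by rewrite zE; congr inR; apply/esym/(Itr_reparam k rphi); rewrite r'E.
Qed.

(** The inverse prepends [hd], sending the identity of c to the class of [hd] itself. Beheading [hd]
    followed by r gives r composed with [skip], and the other composite is also a reparametrization,
    so both are identities on traces. *)
Theorem head_removal : homeo (Iplus_hom k a b) Z.
Proof.
have /choice[G GP] := spec_ex.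
have sZ : top_separated R k Z.
  apply: top_separated_coprod; last exact: top_separated_Iplus.
  apply: top_separated_subsingleton => y y'; apply: val_inj; apply: Tau_uniq.
    exact: set_mem (valP y).
  exact: set_mem (valP y').
have [|F [cF Fid Ftr]] := Iplus_lift (fun e => @inL (set_type Tau) (Iplus_hom k c b)
    (exist (fun y => y \in Tau) _ (mem_set (Tau_id e)))) sZ
    (spec_continuous GP).
  move=> p q phi rphi qE; apply: spec_uniq (GP q).
  exact: spec_reparam rphi qE (GP p).
have hd_ex (e : c = b) : exists p : epaths a b, epaths_fun p = hd.
  by apply: epaths_mk => //; rewrite hd1.
have hdr_ex (r : epaths c b) : exists p : epaths a b, epaths_fun p = ncomp hd (epaths_fun r).
  have [re r0 r1] := epathsP r.
  apply: epaths_mk; first by apply: epath_ncomp; rewrite // hd1 r0.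
    by rewrite ncomp0.
  by rewrite ncomp1.
have /choice[hdr hdrE] := hdr_ex.
have chdr : continuous hdr.
  apply: epaths_delta_continuous => n s cs; apply: epaths_curry; first exact: simplex_delta.
  apply: (continuous_eq (g := fun z : simplex R n * I =>
    ncomp hd (epaths_fun (s z.1)) z.2)) => [z|]; first by rewrite /= hdrE.
  have cw := epaths_uncurry cs.
  apply: (@continuous_ncomp R X _ (fun z => hd z.2) (fun z => epaths_fun (s z.1) z.2)).
  - exact: continuous_fun_comp (@snd_continuous _ _) (epath_continuous hdP).
  - exact: epaths_uncurry.
  - by move=> x; have [_ r0 _] := epathsP (s x); rewrite /= hd1 r0.
have [|Y [cY Yid Ytr]] := Iplus_lift (fun e : c = b => Itr k (projT1 (cid (hd_ex e))))
    (@top_separated_Iplus R k X a b) (continuous_fun_comp chdr (@Itr_continuous _ _ _ _ _)).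
  move=> r r' phi rphi rE; apply/esym/(Itr_reparam k (reparam_catP (@reparam_id R) rphi)).
  have [re r0 r1] := epathsP r.
  by rewrite !hdrE rE -ncomp_reparam//; [exact: reparam_id|rewrite hd1 r0].
have cval : continuous (fun y : set_type Tau => \val y) by exact: set_val_continuous.
exists F, (coprod_case (fun y : set_type Tau => \val y) Y); split => //.
- exact: coprod_case_continuous.
- elim/Iplus_ind => [e|p]; first by rewrite Fid.
  rewrite Ftr; have [[pm [y ->]]|[[phi rphi pE] [e ->]]|[r [q [phi [[qe q0] rphi pE rE ->]]]]] := GP p.
  + by apply: Tau_uniq; [exact: set_mem (valP y)|exact: Tau_mid].
  + rewrite /= Yid; case: cid => p' p'E /=.
    by apply/esym/(Itr_reparam k rphi); rewrite p'E.
  + rewrite /= Ytr.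
    (* Both p and [hd] followed by r are reparametrizations of [hd] followed by q, since r is q
       composed with [skip] and phi. *)
    have [u uE] : exists u : epaths a b, epaths_fun u = ncomp hd q.
      have [_ _ p1] := epathsP p; apply: epaths_mk; rewrite ?ncomp0//.
        by apply: epath_ncomp; rewrite // hd1 q0.
      by rewrite ncomp1 -p1 pE /= reparam1// ncomp1.
    transitivity (Itr k u); last by apply/esym/(Itr_reparam k rphi); rewrite uE.
    have sphi : reparam (@skip R \o phi) by apply: reparam_comp => //; exact: skip_reparam.
    apply: (Itr_reparam k (reparam_catP (@reparam_id R) sphi)).
    rewrite uE hdrE rE pE behead_reparam// behead_ncomp// -compA -ncomp_reparam//.
      exact: reparam_id.
    by rewrite hd1 q0.
- elim/coprod_ind => [y|y].
    have := set_mem (valP y); move=> /Tau_ind[[e yE]|[p pm yE]].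
      by rewrite /= yE Fid; congr inL; apply: val_inj; rewrite /= yE.
    rewrite /= yE Ftr; apply: spec_uniq (GP p) _; apply: Or31; split => //.
    by exists y.
  elim/Iplus_ind: y => [e|r] /=.
    rewrite Yid; case: cid => p pE /=; rewrite Ftr; apply: spec_uniq (GP p) _.
    by apply: Or32; split; [exists id; [exact: reparam_id|rewrite pE]|exists e].
  have [re r0 r1] := epathsP r.
  have rsk := @skip_reparam R.
  have bE : behead (epaths_fun (hdr r)) = epaths_fun r \o @skip R.
    by rewrite hdrE behead_ncomp.
  have [r' r'E] : exists r' : epaths c b, epaths_fun r' = behead (epaths_fun (hdr r)).
    apply: epaths_mk; rewrite bE; first exact: epath_reparam.
      by rewrite /= reparam0.
    by rewrite /= reparam1.
  rewrite Ytr Ftr; apply: spec_uniq (GP (hdr r)) _; apply: Or33.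
  exists r', (epaths_fun r), id; split => //; first exact: reparam_id.
  by congr inR; apply/esym/(Itr_reparam k rsk); rewrite r'E.
Qed.

End HeadRemoval.

(** * Induced maps on traces *)

Section IplusMap.
Variables (R : realType) (k : topcat) (X Y : mdspace R).
Local Notation I := (unitI R).

Lemma Iplus_map (a b : X) (a' b' : Y) (e : a = b -> a' = b')
    (G : epaths a b -> epaths a' b') : continuous G ->
  (forall p q phi, reparam phi -> epaths_fun q = epaths_fun p \o phi ->
    exists2 psi, reparam psi & epaths_fun (G q) = epaths_fun (G p) \o psi) ->
  exists F : Iplus_hom k a b -> Iplus_hom k a' b', [/\ continuous F,
    forall h, F (Iid k h) = Iid k (e h) & forall p, F (Itr k p) = Itr k (G p)].
Proof.
move=> cG rG; apply: (Iplus_lift (fun h => Iid k (e h)) (@top_separated_Iplus R k Y a' b')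
  (continuous_fun_comp cG (@Itr_continuous _ _ _ _ _))) => p q phi rphi qE.
by have [psi rpsi E] := rG p q phi rphi qE; apply/esym/(Itr_reparam k rpsi).
Qed.

Lemma Iplus_rev_map (u : X -> Y) (a b : X) : continuous u ->
  (forall p, epath X p -> epath Y (u \o p \o @Irev R)) ->
  exists F : Iplus_hom k a b -> Iplus_hom k (u b) (u a), [/\ continuous F,
    forall h, F (Iid k h) = Iid k (congr1 u (esym h)) &
    forall p, exists2 q, F (Itr k p) = Itr k q &
      epaths_fun q = u \o epaths_fun p \o @Irev R].
Proof.
move=> cu eu.
have /choice[G GE] (p : epaths a b) : exists q : epaths (u b) (u a),
    epaths_fun q = u \o epaths_fun p \o @Irev R.
  have [pe p0 p1] := epathsP p.
  by apply: epaths_mk; [exact: eu|rewrite /= Irev0 p1|rewrite /= Irev1 p0].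
have cG : continuous G.
  apply: epaths_delta_continuous => n s cs; apply: epaths_curry; first exact: simplex_delta.
  apply: (continuous_eq (g := fun z : simplex R n * I => u (epaths_fun (s z.1) (Irev z.2)))).
    by move=> z; rewrite /= GE.
  apply: continuous_fun_comp cu.
  apply: (@continuous_fun_comp _ (simplex R n * I)%type _ (fun z => (z.1, Irev z.2))
    (fun z => epaths_fun (s z.1) z.2)); last exact: epaths_uncurry.
  apply: pair_continuous; first exact: fst_continuous.
  exact: continuous_fun_comp (@snd_continuous _ _) (@Irev_continuous R).
have [|F [cF Fid Ftr]] := Iplus_map (fun h : a = b => congr1 u (esym h)) cG.
  move=> p q phi rphi qE; exists (@Irev R \o phi \o @Irev R); first exact: reparam_rev.
  by rewrite !GE qE; apply/funext => t /=; rewrite IrevK.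
by exists F; split => // p; exists (G p).
Qed.

End IplusMap.

(** * Reversal of paths and removal of the final piece *)

Section Opposite.
Variables (R : realType) (k : topcat) (X : mdspace R).
Local Notation I := (unitI R).

Program Definition op_md : mdspace R :=
  @MDSpace R X (states X) [set p : I -> X | epath X (p \o @Irev R)] _ _ _ _.
Next Obligation.
move=> p /epath_continuous cp.
have -> : p = (p \o @Irev R) \o @Irev R by apply/funext => t /=; rewrite IrevK.
exact: continuous_fun_comp (@Irev_continuous R) cp.
Qed.
Next Obligation. by move=> p /epath_states[]; rewrite /= Irev0 Irev1. Qed.
Next Obligation.
move=> p phi /= ep /reparam_rev rphi; have := epath_reparam ep rphi.
by congr (epath X _); apply/funext => t /=; rewrite IrevK.
Qed.
Next Obligation.
move=> p q /= ep eq pq; rewrite ncomp_rev//.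
by apply: epath_ncomp => //=; rewrite Irev0 Irev1.
Qed.

Lemma homeo_op (a b : X) :
  homeo (Iplus_hom (X := op_md) k b a) (Iplus_hom (X := X) k a b).
Proof.
have cid : continuous (id : X -> X) by move=> x; exact: cvg_id.
have [|F [cF Fid Ftr]] := @Iplus_rev_map R k op_md X id b a cid.
  by move=> p.
have [|G [cG Gid Gtr]] := @Iplus_rev_map R k X op_md id a b cid.
  move=> p ep /=; have <- : p = (p \o @Irev R) \o @Irev R.
    by apply/funext => t /=; rewrite IrevK.
  by [].
exists F, G; split => //.
- elim/Iplus_ind => [e|p]; first by rewrite Fid Gid; exact: Iid_irr.
  have [q -> qE] := Ftr p; have [r -> rE] := Gtr q.
  congr (Itr k _); apply: epaths_fun_inj; rewrite rE qE.
  by apply/funext => t /=; rewrite IrevK.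
- elim/Iplus_ind => [e|p]; first by rewrite Gid Fid; exact: Iid_irr.
  have [q -> qE] := Gtr p; have [r -> rE] := Ftr q.
  congr (Itr k _); apply: epaths_fun_inj; rewrite rE qE.
  by apply/funext => t /=; rewrite IrevK.
Qed.

End Opposite.

Section TailRemoval.
Variables (R : realType) (k : topcat) (X : mdspace R) (a b c : X).
Local Notation I := (unitI R).
Variables (tl : I -> X) (mu : X -> I) (K : X * I -> X).

(** Head removal in [op_md X], with the reversed [tl] as initial piece. [mid] and [Tau] can be
    empty: a <> b rules out identities, and the last hypothesis rules out paths without the piece
    [tl]. The value 1 of eps is then a mere placeholder. *)
Lemma tail_removal :
  epath X tl -> tl I0 = c -> tl I1 = b -> continuous mu -> mu c = I0 ->
  continuous K -> (forall x, K (x, I0) = x) ->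
  (forall t, K (tl (Irev t), runmin (mu \o tl \o @Irev R) t) = c) ->
  a <> b ->
  (exists omega : X -> I, [/\ continuous omega, omega c = I0 &
    a = c -> forall p, epath X p -> p I0 = c -> p I1 = c ->
      exists t, omega (p t) = I1]) ->
  (forall p, epath X p -> p I0 = a -> p I1 = b ->
    (exists2 phi, reparam phi & p = tl \o phi) \/
    exists q phi, [/\ epath X q, q I0 = a, q I1 = c, reparam phi &
      p = ncomp q tl \o phi]) ->
  homeo (Iplus_hom k a b) (Iplus_hom k a c).
Proof.
move=> etl tl0 tl1 cmu mu_c cK K0 K_tl ab [omega [comega omega_c omega_loop]] H.
apply: homeo_trans (homeo_sym (homeo_op k a b)) _.
apply: homeo_trans _ (homeo_op k a c).
have KK p : p = (p \o @Irev R) \o @Irev R :> (I -> X) by apply/funext => t /=; rewrite IrevK.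
have hr := @head_removal R k (op_md X) b a c (tl \o @Irev R) mu K omega set0
  (set0 : set (Iplus_hom (X := op_md X) k b a)) 1.
apply: homeo_trans (hr _ _ _ cmu mu_c cK K0 _ comega omega_c _ _ _ _ _ _ _ _ _) _ => //.
- by rewrite /= -KK.
- by rewrite /= Irev0.
- by rewrite /= Irev1.
- move=> e p ep p0 p1; have [||t tE] := omega_loop (esym e) _ ep.
  + by rewrite /= Irev0.
  + by rewrite /= Irev1.
  by exists (Irev t).
- move=> p ep p0 p1.
  have [||[phi rphi pE]|[q [phi [eq q0 q1 rphi pE]]]] := H _ ep.
  + by rewrite /= Irev0.
  + by rewrite /= Irev1.
  + apply: Or32; exists (@Irev R \o phi \o @Irev R); first exact: reparam_rev.
    by rewrite (KK p) pE; apply/funext => t /=; rewrite IrevK.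
  + apply: Or33; exists (q \o @Irev R), (@Irev R \o phi \o @Irev R); split.
    * by rewrite /= -KK.
    * by rewrite /= Irev0.
    * by rewrite /= Irev1.
    * exact: reparam_rev.
    * by rewrite (KK p) pE -ncomp_rev ?q1// ; apply/funext => t /=; rewrite IrevK.
- by move=> e; case: ab.
- by apply: homeo_coprod0 => -[y /set_mem].
Qed.

End TailRemoval.

(** * Pushouts *)

Section Pushout.
Variables (R : realType) (k : topcat).
Local Notation I := (unitI R).

Program Definition generated_md (X : mdspace R) (S : set X) (P : set (I -> X))
    (PS : forall p, P p -> S (p I0) /\ S (p I1))
    (Pr : forall p phi, epath X p -> P p -> reparam phi -> P (p \o phi))
    (Pc : forall p q, epath X p -> epath X q -> P p -> P q -> p I1 = q I0 -> P (ncomp p q)) :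
  mdspace R := @MDSpace R X (states X `&` S) (epath X `&` P) _ _ _ _.
Next Obligation. by move=> X S P _ _ _ p [/epath_continuous]. Qed.
Next Obligation.
by move=> X S P PS _ _ p [/epath_states[? ?] /PS[]].
Qed.
Next Obligation.
by move=> X S P _ Pr _ p phi [ep Pp] rphi; split; [exact: epath_reparam|exact: Pr].
Qed.
Next Obligation.
by move=> X S P _ _ Pc p q [ep Pp] [eq Pq] pq; split; [exact: epath_ncomp|exact: Pc].
Qed.

(* the identity of X factors through the sub-object of the generated paths *)
Lemma pushout_ind (B A W X : mdspace R) (i : mdmap B W) (g : mdmap B A)
    (gh : mdmap W X) (f : mdmap A X) (S : set X) (P : set (I -> X)) :
  is_pushout k i g gh f ->
  (forall p, P p -> S (p I0) /\ S (p I1)) ->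
  (forall p phi, epath X p -> P p -> reparam phi -> P (p \o phi)) ->
  (forall p q, epath X p -> epath X q -> P p -> P q -> p I1 = q I0 -> P (ncomp p q)) ->
  (forall x, states A x -> S (f x)) -> (forall x, states W x -> S (gh x)) ->
  (forall p, epath A p -> P (f \o p)) -> (forall p, epath W p -> P (gh \o p)) ->
  (forall x, states X x -> S x) /\ (forall p, epath X p -> P p).
Proof.
move=> [Xk comm univ] PS Pr Pc fS ghS fP ghP.
pose X' := generated_md PS Pr Pc.
have cid : continuous (id : X -> X) by move=> x; exact: cvg_id.
have @f' : mdmap A X'.
  apply: (@MDMap R A X' f (@md_continuous _ _ _ f)) => [x sx|p ep].
    by split; [exact: md_states|exact: fS].
  by split; [exact: md_epath|exact: fP].
have @gh' : mdmap W X'.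
  apply: (@MDMap R W X' gh (@md_continuous _ _ _ gh)) => [x sx|p ep].
    by split; [exact: md_states|exact: ghS].
  by split; [exact: md_epath|exact: ghP].
have @inc : mdmap X' X by apply: (@MDMap R X' X id cid) => [x []|p []].
have @idX : mdmap X X by apply: (@MDMap R X X id cid).
have [h [hf hgh _]] := univ X' f' gh' Xk comm.
have [h0 [_ _ h0u]] := univ X f gh Xk comm.
have hid : h =1 id.
  move=> x; transitivity (h0 x).
    by apply: (h0u (mdcomp h inc)) => y /=; [exact: hf|exact: hgh].
  by apply/esym; apply: (h0u idX).
split => [x /(md_states h)[_]|p /(md_epath h)[_]]; first by rewrite hid.
by congr P; apply/funext => t /=; exact: hid.
Qed.

Lemma continuous_ncomp_path (Y : topologicalType) (p q : I -> Y) :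
  continuous p -> continuous q -> p I1 = q I0 -> continuous (ncomp p q).
Proof.
move=> cp cq pq.
pose F (u : I -> Y) (z : I * I) := u z.2.
have cF u : continuous u -> continuous (F u).
  by move=> cu; exact: continuous_fun_comp (@snd_continuous _ _) cu.
have h := continuous_ncomp (cF p cp) (cF q cq) (fun=> pq).
by apply: (continuous_eq _ (@continuous_pairl I I Y _ I0 h)).
Qed.

(** Every continuous map into this object is a morphism: the construction is right adjoint to the
    underlying space. It turns a pushout of multipointed d-spaces into a universal property of the
    underlying space, for targets in Top. *)
Program Definition codiscrete_md (Y : topologicalType) : mdspace R :=
  @MDSpace R Y setT [set p : I -> Y | continuous p] _ _ _ _.
Next Obligation. by []. Qed.
Next Obligation. by []. Qed.
Next Obligation.
by move=> Y p phi cp [cphi _ _]; exact: continuous_fun_comp cphi cp.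
Qed.
Next Obligation. by move=> Y p q; exact: continuous_ncomp_path. Qed.

Lemma codiscrete_map (X : mdspace R) (Y : topologicalType) (u : X -> Y) :
  continuous u -> exists h : mdmap X (codiscrete_md Y), h = u :> (X -> Y).
Proof.
move=> cu; suff eu : forall p, epath X p -> epath (codiscrete_md Y) (u \o p).
  by exists (@MDMap R X (codiscrete_md Y) u cu (fun _ _ => Logic.I) eu).
by move=> p /epath_continuous cp; exact: continuous_fun_comp cp cu.
Qed.

Lemma pushout_lift (B A W X : mdspace R) (i : mdmap B W) (g : mdmap B A)
    (gh : mdmap W X) (f : mdmap A X) (Y : topologicalType) (u : A -> Y) (v : W -> Y) :
  is_pushout k i g gh f -> in_top R k Y -> continuous u -> continuous v ->
  v \o i =1 u \o g ->
  exists2 h : X -> Y, continuous h & h \o f =1 u /\ h \o gh =1 v.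
Proof.
move=> [_ _ univ] Yk cu cv e.
have [u' uE] := codiscrete_map cu; have [v' vE] := codiscrete_map cv.
have [|h [hf hgh _]] := univ (codiscrete_md Y) u' v' Yk.
  by move=> x; have := e x; rewrite /= uE vE.
exists h; first exact: (@md_continuous R X (codiscrete_md Y) h).
by rewrite -uE -vE.
Qed.

Lemma pushout_uniq (B A W X : mdspace R) (i : mdmap B W) (g : mdmap B A)
    (gh : mdmap W X) (f : mdmap A X) (Y : topologicalType) (u v : X -> Y) :
  is_pushout k i g gh f -> in_top R k Y -> continuous u -> continuous v ->
  u \o f =1 v \o f -> u \o gh =1 v \o gh -> u =1 v.
Proof.
move=> [_ comm univ] Yk cu cv ef egh.
have [u' uE] := codiscrete_map cu; have [v' vE] := codiscrete_map cv.
have [|h [_ _ hu]] := univ (codiscrete_md Y) (mdcomp f u') (mdcomp gh u') Yk.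
  by move=> x /=; congr (u' _); exact: comm.
move=> x; rewrite -uE -vE; transitivity (h x); first exact: hu.
apply/esym; apply: hu => y /=; rewrite uE vE; first exact/esym/ef.
exact/esym/egh.
Qed.

Lemma top_pushout_uniq (S B C P Y : topologicalType) (i : S -> B) (j : S -> C)
    (u : B -> P) (v : C -> P) (h h' : P -> Y) :
  is_top_pushout R k i j u v -> in_top R k Y -> continuous h -> continuous h' ->
  h \o u =1 h' \o u -> h \o v =1 h' \o v -> h =1 h'.
Proof.
move=> [_ cu cv comm univ] Yk ch ch' eu ev.
have [||| w [_ wu]] := univ Y (h \o u) (h \o v) Yk.
- exact: continuous_fun_comp cu ch.
- exact: continuous_fun_comp cv ch.
- by move=> x /=; congr h; exact: comm.
have <- : w = h by apply: wu.
have <- // : w = h'.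
by apply: wu; split => // y.
Qed.

End Pushout.

(** * Maps out of globes *)

Section GlobeLift.
Variables (R : realType) (Z : topologicalType).
Local Notation I := (unitI R).

Lemma glob_ind (P : glob R Z -> Prop) :
  (forall b, P (glob_end R Z b)) -> (forall z t, P (glob_pt z t)) -> forall x, P x.
Proof.
move=> pe pp x; rewrite -[x]reprK; case: (repr x) => -[b|[z t]].
  exact: pe.
exact: pp.
Qed.

Lemma glob_pt_uncurry_continuous : continuous (fun z : Z * I => glob_pt z.1 z.2).
Proof.
apply: (continuous_eq (g := fun z : Z * I => \pi_(glob R Z) (inR bool z))).
  by move=> -[].
apply: (continuous_fun_comp (@inR_continuous _ _)).
exact: pi_continuous.
Qed.

Lemma glob_lift (Y : topologicalType) (C : Z * I -> Y) (y : bool -> Y) :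
  continuous C -> (forall z, C (z, I0) = y false) -> (forall z, C (z, I1) = y true) ->
  exists2 h : glob R Z -> Y, continuous h &
    (forall z t, h (glob_pt z t) = C (z, t)) /\ forall b, h (glob_end R Z b) = y b.
Proof.
move=> cC C0 C1.
pose c : preglob R Z -> Y := coprod_case y C.
have cnf u : c (glob_nf u) = c u.
  elim/coprod_ind: u => // -[z t] /=; case: eqP => [->|_] /=; first by rewrite C0.
  by case: eqP => [->|//] /=; rewrite C1.
have ch u v : \pi_(glob R Z) u = \pi_(glob R Z) v -> c u = c v.
  by move=> /glob_eqP e; rewrite -(cnf u) e cnf.
have hE u : c (repr (\pi_(glob R Z) u)) = c u by apply: ch; rewrite reprK.
exists (c \o repr); last by split => [z t|b] /=; rewrite hE.
have cc : continuous c.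
  apply: coprod_case_continuous => // b A /nbhs_singleton Ab.
  by rewrite /= nbhs_principalE; apply/principal_filterP.
have := @repr_comp_continuous _ (glob R Z) Y c cc; apply.
by move=> u v /eqP e; apply/eqP/ch.
Qed.

End GlobeLift.

(** * Radial extensions and markings *)

Section Radial.
Variable R : realType.

Lemma enorm0 n : enorm (0 : 'rV[R]_n) = 0.
Proof. by rewrite -[0 in LHS](scale0r 0) enormZ normr0 mul0r. Qed.

(* u extended to the disk by U (r s) = r (u s), for s in the sphere *)
Lemma radial_extension_param n (s0 : sphere R n) :
  exists2 N : disk R n -> sphere R n, (forall s, N (sphere_disk s) = s) &
    forall (T : topologicalType) (u : sphere R n * T -> R), continuous u ->
      (forall z, `|u z| <= 1) ->
      continuous (fun z : disk R n * T => enorm (diskval z.1) * u (N z.1, z.2)).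
Proof.
(* [N] is the radial projection to the sphere, with an arbitrary value at the center. *)
have Nex (x : disk R n) : exists s : sphere R n,
    enorm (diskval x) != 0 -> spherev s = (enorm (diskval x))^-1 *: diskval x.
  have [x0|x0] := eqVneq (enorm (diskval x)) 0; first by exists s0; rewrite ?x0 ?eqxx.
  have h : (enorm (diskval x))^-1 *: diskval x \in sphere_set R n.
    apply/mem_set/sphere_enorm; rewrite enormZ ger0_norm ?invr_ge0 ?enorm_ge0//.
    by rewrite mulVf.
  by exists (exist (fun v => v \in sphere_set R n) _ h).
have /choice[N NE] := Nex.
pose r (x : disk R n) := enorm (diskval x).
have cr : continuous r.
  exact: continuous_fun_comp (@diskval_continuous R n) (@enorm_continuous R n).
exists N.
  move=> s; have s1 : r (sphere_disk s) = 1 by apply/sphere_enorm; exact: spherevP.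
  by apply: spherev_inj; rewrite NE -/(r _) s1 ?oner_eq0// invr1 scale1r.
(* At the center [N] may be discontinuous; there continuity comes from the factor |x| and the bound
   |u| <= 1. *)
move=> T u cu u1 [x t]; have [x0|x0] := eqVneq (r x) 0.
  rewrite /continuous_at /= -/(r x) x0 mul0r.
  apply: (iffRL (@cvgrPdist_lt R R^o _ (nbhs (x, t)) _ _ _)) => e e0.
  have hx : nbhs x [set y | `|r x - r y| < e].
    exact: (@cvgr_dist_lt R R^o _ (nbhs x) _ r (r x) (cr x) e e0).
  exists ([set y | `|r x - r y| < e], setT); first by split => //; exact: filterT.
  move=> [y s] /= [+ _]; rewrite x0 !sub0r !normrN normrM; apply: le_lt_trans.
  by rewrite ler_piMr.
pose v (y : disk R n) : 'rV[R]_n := (r y)^-1 *: diskval y.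
have cv : {for x, continuous v}.
  exact: (@cvgZ R 'rV[R]_n _ (nbhs x) (nbhs_filter x) _ _ _ _
    (continuousV x0 (cr x)) (@diskval_continuous R n x)).
have cN : {for x, continuous N}.
  move=> B; rewrite {1}nbhsE => -[B' [[O oO OB'] B'x] B'B].
  have xO : nbhs x (v @^-1` O).
    apply: cv; apply: open_nbhs_nbhs; split => //.
    have -> : v x = spherev (N x) by rewrite NE.
    by move: B'x; rewrite -OB'.
  have xr : nbhs x [set y | r y != 0].
    have h : nbhs (r x) [set y : R | y != 0].
      by apply: open_nbhs_nbhs; split => //; exact: open_neq.
    exact: (cr x _ h).
  apply: filterS2 xO xr => y yO yr; apply: B'B; rewrite -OB' /=.
  by rewrite -[set_val (N y)]/(spherev (N y)) NE.
apply: (@continuousM R (disk R n * T)%type (fun z => r z.1) (fun z => u (N z.1, z.2)) (x, t)).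
  exact: (continuous_fun_comp (@fst_continuous _ _) cr).
apply: continuous_comp; last exact: cu.
have cN1 : {for (x, t), continuous (fun z : disk R n * T => N z.1)}.
  by apply: continuous_comp; [exact: fst_continuous|exact: cN].
exact: (@cvg_pair _ _ _ (nbhs (x, t)) (nbhs (N x)) (nbhs t) _ _ _
  (fun z : disk R n * T => N z.1) snd cN1 (@snd_continuous _ _ (x, t))).
Qed.

Lemma radial_extension n (u : sphere R n -> R) (s0 : sphere R n) : continuous u ->
  (forall s, `|u s| <= 1) ->
  exists2 U : disk R n -> R, continuous U & forall s, U (sphere_disk s) = u s.
Proof.
move=> cu u1; have [N NK cN] := radial_extension_param s0.
exists (fun x => enorm (diskval x) * u (N x)); last first.
  move=> s; have /sphere_enorm e := spherevP s.
  by rewrite NK -[diskval _]/(spherev s) e mul1r.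
have cu' : continuous (fun z : sphere R n * unitI R => u z.1).
  exact: continuous_fun_comp (@fst_continuous _ _) cu.
exact: (@continuous_pairr _ (unitI R) R
  (fun z => enorm (diskval z.1) * u (N z.1)) I0 (cN _ _ cu' (fun z => u1 z.1))).
Qed.

End Radial.

(** * Functions on the disk prescribed on the two hemispheres *)

Section Hemispheres.
Variables (R : realType) (k : topcat) (n : nat).
Local Notation I := (unitI R).
Variables (hemi1 hemi2 : disk R n -> sphere R n.+1).
Hypothesis hemiP : is_top_pushout R k (@sphere_disk R n) (@sphere_disk R n) hemi1 hemi2.

Lemma disk0_ex m : exists x : disk R m, diskval x = 0.
Proof.
have h : (0 : 'rV[R]_m) \in disk_set R m.
  by apply/mem_set/disk_enorm; rewrite enorm0.
by exists (exist (fun v => v \in disk_set R m) _ h).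
Qed.

(** Functions that agree on the equator form one function on the sphere by [hemiP], which is then
    extended radially. The bounds let the pushout property be used with [0,1], a space of Top, as
    target. *)
Lemma hemi_extension (u1 u2 : disk R n -> R) : continuous u1 -> continuous u2 ->
  (forall z, 0 <= u1 z <= 1) -> (forall z, 0 <= u2 z <= 1) ->
  (forall s, u1 (sphere_disk s) = u2 (sphere_disk s)) ->
  exists2 U : disk R n.+1 -> R, continuous U &
    (forall z, U (sphere_disk (hemi1 z)) = u1 z) /\
    (forall z, U (sphere_disk (hemi2 z)) = u2 z).
Proof.
move=> cu1 cu2 b1 b2 u12; have [_ _ _ _ univ] := hemiP.
have [|||| w [[cw w1 w2] _]] := univ I (@clampI R \o u1) (@clampI R \o u2).
- exact: I_in_top.
- exact: continuous_clampI.
- exact: continuous_clampI.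
- by move=> s /=; rewrite u12.
have [z0 _] := disk0_ex n.
have [|s|U cU UE] := radial_extension (hemi1 z0) (u := fun s => \val (w s)).
- exact: continuous_valI.
- by rewrite ger0_norm ?I_ge0 ?I_le1.
exists U => //; split => z; rewrite UE.
  by have /= -> := w1 z; have /andP[] := b1 z => *; rewrite clampI_val.
by have /= -> := w2 z; have /andP[] := b2 z => *; rewrite clampI_val.
Qed.

(** The coordinates of z, moved into [0,1] by y -> (1 + y)/2, are extended one at a time;
    [disk_proj] then brings the resulting vector back to the disk without changing it on the
    hemispheres. *)
Lemma disk_fold : exists2 rho : disk R n.+1 -> disk R n, continuous rho &
  forall z, rho (sphere_disk (hemi1 z)) = z /\ rho (sphere_disk (hemi2 z)) = z.
Proof.
have h (i : 'I_n) : exists U : disk R n.+1 -> R, continuous U /\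
    forall z, U (sphere_disk (hemi1 z)) = (1 + diskval z ord0 i) / 2 /\
              U (sphere_disk (hemi2 z)) = (1 + diskval z ord0 i) / 2.
  pose u (z : disk R n) := (1 + diskval z ord0 i) / 2.
  have cu : continuous u.
    by rewrite /u; continuity.
  have bu z : 0 <= u z <= 1.
    have /disk_enorm h1 := diskvalP z.
    have := le_trans (coord_le_enorm (diskval z) i) h1.
    by rewrite ler_norml /u => /andP[? ?]; apply/andP; split; lra.
  have [U cU [U1 U2]] := hemi_extension cu cu bu bu (fun=> erefl).
  by exists U; split => // z; rewrite U1 U2.
have /choice[U UE] := h.
have [p cp pK] := disk_proj R n.
exists (fun x => p (\row_i (2 * U i x - 1))).
  apply: continuous_fun_comp cp; apply: rV_continuous => i.
  by have [cU _] := UE i; apply: continuous_eq (fun x => mxE _ _ _ _) _; continuity.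
move=> z; split; rewrite -[RHS]pK; congr p; apply/rowP => i; rewrite mxE;
  have [_ /(_ z)[e1 e2]] := UE i.
  by rewrite e1 mulrC divfK ?pnatr_eq0// addrC addKr.
by rewrite e2 mulrC divfK ?pnatr_eq0// addrC addKr.
Qed.

(** 1 - |z|^2 vanishes on the equator, so it glues with 0 on the upper hemisphere, and it is
    positive on the interior of the lower one. It is the source of all functions that detect the
    part of the cell outside A. *)
Lemma disk_bump : exists2 c : disk R n.+1 -> I, continuous c &
  forall z, c (sphere_disk (hemi1 z)) = I0 /\
    \val (c (sphere_disk (hemi2 z))) = 1 - enorm (diskval z) ^+ 2.
Proof.
pose u (z : disk R n) := 1 - enorm (diskval z) ^+ 2.
have cu : continuous u by rewrite /u; continuity.
have bu z : 0 <= u z <= 1.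
  have /disk_enorm h1 := diskvalP z; rewrite /u subr_ge0 gerBl sqr_ge0 andbT.
  by rewrite expr_le1 ?enorm_ge0.
have b0 (z : disk R n) : (0 <= (0 : R)) && ((0 : R) <= 1) by rewrite lexx ler01.
have [|s|U cU [U1 U2]] := hemi_extension (u1 := fun=> 0) _ cu b0 bu.
- exact: cst_continuous.
- have /sphere_enorm h1 := spherevP s.
  by rewrite /u -[diskval _]/(spherev s) h1 expr1n subrr.
exists (@clampI R \o U); first exact: continuous_clampI.
move=> z; split => /=; first by rewrite U1 clampI_le0.
rewrite -[LHS]/(\val (clampI (U (sphere_disk (hemi2 z))))) U2.
by have /andP[? ?] := bu z; rewrite clampI_val.
Qed.

End Hemispheres.

(** * Markings of cellular objects *)

Section Marking.
Variables (R : realType) (k : topcat).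
Local Notation I := (unitI R).

(* a marking keeps every execution path away from the constant paths at the
   states, uniformly *)
Definition marking (X : mdspace R) (m : X -> I) : Prop :=
  [/\ continuous m, forall x, states X x -> m x = I0 &
      forall p, epath X p -> exists t, m (p t) = I1].

(* markings are the maps to this object, so colimits glue them *)
Program Definition marked_md : mdspace R :=
  @MDSpace R I [set I0] [set p : I -> I | [/\ continuous p, p I0 = I0, p I1 = I0 &
    exists t, p t = I1]] _ _ _ _.
Next Obligation. by move=> p []. Qed.
Next Obligation. by move=> p []. Qed.
Next Obligation.
move=> p phi [cp p0 p1 [t tE]] rphi; have [cphi _ sphi] := rphi; split.
- exact: continuous_fun_comp cphi cp.
- by rewrite /= reparam0.
- by rewrite /= reparam1.
- by have [s sE] := sphi t; exists s; rewrite /= sE.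
Qed.
Next Obligation.
move=> p q [cp p0 p1 [t tE]] [cq q0 q1 _] pq; split.
- exact: continuous_ncomp_path.
- by rewrite ncomp0.
- by rewrite ncomp1.
- by exists (Ileft t); rewrite ncomp_Ileft.
Qed.

Lemma marking_mdmap (X : mdspace R) (m : X -> I) : marking m ->
  exists h : mdmap X marked_md, h = m :> (X -> I).
Proof.
move=> [cm sm em]; suff em' : forall p, epath X p -> epath marked_md (m \o p).
  by exists (@MDMap R X marked_md m cm sm em').
move=> p ep; have [s0 s1] := epath_states ep; split.
- exact: continuous_fun_comp (epath_continuous ep) cm.
- exact: sm.
- exact: sm.
- exact: em.
Qed.

Lemma mdmap_marking (X : mdspace R) (h : mdmap X marked_md) : marking (h : X -> I).
Proof.
split; first exact: (@md_continuous R X marked_md h).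
  by move=> x /(md_states h).
by move=> p /(md_epath h)[].
Qed.

Lemma marking_comp (X Y : mdspace R) (h : mdmap X Y) (m : Y -> I) :
  marking m -> marking (m \o h).
Proof.
move=> [cm sm em]; split.
- exact: continuous_fun_comp (@md_continuous _ _ _ h) cm.
- by move=> x sx; apply/sm/md_states.
- by move=> p ep; have [t tE] := em _ (md_epath h ep); exists t.
Qed.

Lemma marking_pushout (B A W X : mdspace R) (i : mdmap B W) (g : mdmap B A)
    (gh : mdmap W X) (f : mdmap A X) (u : A -> I) (v : W -> I) :
  is_pushout k i g gh f -> marking u -> marking v -> v \o i =1 u \o g ->
  exists2 m : X -> I, marking m & m \o f =1 u.
Proof.
move=> [_ _ univ] /marking_mdmap[u' <-] /marking_mdmap[v' <-] e.
have [h [hf _ _]] := univ marked_md u' v' (I_in_top R k) e.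
by exists h; [exact: mdmap_marking|exact: hf].
Qed.

Definition tent (t : I) : R := Num.min (2 * \val t) (2 - 2 * \val t).

Lemma tent_continuous : continuous tent.
Proof. by rewrite /tent; continuity; exact: val_continuous. Qed.

Lemma tent_bound t : 0 <= tent t <= 1.
Proof.
have := I_ge0 t; have := I_le1 t; rewrite /tent; move: (\val t) => x x1 x0.
rewrite le_min ge_min; apply/andP; split; first by apply/andP; split; lra.
have [h|h] := leP x 2^-1; apply/orP; [left|right]; lra.
Qed.

Lemma tent0 : tent I0 = 0.
Proof. by rewrite /tent /= mulr0 subr0; apply/min_idPl. Qed.

Lemma tent1 : tent I1 = 0.
Proof. by rewrite /tent /= mulr1 subrr; apply/min_idPr. Qed.

Lemma tent_half : exists t, tent t = 1.
Proof.
exists (clampI 2^-1); rewrite /tent clampI_val; [|lra|lra].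
by rewrite mulfV ?pnatr_eq0//; apply/min_idPl; lra.
Qed.

Lemma marking_glob_lift (Z : topologicalType) (C : Z * I -> R) : continuous C ->
  (forall z, C (z, I0) = 0) -> (forall z, C (z, I1) = 0) ->
  (forall z, C z <= 1) ->
  (forall z, exists t, C (z, t) = 1) ->
  exists2 h : glob R Z -> I, marking (X := glob_md R Z) h &
    (forall z t, h (glob_pt z t) = clampI (C (z, t))) /\ forall b, h (glob_end R Z b) = I0.
Proof.
move=> cC C0 C1 Cle Cex.
have [|z|z|h ch [hp he]] := @glob_lift R Z I (@clampI R \o C) (fun=> I0).
- exact: continuous_clampI.
- by rewrite /= C0 clampI_le0.
- by rewrite /= C1 clampI_le0.
exists h => //; split => //; first by move=> _ [b _ <-]; exact: he.
move=> _ [z [phi [[_ _ sphi] ->]]]; have [t tE] := Cex z.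
by have [s sE] := sphi t; exists s; rewrite /= hp /= sE tE clampI_ge1.
Qed.

(** The radial extension is scaled by |x| and so misses the value 1 inside the disk. It is
    renormalized away from the center, and its maximum with a tent function takes over near the
    center. *)
Lemma marking_glob_extension n (u : glob R (sphere R n) -> I) :
  marking (X := glob_md R (sphere R n)) u ->
  exists2 v : glob R (disk R n) -> I, marking (X := glob_md R (disk R n)) v &
    v \o glob_incl R n =1 u.
Proof.
move=> [cu su eu].
have ue b : u (glob_end R (sphere R n) b) = I0 by apply: su; exists b.
(* Over an empty sphere only the ends of the globe are prescribed, and the tent function alone
   works. *)
have [[s0 _]|nos] := pselect (exists s : sphere R n, True); last first.
  have [|||||v mv [vp ve]] := @marking_glob_lift (disk R n) (fun z => tent z.2).
  - exact: continuous_fun_comp (@snd_continuous _ _) tent_continuous.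
  - by move=> z; exact: tent0.
  - by move=> z; exact: tent1.
  - by move=> z; have /andP[] := tent_bound z.2.
  - by move=> z; exact: tent_half.
  exists v => //; elim/glob_ind => [b|z t].
    by rewrite /= glob_map_end ve ue.
  by case: nos; exists z.
have [N NK cN] := radial_extension_param s0.
pose r (x : disk R n) := enorm (diskval x).
have cr : continuous r.
  exact: continuous_fun_comp (@diskval_continuous R n) (@enorm_continuous R n).
pose u' (z : sphere R n * I) : R := \val (u (glob_pt z.1 z.2)).
have cu' : continuous u'.
  apply: continuous_valI; apply: continuous_fun_comp cu.
  exact: glob_pt_uncurry_continuous.
have u'b z : 0 <= u' z <= 1 by rewrite I_ge0 I_le1.
pose w (z : disk R n * I) : R := r z.1 * u' (N z.1, z.2).
have cw : continuous w.
  by apply: cN => // z; have /andP[? ?] := u'b z; rewrite ger0_norm.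
(* w / d is u in the direction N x once |x| >= 1/2, and it stays continuous at the center because d
   >= 1/2. *)
pose d (x : disk R n) : R := Num.max (r x) 2^-1.
have d0 x : 0 < d x by rewrite /d lt_max invr_gt0 ltr0n orbT.
have cd : continuous d by rewrite /d; continuity.
(* C is u on the sphere, and C (x, -) reaches 1 through its first term when
   1/2 <= |x|, through the second one when |x| <= 1/2 *)
pose C (z : disk R n * I) : R :=
  Num.max (w z / d z.1) (Num.min 1 (2 - 2 * r z.1) * tent z.2).
have rb (x : disk R n) : 0 <= r x <= 1.
  by rewrite enorm_ge0; apply/disk_enorm; exact: diskvalP.
have wle z : w z / d z.1 <= 1.
  rewrite ler_pdivrMr// mul1r /w /d le_max; apply/orP; left.
  have /andP[r0 r1] := rb z.1; have /andP[? ?] := u'b (N z.1, z.2).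
  by rewrite ler_piMr.
have mle z : Num.min 1 (2 - 2 * r z.1) * tent z.2 <= 1.
  have /andP[r0 r1] := rb z.1; have /andP[t0 t1] := tent_bound z.2.
  have m1 : Num.min 1 (2 - 2 * r z.1) <= 1 by rewrite ge_min lexx.
  have m0 : 0 <= Num.min 1 (2 - 2 * r z.1) by rewrite le_min ler01; lra.
  exact: mulr_ile1.
have Cle z : C z <= 1 by rewrite /C ge_max wle mle.
have Cge z : 0 <= C z.
  rewrite /C le_max; apply/orP; left; have /andP[r0 r1] := rb z.1.
  by rewrite divr_ge0// ?(ltW (d0 _))// mulr_ge0// I_ge0.
have cC : continuous C.
  apply: continuous_funmax.
    apply: continuous_funM cw _; apply: continuous_funV.
      by move=> z; rewrite gt_eqF.
    exact: (continuous_fun_comp (@fst_continuous _ _) cd).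
  by have ct := tent_continuous; continuity.
have u'0 s : u' (s, I0) = 0 by rewrite /u' /= glob_pt0 ue.
have u'1 s : u' (s, I1) = 0 by rewrite /u' /= glob_pt1 ue.
have [||||v mv [vp ve]] := marking_glob_lift cC.
- by move=> z; rewrite /C /w /= u'0 mulr0 mul0r tent0 mulr0 maxxx.
- by move=> z; rewrite /C /w /= u'1 mulr0 mul0r tent1 mulr0 maxxx.
- exact: Cle.
- move=> x; have [h|h] := leP 2^-1 (r x).
    have [t tE] := eu _ (ex_intro _ (N x) (ex_intro _ id (conj (@reparam_id R) erefl))).
    exists t; apply/le_anti; rewrite Cle /= /C le_max; apply/orP; left.
    rewrite /w /d /u' /= (max_idPl h) [u _]tE /= mulr1 mulfV ?lexx//.
    by rewrite gt_eqF// (lt_le_trans _ h)// invr_gt0 ltr0n.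
  have [t tE] := tent_half; exists t; apply/le_anti; rewrite Cle /= /C le_max.
  apply/orP; right; rewrite tE mulr1 /= le_min lexx /=; lra.
exists v => //; elim/glob_ind => [b|s t]; first by rewrite /= glob_map_end ve ue.
rewrite /= glob_map_pt vp -[RHS]clampIK; congr clampI.
have s1 : r (sphere_disk s) = 1 by apply/sphere_enorm; exact: spherevP.
have [u0 _] := andP (u'b (s, t)).
rewrite /C /w /d /= s1 NK mul1r.
have -> : Num.max 1 2^-1 = 1 :> R by apply/max_idPl; lra.
rewrite divr1 mulr1 subrr (_ : Num.min 1 0 = 0 :> R) ?mul0r.
  exact/max_idPl.
exact/min_idPr.
Qed.

Lemma marking_cell_attachment (X Y : mdspace R) (h : mdmap X Y) (m : X -> I) :
  cell_attachment k h -> marking m ->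
  exists2 m' : Y -> I, marking m' & m' \o h =1 m.
Proof.
have mcst (S : choiceType) : marking (X := discrete_md R S) (fun=> I0).
  by split => //; exact: cst_continuous.
move=> [[n [a [b po]]]|[a [b po]]|[a [b po]]] mm.
- have [v mv ve] := marking_glob_extension (marking_comp a mm).
  exact: (marking_pushout po mm mv).
- by apply: (marking_pushout po mm (mcst unit)) => -[].
- apply: (marking_pushout po mm (mcst unit)) => x /=.
  have [_ sm _] := mm; apply/esym/sm.
  exact: (@md_states _ _ _ a).
Qed.

(** Transfinite recursion: [xget] chooses at each stage a marking that extends the earlier ones.
    That one exists is a well-founded induction with minimal, successor and limit stages; at limits
    the earlier markings form a cocone over [marked_md]. *)
Lemma cellular_marking (X : mdspace R) : cellular k X -> exists m : X -> I, marking m.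
Proof.
move=> [D [D0 Ds Dl [c [_ _ univ]]]].
pose good (a : tw_idx D) (rec : forall b, tw_lt b a -> tw_ob b -> I) (m : tw_ob a -> I) :=
  marking m /\ forall b (ba : tw_lt b a), m \o tw_map ba =1 rec b ba.
pose step (a : tw_idx D) (rec : forall b, tw_lt b a -> tw_ob b -> I) : tw_ob a -> I :=
  xget (fun=> I0) (good a rec).
pose M : forall a : tw_idx D, tw_ob a -> I :=
  Fix (@tw_wf R D) (fun a : tw_idx D => tw_ob a -> I) step.
have ME a : M a = step a (fun b _ => M b).
  rewrite /M Fix_eq// => x f g fg; congr step.
  by apply: functional_extensionality_dep => y; apply: functional_extensionality_dep => yx.
have MP a : good a (fun b _ => M b) (M a).
  elim/(well_founded_ind (@tw_wf R D)): a => a IH.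
  suff [m mP] : exists m, good a (fun b _ => M b) m by rewrite [M a]ME; exact: (xgetPex (fun=> I0) (ex_intro _ m mP)).
  have [amin|/existsNP[b0 /contrapT b0a]] := pselect (forall b, ~ tw_lt b a).
    have E := D0 a amin; exists (fun=> I0); split; last by move=> b ba; case: (amin b).
    split; [exact: cst_continuous|by []|].
    by move=> p _; case: (E (p I0)).
  (* With an immediate predecessor b, compatibility with all earlier stages follows from
     compatibility with b. *)
  have [[b [ba bmax]]|nomax] := pselect (exists b, exists ba : tw_lt b a,
      forall c, tw_lt b c -> ~ tw_lt c a).
    have [mb cb] := IH b ba.
    have [m mm mE] := marking_cell_attachment (Ds b a ba bmax) mb.
    exists m; split => // e ea x.
    have [eb|eb|be] := tw_total e b.
    - by rewrite -(cb e eb x) /= -(mE) /= -(tw_map_comp eb ba ea).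
    - by subst e; rewrite (Prop_irrelevance ea ba); exact: mE.
    - by case: (bmax e be ea).
  have lim b : tw_lt b a -> exists2 e, tw_lt b e & tw_lt e a.
    move=> ba; apply: contrapT => h; apply: nomax; exists b, ba => e be ea.
    by apply: h; exists e.
  have [_ _ univa] := Dl a (ex_intro _ b0 b0a) lim.
  pose d b (ba : tw_lt b a) : mdmap (tw_ob b) marked_md :=
    projT1 (cid (marking_mdmap (proj1 (IH b ba)))).
  have dE b (ba : tw_lt b a) : d b ba = M b :> (tw_ob b -> I).
    by rewrite /d; case: cid.
  have [|h [hd _]] := univa marked_md d (I_in_top R k).
    move=> b e ba ea be x; rewrite /= !dE.
    by have [_ ce] := IH e ea; exact: ce.
  exists h; split; first exact: mdmap_marking.
  by move=> b ba x; rewrite -dE; exact: hd.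
pose d b (_ : True) : mdmap (tw_ob b) marked_md :=
  projT1 (cid (marking_mdmap (proj1 (MP b)))).
have dE b Pb : d b Pb = M b :> (tw_ob b -> I) by rewrite /d; case: cid.
have [|h [hd _]] := univ marked_md d (I_in_top R k).
  move=> b e ba ea be x; rewrite /= !dE.
  by have [_ ce] := MP e; exact: ce.
by exists h; exact: mdmap_marking.
Qed.

Lemma cellular_in_top (X : mdspace R) : cellular k X -> in_top R k X.
Proof. by move=> [D [_ _ _ [c []]]]. Qed.

End Marking.

(** * The cell W and its attachment to A *)

Section WCell.
Variables (R : realType) (k : topcat) (n : nat) (F : set (glob R (disk R n))).
Variable D : Wdata k F.
Local Notation I := (unitI R).

(* F lies on the lower hemisphere, and i^n_F is the upper one *)
Definition lower (z : disk R n) : disk R n.+1 := sphere_disk (hemi2 D z).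
Definition upper (z : disk R n) : disk R n.+1 := sphere_disk (hemi1 D z).

Lemma hemi_bd s : hemi1 D (sphere_disk s) = hemi2 D (sphere_disk s).
Proof. by have [_ _ _ e _] := hemi_pushout D; exact: e. Qed.

Lemma upper_continuous : continuous upper.
Proof.
have [_ c1 _ _ _] := hemi_pushout D.
exact: continuous_fun_comp c1 (@sphere_disk_continuous R n.+1).
Qed.

Lemma lower_continuous : continuous lower.
Proof.
have [_ _ c2 _ _] := hemi_pushout D.
exact: continuous_fun_comp c2 (@sphere_disk_continuous R n.+1).
Qed.

Lemma w_upper z t : w_V D (v_glob D (glob_pt z t)) = w_glob D (glob_pt (upper z) t).
Proof.
have [_ comm _] := w_pushout D; have := comm (glob_pt (hemi1 D z) t).
by rewrite /= glob_map_pt theta1.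
Qed.

Lemma w_lower z t : w_V D (v_globF D (glob_pt z t)) = w_glob D (glob_pt (lower z) t).
Proof.
have [_ comm _] := w_pushout D; have := comm (glob_pt (hemi2 D z) t).
by rewrite /= glob_map_pt theta2.
Qed.

Lemma glob_end_pt (Z : topologicalType) (z : Z) b :
  glob_end R Z b = glob_pt z (if b then I1 else I0).
Proof. by case: b; rewrite ?glob_pt0 ?glob_pt1. Qed.

(** V is covered by its upper and lower globes, and both lie on the boundary of the globe of the
    larger disk, which therefore determines a map out of W. *)
Lemma W_uniq (Y : topologicalType) (u v : Wsp D -> Y) : in_top R k Y ->
  continuous u -> continuous v ->
  (forall x t, u (w_glob D (glob_pt x t)) = v (w_glob D (glob_pt x t))) -> u =1 v.
Proof.
move=> Yk cu cv uv.
have [x0 _] := disk0_ex R n.+1; have [z0 _] := disk0_ex R n.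
apply: (pushout_uniq (w_pushout D) Yk cu cv); last first.
  by elim/glob_ind => [b|x t] /=; rewrite ?(glob_end_pt x0).
have cwV := @md_continuous _ _ _ (w_V D).
apply: (pushout_uniq (v_pushout D) Yk).
- exact: continuous_fun_comp cwV cu.
- exact: continuous_fun_comp cwV cv.
- by elim/glob_ind => [b|z t] /=; rewrite ?(glob_end_pt z0) w_lower.
- by elim/glob_ind => [b|z t] /=; rewrite ?(glob_end_pt z0) w_upper.
Qed.

(** With [W_uniq], this states that |W| is the globe of the larger disk for maps to Top. On V the
    map is the restriction of C to the two hemispheres. *)
Lemma W_lift (Y : topologicalType) (C : disk R n.+1 * I -> Y) (y : bool -> Y) :
  in_top R k Y -> continuous C ->
  (forall x, C (x, I0) = y false) -> (forall x, C (x, I1) = y true) ->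
  exists2 h : Wsp D -> Y, continuous h &
    forall x t, h (w_glob D (glob_pt x t)) = C (x, t).
Proof.
move=> Yk cC C0 C1.
have ccomp (u : disk R n -> disk R n.+1) : continuous u ->
    continuous (fun z : disk R n * I => C (u z.1, z.2)).
  by move=> cu; continuity.
have [h ch [hp he]] := glob_lift cC C0 C1.
have [h1 ch1 [hp1 he1]] := glob_lift (ccomp _ upper_continuous)
  (fun z => C0 (upper z)) (fun z => C1 (upper z)).
have [h2 ch2 [hp2 he2]] := glob_lift (ccomp _ lower_continuous)
  (fun z => C0 (lower z)) (fun z => C1 (lower z)).
have [|v cv [v2 v1]] := pushout_lift (v_pushout D) Yk ch2 ch1.
  elim/glob_ind => [b|z t] /=; first by rewrite !glob_map_end he1 he2.
  by rewrite !glob_map_pt hp1 hp2 /= /upper hemi_bd.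
have [|w cw [wV wg]] := pushout_lift (w_pushout D) Yk cv ch.
  (* At a fixed height t both sides are continuous in the point s of the sphere, so they can be
     compared on the hemispheres. *)
  suff key s t : h (glob_incl R n.+1 (glob_pt s t)) = v (theta D (glob_pt s t)).
    have [z0 _] := disk0_ex R n.
    by elim/glob_ind => [b|s t]; rewrite /= ?(glob_end_pt (hemi1 D z0)); exact: key.
  have cpt : continuous (fun s : sphere R n.+1 => glob_pt s t).
    exact: (@continuous_pairr _ I _ (fun z => glob_pt z.1 z.2) t
      (@glob_pt_uncurry_continuous R _)).
  apply: (top_pushout_uniq (hemi_pushout D) Yk
    (h := fun s => h (glob_incl R n.+1 (glob_pt s t)))
    (h' := fun s => v (theta D (glob_pt s t)))).
  - apply: continuous_fun_comp ch.
    exact: (continuous_fun_comp cpt (@md_continuous _ _ _ (glob_incl R n.+1))).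
  - apply: continuous_fun_comp cv.
    exact: (continuous_fun_comp cpt (@md_continuous _ _ _ (theta D))).
  - move=> z /=; rewrite glob_map_pt hp theta1.
    by have /= -> := v1 (glob_pt z t); rewrite hp1.
  - move=> z /=; rewrite glob_map_pt hp theta2.
    by have /= -> := v2 (glob_pt z t); rewrite hp2.
by exists w => // x t; have /= -> := wg (glob_pt x t); exact: hp.
Qed.

(** Paths of the first globe of V are absorbed by those of [w_glob]; the lines of the lower
    hemisphere between states are the only other generators. *)
Lemma W_epath_ind (S : set (Wsp D)) (P : set (I -> Wsp D)) :
  (forall p, P p -> S (p I0) /\ S (p I1)) ->
  (forall p phi, epath (Wsp D) p -> P p -> reparam phi -> P (p \o phi)) ->
  (forall p q, epath (Wsp D) p -> epath (Wsp D) q -> P p -> P q ->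
    p I1 = q I0 -> P (ncomp p q)) ->
  (forall b, S (w_glob D (glob_end R _ b))) -> (forall x, F x -> S (Wstate D x)) ->
  (forall x phi, reparam phi -> P (w_glob D \o (glob_pt x \o phi))) ->
  (forall z psi, continuous psi -> nondecreasingI psi ->
    globF_states F (glob_pt z (psi I0)) -> globF_states F (glob_pt z (psi I1)) ->
    psi I0 <> psi I1 -> P (w_glob D \o (glob_pt (lower z) \o psi))) ->
  (forall x, states (Wsp D) x -> S x) /\ (forall p, epath (Wsp D) p -> P p).
Proof.
move=> PS Pr Pc Se SF Pg PF.
have [z0 _] := disk0_ex R n.
have endu b : w_V D (v_glob D (glob_end R _ b)) = w_glob D (glob_end R _ b).
  by rewrite (glob_end_pt z0) w_upper -!glob_end_pt.
have endl b : w_V D (v_globF D (glob_end R _ b)) = w_glob D (glob_end R _ b).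
  by rewrite (glob_end_pt z0) w_lower -!glob_end_pt.
have [sV eV] : (forall x, states (Vsp D) x -> S (w_V D x)) /\
    (forall p, epath (Vsp D) p -> P (w_V D \o p)).
  pose PV : set (I -> Vsp D) := [set p : I -> Vsp D | P (w_V D \o p)].
  pose SV : set (Vsp D) := [set x | S (w_V D x)].
  apply: (@pushout_ind R k _ _ _ _ _ _ _ _ SV PV (v_pushout D)).
  - by move=> p /PS.
  - by move=> p phi ep Pp; exact: Pr (md_epath (w_V D) ep) Pp.
  - move=> p q ep eq Pp Pq pq; rewrite /PV /mkset -ncomp_comp.
    by apply: Pc => //=; [exact: md_epath|exact: md_epath|rewrite pq].
  - move=> x [[b _ <-]|Fx] /=; first by rewrite /SV /mkset endl.
    exact: SF.
  - by move=> _ [b _ <-] /=; rewrite /SV /mkset endu.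
  - move=> p [[z [psi [cpsi npsi ->]]] [s0 s1 ne]] /=.
    have := PF z psi cpsi npsi s0 s1 (fun e => ne (congr1 (glob_pt z) e)).
    by rewrite /PV /mkset; congr P; apply/funext => t /=; rewrite w_lower.
  - move=> p [z [phi [rphi ->]]] /=; have := Pg (upper z) phi rphi.
    by rewrite /PV /mkset; congr P; apply/funext => t /=; rewrite w_upper.
apply: (pushout_ind (w_pushout D)) => //.
- by move=> _ [b _ <-]; exact: Se.
- by move=> p [x [phi [rphi ->]]]; exact: Pg.
Qed.

End WCell.

(** * Universal property and path induction for X *)

Section XCell.
Variables (R : realType) (k : topcat) (n : nat) (F : set (glob R (disk R n))).
Variables (D : Wdata k F) (A X : mdspace R).
Variables (g : mdmap (glob_md R (disk R n)) A) (f : mdmap A X) (gh : mdmap (Wsp D) X).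
Hypothesis X_pushout : is_pushout k (Wincl D) g gh f.
Local Notation I := (unitI R).

Definition cell (x : disk R n.+1) (t : I) : X := gh (w_glob D (glob_pt x t)).

Lemma cell_upper z t : cell (upper D z) t = f (g (glob_pt z t)).
Proof.
have [_ comm _] := X_pushout; have := comm (glob_pt z t).
by rewrite /= /cell -w_upper.
Qed.

Lemma cell_end x b : cell x (if b then I1 else I0) = f (g (glob_end R _ b)).
Proof.
have [z0 _] := disk0_ex R n.
by rewrite (glob_end_pt R z0) -cell_upper /cell -!glob_end_pt.
Qed.

Lemma cell0 x : cell x I0 = f (g (glob_end R _ false)).
Proof. exact: cell_end x false. Qed.

Lemma cell1 x : cell x I1 = f (g (glob_end R _ true)).
Proof. exact: cell_end x true. Qed.

Lemma gh_Wstate z t : gh (Wstate D (glob_pt z t)) = cell (lower D z) t.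
Proof. by rewrite /Wstate w_lower. Qed.

Lemma cell_continuous : continuous (fun z : disk R n.+1 * I => cell z.1 z.2).
Proof.
apply: (continuous_fun_comp _ (@md_continuous _ _ _ gh)).
apply: (continuous_fun_comp _ (@md_continuous _ _ _ (w_glob D))).
exact: glob_pt_uncurry_continuous.
Qed.

Lemma X_uniq (Y : topologicalType) (u v : X -> Y) : in_top R k Y ->
  continuous u -> continuous v -> u \o f =1 v \o f ->
  (forall x t, u (cell x t) = v (cell x t)) -> u =1 v.
Proof.
move=> Yk cu cv uvf uvc; apply: (pushout_uniq X_pushout Yk cu cv uvf).
have cgh := @md_continuous _ _ _ gh.
apply: (W_uniq Yk) => [||x t].
- exact: continuous_fun_comp cgh cu.
- exact: continuous_fun_comp cgh cv.
- exact: uvc.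
Qed.

Lemma X_lift (Y : topologicalType) (u : A -> Y) (C : disk R n.+1 * I -> Y) :
  in_top R k Y -> continuous u -> continuous C ->
  (forall x, C (x, I0) = u (g (glob_end R _ false))) ->
  (forall x, C (x, I1) = u (g (glob_end R _ true))) ->
  (forall z t, C (upper D z, t) = u (g (glob_pt z t))) ->
  exists2 h : X -> Y, continuous h &
    (forall y, h (f y) = u y) /\ forall x t, h (cell x t) = C (x, t).
Proof.
move=> Yk cu cC C0 C1 Cu.
have [w cw wE] := W_lift D (y := fun b => u (g (glob_end R _ b))) Yk cC C0 C1.
have [z0 _] := disk0_ex R n.
have [|h ch [hf hgh]] := pushout_lift X_pushout Yk cu cw.
  by elim/glob_ind => [b|z t] /=; rewrite ?(glob_end_pt R z0) w_upper wE.
by exists h => //; split => [y|x t]; [exact: hf|rewrite -wE; exact: hgh].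
Qed.

Lemma X_epath_ind (S : set X) (P : set (I -> X)) :
  (forall p, P p -> S (p I0) /\ S (p I1)) ->
  (forall p phi, epath X p -> P p -> reparam phi -> P (p \o phi)) ->
  (forall p q, epath X p -> epath X q -> P p -> P q -> p I1 = q I0 -> P (ncomp p q)) ->
  (forall y, states A y -> S (f y)) ->
  (forall z s, F (glob_pt z s) -> S (cell (lower D z) s)) ->
  (forall p, epath A p -> P (f \o p)) ->
  (forall x phi, reparam phi -> P (cell x \o phi)) ->
  (forall z psi, continuous psi -> nondecreasingI psi ->
    globF_states F (glob_pt z (psi I0)) -> globF_states F (glob_pt z (psi I1)) ->
    psi I0 <> psi I1 -> P (cell (lower D z) \o psi)) ->
  (forall x, states X x -> S x) /\ (forall p, epath X p -> P p).
Proof.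
move=> PS Pr Pc SA SF PA Pg PF.
have Send b : S (f (g (glob_end R _ b))) by apply/SA/md_states; exists b.
have [sW eW] : (forall x, states (Wsp D) x -> S (gh x)) /\
    (forall p, epath (Wsp D) p -> P (gh \o p)).
  pose PW : set (I -> Wsp D) := [set p : I -> Wsp D | P (gh \o p)].
  pose SW : set (Wsp D) := [set x | S (gh x)].
  apply: (@W_epath_ind R k n F D SW PW).
  - by move=> p /PS.
  - by move=> p phi ep Pp; exact: Pr (md_epath gh ep) Pp.
  - move=> p q ep eq Pp Pq pq; rewrite /PW /mkset -ncomp_comp.
    by apply: Pc => //=; [exact: md_epath|exact: md_epath|rewrite pq].
  - move=> b; have [x0 _] := disk0_ex R n.+1.
    by rewrite (glob_end_pt R x0) /SW /mkset -[gh _]/(cell _ _) cell_end.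
  - move=> x; elim/glob_ind: x => [b _|z t]; last by rewrite /SW /mkset gh_Wstate; exact: SF.
    have [z0 _] := disk0_ex R n.
    by rewrite (glob_end_pt R z0) /SW /mkset gh_Wstate cell_end.
  - by move=> x phi; exact: Pg.
  - by move=> z psi; exact: PF.
exact: (pushout_ind X_pushout).
Qed.

Lemma cell_epath x phi : reparam phi -> epath X (cell x \o phi).
Proof.
move=> rphi; apply: (md_epath gh (g := w_glob D \o (glob_pt x \o phi))).
by apply: (md_epath (w_glob D)); exists x, phi.
Qed.

Lemma lower_epath z psi : continuous psi -> nondecreasingI psi ->
  globF_states F (glob_pt z (psi I0)) -> globF_states F (glob_pt z (psi I1)) ->
  psi I0 <> psi I1 -> epath X (cell (lower D z) \o psi).
Proof.
move=> cpsi npsi s0 s1 ne.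
have -> : cell (lower D z) \o psi = gh \o (w_V D \o (v_globF D \o (glob_pt z \o psi))).
  by apply/funext => t /=; rewrite w_lower.
apply: md_epath; apply: md_epath; apply: md_epath; split; first by exists z, psi.
by split => // /glob_pt_height.
Qed.

End XCell.

(** * Retraction, homotopies and separating functions on X *)

Section XMaps.
Variables (R : realType) (k : topcat) (n : nat) (F : set (glob R (disk R n))).
Variables (D : Wdata k F) (A X : mdspace R).
Variables (g : mdmap (glob_md R (disk R n)) A) (f : mdmap A X) (gh : mdmap (Wsp D) X).
Hypothesis X_pushout : is_pushout k (Wincl D) g gh f.
Hypothesis A_in_top : in_top R k A.
Local Notation I := (unitI R).
Local Notation cell := (cell gh).
Variables (rho : disk R n.+1 -> disk R n) (c : disk R n.+1 -> I).
Hypothesis rho_continuous : continuous rho.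
Hypothesis rho_hemi : forall z, rho (upper D z) = z /\ rho (lower D z) = z.
Hypothesis c_continuous : continuous c.
Hypothesis c_hemi : forall z, c (upper D z) = I0 /\
  \val (c (lower D z)) = 1 - enorm (diskval z) ^+ 2.

Lemma X_in_top : in_top R k X.
Proof. by have [] := X_pushout. Qed.

Lemma X_retraction : exists2 r : X -> A, continuous r &
  (forall y, r (f y) = y) /\ forall x t, r (cell x t) = g (glob_pt (rho x) t).
Proof.
have cC : continuous (fun z : disk R n.+1 * I => g (glob_pt (rho z.1) z.2)).
  apply: (continuous_fun_comp _ (@md_continuous _ _ _ g)).
  apply: (@continuous_fun_comp _ (disk R n * I)%type _ (fun z : disk R n.+1 * I => (rho z.1, z.2))
    (fun z => glob_pt z.1 z.2)); last exact: glob_pt_uncurry_continuous.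
  by continuity.
have cid : continuous (id : A -> A) by move=> x; exact: cvg_id.
have [x|x|z t|r cr [rf rc]] := X_lift X_pushout A_in_top cid cC.
- by rewrite /= glob_pt0.
- by rewrite /= glob_pt1.
- by rewrite /= (rho_hemi z).1.
- by exists r.
Qed.

(** The pushout property speaks of X and not of X x [0,1], so the homotopy is lifted as a map from X
    to [TOP R X]. *)
Lemma X_deformation (G : (disk R n.+1 * I) * I -> disk R n.+1 * I) : continuous G ->
  (forall x s, (G ((x, I0), s)).2 = I0) -> (forall x s, (G ((x, I1), s)).2 = I1) ->
  (forall z t s, G ((upper D z, t), s) = (upper D z, t)) ->
  exists2 H : X * I -> X, continuous H &
    (forall y s, H (f y, s) = f y) /\
    forall x t s, H (cell x t, s) = cell (G ((x, t), s)).1 (G ((x, t), s)).2.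
Proof.
move=> cG G0 G1 Gu.
have [u cu uE] : exists2 u : A -> TOP R X, continuous u & forall y s, TOP_fun (u y) s = f y.
  have [|u cu uE] := TOP_lift (f := fun z : A * I => f z.1) (in_top_delta A_in_top).
    exact: (continuous_fun_comp (@fst_continuous _ _) (@md_continuous _ _ _ f)).
  by exists u.
have dD : delta_generated R (disk R n.+1 * I)%type.
  exact/simplex_retract_delta/simplex_retract_prodI/simplex_retract_disk.
have [|C cC CE] := TOP_lift (f := fun w => cell (G w).1 (G w).2) dD.
  apply: (@continuous_fun_comp _ (disk R n.+1 * I)%type _ G (fun z => cell z.1 z.2)) => //.
  exact: cell_continuous.
have [x|x|z t|h ch [hf hc]] := X_lift X_pushout (TOP_in_top X_in_top) cu cC.
- by apply/TOP_fun_inj/funext => s; rewrite CE uE G0 (cell0 X_pushout).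
- by apply/TOP_fun_inj/funext => s; rewrite CE uE G1 (cell1 X_pushout).
- by apply/TOP_fun_inj/funext => s; rewrite CE uE Gu (cell_upper X_pushout).
exists (fun z => TOP_fun (h z.1) z.2); first exact: TOP_uncurry.
by split => [y s|x t s] /=; rewrite ?hf ?uE// hc CE.
Qed.

Lemma X_id (u : X -> X) : continuous u -> (forall y, u (f y) = f y) ->
  (forall x t, u (cell x t) = cell x t) -> u =1 id.
Proof.
move=> cu uf uc; apply: (X_uniq X_pushout X_in_top) => //.
by move=> x; exact: cvg_id.
Qed.

(** The straight homotopy from x to [upper D (rho x)] in the convex disk, at constant height, which
    is why lines go to lines. It fixes the upper hemisphere because [rho (upper D z) = z]. *)
Lemma X_homotopy (r : X -> A) : continuous r -> (forall y, r (f y) = y) ->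
  (forall x t, r (cell x t) = g (glob_pt (rho x) t)) ->
  exists2 H : X * I -> X, continuous H &
    [/\ forall x, H (x, I0) = x, forall x, H (x, I1) = f (r x),
        forall y s, H (f y, s) = f y &
        forall x s, exists x', forall t, H (cell x t, s) = cell x' t].
Proof.
move=> cr rf rc.
have cv : continuous (fun w : disk R n.+1 * I => (1 - \val w.2) *: diskval w.1 +
    \val w.2 *: diskval (upper D (rho w.1))).
  apply: rV_continuous => i; have cu := @upper_continuous _ _ _ _ D.
  apply: (continuous_eq (g := fun w : disk R n.+1 * I => (1 - \val w.2) * diskval w.1 ord0 i +
    \val w.2 * diskval (upper D (rho w.1)) ord0 i)); first by move=> w; rewrite !mxE.
  by continuity.
have [|S cS SE] := disk_lift _ cv.
  by move=> w; apply: disk_convex; rewrite ?I_ge0 ?I_le1//; exact: diskvalP.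
pose G (w : (disk R n.+1 * I) * I) := (S (w.1.1, w.2), w.1.2).
have cG : continuous G.
  by rewrite /G; continuity.
have Su z s : S (upper D z, s) = upper D z.
  by apply: diskval_inj; rewrite SE /= (rho_hemi z).1 -scalerDl subrK scale1r.
have [|||H cH [Hf Hc]] := X_deformation cG => //.
  by move=> z t s; rewrite /G /= Su.
exists H => //; split => //.
- apply: X_id => //; first exact: continuous_pairr.
  move=> x t; rewrite Hc /=; congr cell; apply: diskval_inj.
  by rewrite SE /= subr0 scale1r scale0r addr0.
- apply: (X_uniq X_pushout X_in_top).
  + exact: continuous_pairr.
  + exact: continuous_fun_comp cr (@md_continuous _ _ _ f).
  + by move=> y /=; rewrite Hf rf.
  + move=> x t; rewrite Hc rc -(cell_upper X_pushout) /=; congr cell.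
    by apply: diskval_inj; rewrite SE /= subrr scale0r scale1r add0r.
- by move=> x s; exists (S (x, s)) => t; rewrite Hc.
Qed.

Lemma X_push (ka : (disk R n.+1 * I) * I -> I) : continuous ka ->
  (forall x s, ka ((x, I0), s) = I0) -> (forall x s, ka ((x, I1), s) = I1) ->
  (forall x t, ka ((x, t), I0) = t) -> (forall z t s, ka ((upper D z, t), s) = t) ->
  exists2 K : X * I -> X, continuous K &
  (forall x, K (x, I0) = x) /\ forall x t s, K (cell x t, s) = cell x (ka ((x, t), s)).
Proof.
move=> cka ka0 ka1 kas kau.
pose G (w : (disk R n.+1 * I) * I) := (w.1.1, ka w).
have cG : continuous G.
  by rewrite /G; continuity.
have [|||K cK [Kf Kc]] := X_deformation cG => //.
  by move=> z t s; rewrite /G kau.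
exists K => //; split => [|x t s]; last by rewrite Kc.
apply: X_id => //; first exact: continuous_pairr.
by move=> x t; rewrite Kc /= kas.
Qed.

Lemma X_function (v : disk R n.+1 * I -> I) : continuous v ->
  (forall x, v (x, I0) = I0) -> (forall x, v (x, I1) = I0) ->
  (forall z t, v (upper D z, t) = I0) ->
  exists2 m : X -> I, continuous m &
    (forall y, m (f y) = I0) /\ forall x t, m (cell x t) = v (x, t).
Proof.
move=> cv v0 v1 vu.
have [||||m cm [mf mc]] := X_lift X_pushout (u := fun=> I0) (I_in_top R k) _ cv.
- exact: cst_continuous.
- exact: v0.
- exact: v1.
- exact: vu.
- by exists m.
Qed.

(** The function mu in the coordinates of the cell: the factor c vanishes on the upper hemisphere
    and t (1 - t) at the two ends, so it extends by 0 to A. *)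
Definition cellmark (x : disk R n.+1) (t : I) : R := \val (c x) * (\val t * (1 - \val t)).

Lemma cellmark_bound x t : 0 <= cellmark x t <= 1.
Proof.
rewrite /cellmark; have := I_ge0 t; have := I_le1 t; have := I_ge0 (c x); have := I_le1 (c x).
move: (\val t) (\val (c x)) => a b b1 b0 a1 a0.
have h0 : 0 <= a * (1 - a) by rewrite mulr_ge0// subr_ge0.
have h1 : a * (1 - a) <= 1 by apply: mulr_ile1 => //; lra.
by rewrite mulr_ge0// mulr_ile1.
Qed.

(** An arbitrary function on the cell does not extend to X, but its product with [cellmark] vanishes
    where the cell is glued to A. *)
Lemma X_function_mul (v : disk R n.+1 * I -> I) : continuous v ->
  exists2 m : X -> I, continuous m &
    (forall y, m (f y) = I0) /\
    forall x t, \val (m (cell x t)) = cellmark x t * \val (v (x, t)).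
Proof.
move=> cv.
have ccm : continuous (fun z : disk R n.+1 * I => cellmark z.1 z.2).
  by rewrite /cellmark; continuity.
have cw : continuous (fun z : disk R n.+1 * I => clampI (cellmark z.1 z.2 * \val (v z))).
  by apply: continuous_clampI; apply: continuous_funM => //; exact: continuous_valI.
have [x|x|z t|m cm [mf mc]] := X_function cw.
- by rewrite /cellmark /= mul0r mulr0 mul0r clampI_le0.
- by rewrite /cellmark /= subrr !mulr0 mul0r clampI_le0.
- by rewrite /cellmark /= (c_hemi z).1 /= !mul0r clampI_le0.
exists m => //; split => // x t; rewrite mc.
have := cellmark_bound x t; have := I_ge0 (v (x, t)); have := I_le1 (v (x, t)).
move: (\val (v _)) (cellmark x t) => a b a1 a0 /andP[b0 b1].
by rewrite clampI_val ?mulr_ge0// mulr_ile1.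
Qed.

Lemma X_mu : exists2 m : X -> I, continuous m &
    (forall y, m (f y) = I0) /\ forall x t, \val (m (cell x t)) = cellmark x t.
Proof.
have [|m cm [mf mc]] := @X_function_mul (fun=> I1); first exact: cst_continuous.
by exists m => //; split => // x t; rewrite mc mulr1.
Qed.

Lemma cellmark_lower_gt0 z t : enorm (diskval z) < 1 -> 0 < \val t < 1 ->
  0 < cellmark (lower D z) t.
Proof.
move=> z1 /andP[t0 t1]; rewrite /cellmark (c_hemi z).2; apply: mulr_gt0; last by nra.
by have := enorm_ge0 (diskval z); nra.
Qed.

Lemma cell_lower_neq z t y : enorm (diskval z) < 1 -> 0 < \val t < 1 ->
  cell (lower D z) t <> f y.
Proof.
move=> z1 t01 e; have [m _ [mf mc]] := X_mu.
have := cellmark_lower_gt0 z1 t01; rewrite -mc e mf /=.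
by rewrite ltxx.
Qed.

(** Dividing the functions of [X_function_mul] by [cellmark], which is positive at the first point,
    recovers the height and the coordinates of rho, hence z. *)
Lemma cell_lower_inj z t z' t' : enorm (diskval z) < 1 -> 0 < \val t < 1 ->
  cell (lower D z) t = cell (lower D z') t' -> z = z' /\ t = t'.
Proof.
move=> z1 t01 e; have w0 := cellmark_lower_gt0 z1 t01.
have [m0 _ [_ mc0]] := X_mu.
have ew : cellmark (lower D z) t = cellmark (lower D z') t' by rewrite -!mc0 e.
have key (v : disk R n.+1 * I -> I) : continuous v -> v (lower D z, t) = v (lower D z', t').
  move=> cv; have [m _ [_ mc]] := X_function_mul cv.
  apply: I_inj; apply: (mulfI (lt0r_neq0 w0)).
  by rewrite -mc ew -mc e.
have et : t = t' by exact: (key snd (@snd_continuous _ _)).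
split => //; apply: diskval_inj; apply/rowP => i.
have ri (x : disk R n) : -1 <= diskval x ord0 i <= 1.
  by rewrite -ler_norml; apply: le_trans (coord_le_enorm _ _) _; exact/disk_enorm/diskvalP.
have cq : continuous (fun z : disk R n.+1 * I => clampI ((1 + diskval (rho z.1) ord0 i) / 2)).
  by continuity.
have /andP[a0 a1] := ri z; have /andP[b0 b1] := ri z'.
have := congr1 (fun u : I => \val u) (key _ cq); rewrite !(rho_hemi _).2.
rewrite !clampI_val; lra.
Qed.

End XMaps.

(** * Decomposition of execution paths *)

Section Decomposition.
Variables (R : realType) (k : topcat) (n : nat) (F : set (glob R (disk R n))).
Hypothesis F_interior : F `<=` ~` range (glob_incl R n).
Variables (D : Wdata k F) (A X : mdspace R).
Variables (g : mdmap (glob_md R (disk R n)) A) (f : mdmap A X) (gh : mdmap (Wsp D) X).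
Hypothesis X_pushout : is_pushout k (Wincl D) g gh f.
Local Notation I := (unitI R).
Local Notation cell := (cell gh).
Local Notation lower := (lower D).
Variables (rho : disk R n.+1 -> disk R n) (r : X -> A) (H : X * I -> X).
Hypothesis rf : forall y, r (f y) = y.
Hypothesis rc : forall x t, r (cell x t) = g (glob_pt (rho x) t).
Hypothesis Hf : forall y s, H (f y, s) = f y.
Hypothesis Hc : forall x s, exists x', forall t, H (cell x t, s) = cell x' t.
Hypothesis cell_neq : forall z (t : I) y, enorm (diskval z) < 1 -> 0 < \val t < 1 ->
  cell (lower z) t <> f y.
Hypothesis cell_inj : forall z (t : I) z' (t' : I), enorm (diskval z) < 1 -> 0 < \val t < 1 ->
  cell (lower z) t = cell (lower z') t' -> z = z' /\ t = t'.
Implicit Types (p q e : I -> X) (psi phi : I -> I).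

Lemma F_end b : ~ F (glob_end R _ b).
Proof. by move=> /F_interior; apply; exists (glob_end R _ b) => //; exact: glob_map_end. Qed.

Lemma F_bounds z t : F (glob_pt z t) -> enorm (diskval z) < 1 /\ 0 < \val t < 1.
Proof.
move=> /F_interior Fz.
have dz : enorm (diskval z) <= 1 by apply/disk_enorm; exact: diskvalP.
split.
  rewrite lt_neqAle dz andbT; apply/eqP => z1.
  have h : diskval z \in sphere_set R n by apply/mem_set/sphere_enorm.
  pose s : sphere R n := exist (fun v => v \in sphere_set R n) _ h.
  apply: Fz; exists (glob_pt s t) => //.
  by rewrite /= glob_map_pt; congr glob_pt; exact: diskval_inj.
have I0n : t <> I0.
  move=> t0; apply: Fz; exists (glob_end R _ false) => //.
  by rewrite t0 glob_pt0; exact: glob_map_end.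
have I1n : t <> I1.
  move=> t1; apply: Fz; exists (glob_end R _ true) => //.
  by rewrite t1 glob_pt1; exact: glob_map_end.
rewrite !lt_neqAle I_ge0 I_le1 !andbT; apply/andP; split; apply/eqP => h.
  by apply: I0n; apply: I_inj.
by apply: I1n; apply: I_inj.
Qed.

Definition old (a : X) : Prop := exists2 y, states A y & a = f y.
Definition new (a : X) : Prop := exists z s, F (glob_pt z s) /\ a = cell (lower z) s.

Lemma old_new a : old a -> new a -> False.
Proof.
move=> [y _ ->] [z [s [/F_bounds[z1 s01] e]]].
exact: (cell_neq z1 s01 (esym e)).
Qed.

Lemma new_inj z s z' s' : F (glob_pt z s) ->
  cell (lower z) s = cell (lower z') s' -> z = z' /\ s = s'.
Proof. by move=> /F_bounds[z1 s01]; exact: cell_inj. Qed.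

Lemma old_cell0 x : old (cell x I0).
Proof.
by rewrite (cell0 X_pushout); exists (g (glob_end R _ false)) => //; apply: md_states; exists false.
Qed.

Lemma old_cell1 x : old (cell x I1).
Proof.
by rewrite (cell1 X_pushout); exists (g (glob_end R _ true)) => //; apply: md_states; exists true.
Qed.

(* the paths of X that the retraction and the homotopy send to execution paths *)
Definition full p : Prop :=
  [/\ epath X p, epath A (r \o p), forall s, epath X (fun t => H (p t, s)) &
      old (p I0) /\ old (p I1)].

Lemma full_reparam p phi : full p -> reparam phi -> full (p \o phi).
Proof.
move=> [ep er eH [p0 p1]] rphi; split.
- exact: epath_reparam.
- exact: (epath_reparam er rphi).
- by move=> s; exact: (epath_reparam (eH s) rphi).
- by rewrite /= reparam0// reparam1.
Qed.

Lemma full_ncomp p q : full p -> full q -> p I1 = q I0 -> full (ncomp p q).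
Proof.
move=> [ep er eH [p0 p1]] [eq er' eH' [q0 q1]] pq; split.
- exact: epath_ncomp.
- by rewrite -ncomp_comp; apply: epath_ncomp => //=; rewrite pq.
- move=> s; rewrite -[X in epath _ X]/((fun x => H (x, s)) \o ncomp p q) -ncomp_comp.
  by apply: epath_ncomp (eH s) (eH' s) _; rewrite pq.
- by rewrite ncomp0 ncomp1.
Qed.

Lemma full_cell x phi : reparam phi -> full (cell x \o phi).
Proof.
move=> rphi; split.
- exact: cell_epath.
- have -> : r \o (cell x \o phi) = g \o (glob_pt (rho x) \o phi).
    by apply/funext => t /=; rewrite rc.
  by apply: md_epath; exists (rho x), phi.
- move=> s; have [x' x'E] := Hc x s.
  have -> : (fun t => H ((cell x \o phi) t, s)) = cell x' \o phi.
    by apply/funext => t /=; rewrite x'E.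
  exact: cell_epath.
- rewrite /= reparam0// reparam1//; split; [exact: old_cell0|exact: old_cell1].
Qed.

Lemma full_old (p : I -> A) : epath A p -> full (f \o p).
Proof.
move=> ep; have [s0 s1] := epath_states ep; split.
- exact: md_epath.
- by rewrite (_ : r \o _ = p)//; apply/funext => t /=.
- move=> s; rewrite (_ : (fun t => _) = f \o p); first exact: md_epath.
  by apply/funext => t /=.
- by split; [exists (p I0)|exists (p I1)].
Qed.

Definition line (z : disk R n) (psi : I -> I) (p : I -> X) : Prop :=
  [/\ continuous psi, nondecreasingI psi & p = cell (lower z) \o psi].

Definition tail_path p := exists z psi, [/\ line z psi p, psi I0 = I0 & F (glob_pt z (psi I1))].
Definition head_path p := exists z psi, [/\ line z psi p, F (glob_pt z (psi I0)) & psi I1 = I1].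
Definition mid_path p := exists z psi,
  [/\ line z psi p, F (glob_pt z (psi I0)), F (glob_pt z (psi I1)) & psi I0 <> psi I1].

Lemma line_reparam z psi p phi : line z psi p -> reparam phi ->
  line z (psi \o phi) (p \o phi).
Proof.
move=> [c nd ->] [cphi nphi _]; split => //; first exact: continuous_fun_comp cphi c.
exact: nondecreasingI_comp.
Qed.

Lemma line_ncomp z psi psi' p q : line z psi p -> line z psi' q -> psi I1 = psi' I0 ->
  line z (ncomp psi psi') (ncomp p q).
Proof.
move=> [c nd ->] [c' nd' ->] e; split; [exact: ncomp_continuous|exact: ncomp_nondecreasing|].
exact: ncomp_comp.
Qed.

Lemma tail_reparam p phi : tail_path p -> reparam phi -> tail_path (p \o phi).
Proof.
move=> [z [psi [l p0 p1]]] rphi; exists z, (psi \o phi); split; first exact: line_reparam.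
  by rewrite /= reparam0.
by rewrite /= reparam1.
Qed.

Lemma head_reparam p phi : head_path p -> reparam phi -> head_path (p \o phi).
Proof.
move=> [z [psi [l p0 p1]]] rphi; exists z, (psi \o phi); split; first exact: line_reparam.
  by rewrite /= reparam0.
by rewrite /= reparam1.
Qed.

Lemma mid_path_reparam p phi : mid_path p -> reparam phi -> mid_path (p \o phi).
Proof.
move=> [z [psi [l p0 p1 ne]]] rphi; exists z, (psi \o phi); split; first exact: line_reparam.
- by rewrite /= reparam0.
- by rewrite /= reparam1.
- by rewrite /= reparam0// reparam1.
Qed.

Lemma tail_ends p : tail_path p -> old (p I0) /\ new (p I1).
Proof.
move=> [z [psi [[_ _ ->] p0 p1]]]; split; first by rewrite /= p0; exact: old_cell0.
by exists z, (psi I1).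
Qed.

Lemma head_ends p : head_path p -> new (p I0) /\ old (p I1).
Proof.
move=> [z [psi [[_ _ ->] p0 p1]]]; split; last by rewrite /= p1; exact: old_cell1.
by exists z, (psi I0).
Qed.

Lemma mid_ends p : mid_path p -> new (p I0) /\ new (p I1).
Proof.
move=> [z [psi [[_ _ ->] p0 p1 _]]]; split; first by exists z, (psi I0).
by exists z, (psi I1).
Qed.

Lemma tail_epath p : tail_path p -> epath X p.
Proof.
move=> [z [psi [[c nd ->] p0 p1]]]; apply: lower_epath => //.
- by left; exists false => //; rewrite p0 glob_pt0.
- by right.
- by move=> e; have [_] := F_bounds p1; rewrite -e p0 /= ltxx.
Qed.

Lemma head_epath p : head_path p -> epath X p.
Proof.
move=> [z [psi [[c nd ->] p0 p1]]]; apply: lower_epath => //.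
- by right.
- by left; exists true => //; rewrite p1 glob_pt1.
- by move=> e; have [_] := F_bounds p0; rewrite e p1 /= ltxx andbF.
Qed.

Lemma mid_epath p : mid_path p -> epath X p.
Proof.
move=> [z [psi [[c nd ->] p0 p1 ne]]]; apply: lower_epath => //.
- by right.
- by right.
Qed.

Lemma line_full z psi p : line z psi p -> psi I0 = I0 -> psi I1 = I1 -> full p.
Proof.
by move=> [c nd ->] e0 e1; apply: full_cell; exact: reparam_of.
Qed.

(** A normal form in which pieces that meet at a state of F have been merged, so that a line ending
    in F can only come last. *)
Definition from_old p : Prop := [\/ full p, tail_path p |
  exists q l phi, [/\ full q, tail_path l, q I1 = l I0, reparam phi & p = ncomp q l \o phi]].

Definition from_new p : Prop := [\/ mid_path p, head_path p |
  exists h q phi, [/\ head_path h, from_old q, h I1 = q I0, reparam phi & p = ncomp h q \o phi]].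

Definition elementary p : Prop :=
  [\/ full p, tail_path p, head_path p | mid_path p].

Lemma from_old_reparam p phi : from_old p -> reparam phi -> from_old (p \o phi).
Proof.
move=> [fp|tp|[q [l [phi' [fq tl ql rphi' ->]]]]] rphi.
- by apply: Or31; exact: full_reparam.
- by apply: Or32; exact: tail_reparam.
- by apply: Or33; exists q, l, (phi' \o phi); split => //; exact: reparam_comp.
Qed.

Lemma from_new_reparam p phi : from_new p -> reparam phi -> from_new (p \o phi).
Proof.
move=> [fp|tp|[q [l [phi' [fq tl ql rphi' ->]]]]] rphi.
- by apply: Or31; exact: mid_path_reparam.
- by apply: Or32; exact: head_reparam.
- by apply: Or33; exists q, l, (phi' \o phi); split => //; exact: reparam_comp.
Qed.

Lemma from_old_ends p : from_old p -> old (p I0) /\ (old (p I1) \/ new (p I1)).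
Proof.
move=> [[_ _ _ [p0 p1]]|/tail_ends[p0 p1]|[q [l [phi [[_ _ _ [q0 _]] /tail_ends[_ l1] ql rphi ->]]]]].
- by split => //; left.
- by split => //; right.
- by rewrite /= reparam0// reparam1// ncomp0 ncomp1; split => //; right.
Qed.

Lemma from_new_ends p : from_new p -> new (p I0) /\ (old (p I1) \/ new (p I1)).
Proof.
move=> [/mid_ends[p0 p1]|/head_ends[p0 p1]|[h [q [phi [/head_ends[h0 _] /from_old_ends[_ q1] hq rphi ->]]]]].
- by split => //; right.
- by split => //; left.
- by rewrite /= reparam0// reparam1// ncomp0 ncomp1.
Qed.

Lemma from_old_epath p : from_old p -> epath X p.
Proof.
move=> [[]//|/tail_epath//|[q [l [phi [[eq _ _ _] /tail_epath el ql rphi ->]]]]].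
by apply: epath_reparam => //; exact: epath_ncomp.
Qed.

(** A state of F lies on a single line, so two lines that meet there are parts of the same one and
    their concatenation is again a line. *)
Lemma line_meet z psi p z' psi' q : line z psi p -> line z' psi' q ->
  F (glob_pt z (psi I1)) -> p I1 = q I0 -> [/\ line z (ncomp psi psi') (ncomp p q),
    z = z' & psi I1 = psi' I0].
Proof.
move=> lp lq Fz; have [_ _ pE] := lp; have [_ _ qE] := lq.
rewrite pE qE /= => /(new_inj Fz)[zz e]; subst z'; split => //.
by rewrite -pE -qE; exact: line_ncomp.
Qed.

(** As e starts at a state of F, it is either a head, which completes the line to one from 0 to 1,
    or a middle piece, which lengthens the tail. *)
Lemma tail_append p e : tail_path p -> elementary e -> p I1 = e I0 ->
  full (ncomp p e) \/ tail_path (ncomp p e).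
Proof.
move=> tp ee pe; have [_ p1] := tail_ends tp.
case: ee => [[_ _ _ [e0 _]]|/tail_ends[e0 _]|[z' [psi' [l' s' e1]]]|[z' [psi' [l' s' e1 _]]]].
- by rewrite pe in p1; case: (old_new e0 p1).
- by rewrite pe in p1; case: (old_new e0 p1).
- case: tp => z [psi [l s0 s1]]; left; have [ll _ _] := line_meet l l' s1 pe.
  by apply: line_full ll _ _; rewrite ?ncomp0 ?ncomp1.
- case: tp => z [psi [l s0 s1]]; right; have [ll zz _] := line_meet l l' s1 pe.
  by exists z, (ncomp psi psi'); split; rewrite ?ncomp0 ?ncomp1// zz.
Qed.

Lemma from_old_append p e : from_old p -> elementary e -> p I1 = e I0 ->
  from_old (ncomp p e).
Proof.
move=> [fp|tp|[q [l [phi [fq tl ql rphi ->]]]]] ee pe.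
- have [_ _ _ [_ p1]] := fp.
  case: ee => [fe|te|/head_ends[e0 _]|/mid_ends[e0 _]].
  + by apply: Or31; exact: full_ncomp.
  + apply: Or33; exists p, e, id; split => //; exact: reparam_id.
  + by rewrite pe in p1; case: (old_new p1 e0).
  + by rewrite pe in p1; case: (old_new p1 e0).
- by have [h|h] := tail_append tp ee pe; [apply: Or31|apply: Or32].
- have le : l I1 = e I0 by move: pe; rewrite /= reparam1// ncomp1.
  have E : ncomp (ncomp q l \o phi) e =
      ncomp q (ncomp l e) \o (@assocr R \o reparam_cat phi id).
    rewrite -[e in LHS]/(e \o id) ncomp_reparam//; [|exact: reparam_id|by rewrite ncomp1].
    by rewrite ncomp_assocr.
  have rr : reparam (@assocr R \o reparam_cat phi id).
    apply: reparam_comp; first exact: assocr_reparam.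
    by apply: reparam_catP => //; exact: reparam_id.
  have [h|h] := tail_append tl ee le; rewrite E.
    by apply: Or31; apply: full_reparam => //; apply: full_ncomp => //; rewrite ncomp0.
  by apply: Or33; exists q, (ncomp l e), (@assocr R \o reparam_cat phi id);
    split => //; rewrite ncomp0.
Qed.

Lemma from_new_append p e : from_new p -> elementary e -> p I1 = e I0 ->
  from_new (ncomp p e).
Proof.
move=> [mp|hp|[h [q [phi [hh fq hq rphi ->]]]]] ee pe.
- have [_ p1] := mid_ends mp; case: mp => z [psi [l s0 s1 ne]].
  case: ee => [[_ _ _ [e0 _]]|/tail_ends[e0 _]|[z' [psi' [l' s' e1]]]|[z' [psi' [l' s' e1 ne']]]].
  + by rewrite pe in p1; case: (old_new e0 p1).
  + by rewrite pe in p1; case: (old_new e0 p1).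
  + have [ll _ _] := line_meet l l' s1 pe; apply: Or32.
    by exists z, (ncomp psi psi'); split; rewrite ?ncomp0 ?ncomp1.
  + have [ll zz ss] := line_meet l l' s1 pe; apply: Or31; subst z'.
    exists z, (ncomp psi psi'); split; rewrite ?ncomp0 ?ncomp1//.
    have [_ nd _] := l; have [_ nd' _] := l'.
    move=> es; apply: ne; apply/I_inj/le_anti/andP; split; first exact/nd/I_ge0.
    by rewrite es ss; apply/nd'/I_ge0.
- have [_ p1] := head_ends hp.
  have fe : from_old e.
    case: ee => [fe|te|/head_ends[e0 _]|/mid_ends[e0 _]].
    + exact: Or31.
    + exact: Or32.
    + by rewrite pe in p1; case: (old_new p1 e0).
    + by rewrite pe in p1; case: (old_new p1 e0).
  by apply: Or33; exists p, e, id; split => //; exact: reparam_id.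
- have qe : q I1 = e I0 by move: pe; rewrite /= reparam1// ncomp1.
  have E : ncomp (ncomp h q \o phi) e =
      ncomp h (ncomp q e) \o (@assocr R \o reparam_cat phi id).
    rewrite -[e in LHS]/(e \o id) ncomp_reparam//; [|exact: reparam_id|by rewrite ncomp1].
    by rewrite ncomp_assocr.
  rewrite E; apply: Or33; exists h, (ncomp q e), (@assocr R \o reparam_cat phi id); split => //.
  + exact: from_old_append.
  + by rewrite ncomp0.
  + apply: reparam_comp; first exact: assocr_reparam.
    by apply: reparam_catP => //; exact: reparam_id.
Qed.

(** Being in normal form is not visibly stable under concatenation. Preserving normal forms when
    appended to them is, by associativity, and this makes the induction on generators go through. *)
Definition appendable p : Prop :=
  [/\ from_old p \/ from_new p,
      forall q, from_old q -> q I1 = p I0 -> from_old (ncomp q p) &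
      forall q, from_new q -> q I1 = p I0 -> from_new (ncomp q p)].

Lemma elementary_appendable e : elementary e -> appendable e.
Proof.
move=> ee; split => [|q|q].
- case: ee => h; [left|left|right|right]; [exact: Or31|exact: Or32|exact: Or32|exact: Or31].
- by move=> fq; exact: from_old_append.
- by move=> fq; exact: from_new_append.
Qed.

Lemma X_decomposition : (forall x, states X x -> old x \/ new x) /\
  (forall p, epath X p -> appendable p).
Proof.
apply: (@X_epath_ind R k n F D A X g f gh X_pushout (fun x => old x \/ new x) appendable).
- move=> p [[/from_old_ends[p0 p1]|/from_new_ends[p0 p1]] _ _]; split => //.
    by left.
  by right.
- move=> p phi _ [ip fo fn] rphi; split.
  + by case: ip => h; [left; exact: from_old_reparam|right; exact: from_new_reparam].
  + move=> q fq qp; have qp0 : q I1 = p I0 by rewrite qp /= reparam0.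
    rewrite -[q]/(q \o id) ncomp_reparam//; last exact: reparam_id.
    apply: from_old_reparam; first exact: fo.
    by apply: reparam_catP => //; exact: reparam_id.
  + move=> q fq qp; have qp0 : q I1 = p I0 by rewrite qp /= reparam0.
    rewrite -[q]/(q \o id) ncomp_reparam//; last exact: reparam_id.
    apply: from_new_reparam; first exact: fn.
    by apply: reparam_catP => //; exact: reparam_id.
- move=> p q _ _ [ip fo fn] [iq fo' fn'] pq; split.
  + by case: ip => h; [left; exact: fo'|right; exact: fn'].
  + move=> u fu; rewrite ncomp0 => up; rewrite ncomp_assocl//.
    apply: from_old_reparam; last exact: assocl_reparam.
    by apply: fo'; rewrite ?ncomp1//; exact: fo.
  + move=> u fu; rewrite ncomp0 => up; rewrite ncomp_assocl//.
    apply: from_new_reparam; last exact: assocl_reparam.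
    by apply: fn'; rewrite ?ncomp1//; exact: fn.
- by move=> y sy; left; exists y.
- by move=> z s Fz; right; exists z, s.
- by move=> p ep; apply: elementary_appendable; apply: Or41; exact: full_old.
- by move=> x phi rphi; apply: elementary_appendable; apply: Or41; exact: full_cell.
- move=> z psi c nd s0 s1 ne; apply: elementary_appendable.
  (* Each end of a line is at 0, at 1 or in F; of the nine combinations, the constant and the
     decreasing ones are excluded. *)
  have fs t : globF_states F (glob_pt z t) -> [\/ t = I0, t = I1 | F (glob_pt z t)].
    move=> [[b _]|Fz]; last exact: Or33.
    by case: b; rewrite -?(glob_pt0 R z) -?(glob_pt1 R z) => /glob_pt_height <-;
      [apply: Or32|apply: Or31].
  have lz : line z psi (cell (lower z) \o psi) by [].
  have l0 : \val (psi I0) <= \val (psi I1) by apply/nd/I_ge0.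
  case: (fs _ s0) (fs _ s1) => [e0|e0|F0] [e1|e1|F1].
  + by case: ne; rewrite e0 e1.
  + by apply: Or41; exact: line_full lz _ _.
  + by apply: Or42; exists z, psi.
  + by move: l0; rewrite e0 e1 /= ler10.
  + by case: ne; rewrite e0 e1.
  + by have [_ /andP[_ h]] := F_bounds F1; move: l0; rewrite e0 leNgt => /negP; case.
  + by have [_ /andP[h _]] := F_bounds F0; move: l0; rewrite e1 leNgt => /negP; case.
  + by apply: Or43; exists z, psi.
  + by apply: Or44; exists z, psi.
Qed.

Lemma epath_from_new p : epath X p -> new (p I0) -> from_new p.
Proof.
move=> /(X_decomposition.2)[[fo|//] _ _] p0; have [o0 _] := from_old_ends fo.
by case: (old_new o0 p0).
Qed.

Lemma epath_from_old p : epath X p -> old (p I0) -> from_old p.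
Proof.
move=> /(X_decomposition.2)[[//|fn] _ _] p0; have [n0 _] := from_new_ends fn.
by case: (old_new p0 n0).
Qed.

Lemma epath_full p : epath X p -> old (p I0) -> old (p I1) -> full p.
Proof.
move=> ep p0 p1; case: (epath_from_old ep p0) => //.
  by move=> /tail_ends[_ n1]; case: (old_new p1 n1).
move=> [q [l [phi [_ /tail_ends[_ l1] _ rphi pE]]]].
by move: p1; rewrite pE /= reparam1// ncomp1 => p1; case: (old_new p1 l1).
Qed.

End Decomposition.

(** * Deformation retracts on spaces of traces *)

Section PostMap.
Variables (R : realType) (k : topcat).
Local Notation I := (unitI R).

Lemma Iplus_post_map (X Y : mdspace R) (u : X -> Y) (a b : X) (a' b' : Y)
    (e : a = b -> a' = b') : continuous u -> u a = a' -> u b = b' ->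
  (forall p, epath X p -> p I0 = a -> p I1 = b -> epath Y (u \o p)) ->
  exists F : Iplus_hom k a b -> Iplus_hom k a' b', [/\ continuous F,
    forall h, F (Iid k h) = Iid k (e h) &
    forall p, exists2 q, F (Itr k p) = Itr k q & epaths_fun q = u \o epaths_fun p].
Proof.
move=> cu ua ub eu.
have /choice[G GE] (p : epaths a b) : exists q : epaths a' b', epaths_fun q = u \o epaths_fun p.
  have [pe p0 p1] := epathsP p.
  by apply: epaths_mk; [exact: eu|rewrite /= p0|rewrite /= p1].
have cG : continuous G.
  apply: epaths_delta_continuous => m s cs; apply: epaths_curry; first exact: simplex_delta.
  apply: (continuous_eq (g := fun z : simplex R m * I => u (epaths_fun (s z.1) z.2))).
    by move=> z; rewrite /= GE.
  exact: (continuous_fun_comp (epaths_uncurry cs) cu).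
have [|T [cT Tid Ttr]] := Iplus_map k e cG.
  by move=> p q phi rphi qE; exists phi => //; rewrite !GE qE.
by exists T; split => // p; exists (G p).
Qed.

(** Only the paths from f a to f b have to be preserved: the retraction of a path with an end in F
    need not be an execution path of A. *)
Lemma Iplus_deformation_retract (A X : mdspace R) (f : A -> X) (r : X -> A)
    (H : X * I -> X) (a b : A) :
  continuous f -> continuous r -> continuous H ->
  (forall y, r (f y) = y) -> (forall x, H (x, I0) = x) -> (forall x, H (x, I1) = f (r x)) ->
  (forall y s, H (f y, s) = f y) ->
  (forall p, epath A p -> epath X (f \o p)) ->
  (forall p, epath X p -> p I0 = f a -> p I1 = f b ->
    epath A (r \o p) /\ forall s, epath X (fun t => H (p t, s))) ->
  homotopy_equivalent R (Iplus_hom k (f a) (f b)) (Iplus_hom k a b).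
Proof.
move=> cf cr cH rf H0 H1 Hf ef er.
have er' p : epath X p -> p I0 = f a -> p I1 = f b -> epath A (r \o p).
  by move=> ep p0 p1; have [] := er p ep p0 p1.
have e : f a = f b -> a = b by move=> h; rewrite -(rf a) h rf.
have [F [cF Fid Ftr]] := Iplus_post_map e cr (rf a) (rf b) er'.
have [G [cG Gid Gtr]] := Iplus_post_map (fun h => congr1 f h) cf erefl erefl
  (fun (p : I -> A) ep (_ : p I0 = a) (_ : p I1 = b) => ef p ep).
exists F, G; split => //; last first.
  exists (fun z => F (G z.1)); split => //.
    have cFG := continuous_fun_comp cG cF.
    exact: (continuous_fun_comp (@fst_continuous _ _) cFG).
  elim/Iplus_ind => [h|p]; first by rewrite /= Gid Fid; exact: Iid_irr.
  have [q qE qf] := Gtr p; have [q' q'E q'f] := Ftr q.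
  rewrite /= qE q'E; congr (Itr k _); apply: epaths_fun_inj; rewrite q'f qf.
  by apply/funext => t /=.
(* [Irev] appears because H runs from the identity to the retraction, whereas the homotopy required
   here starts at the composite. *)
have hs_ex (z : epaths (f a) (f b) * I) : exists q : epaths (f a) (f b),
    epaths_fun q = fun t => H (epaths_fun z.1 t, Irev z.2).
  have [ep p0 p1] := epathsP z.1; have [_ eH] := er _ ep p0 p1.
  by apply: epaths_mk; [exact: eH|rewrite p0 Hf|rewrite p1 Hf].
have /choice[hs hsE] := hs_ex.
have chs m (s : simplex R m -> epaths (f a) (f b)) : continuous s ->
    continuous (fun z : simplex R m * I => hs (s z.1, z.2)).
  move=> cs; apply: epaths_curry.
    exact/simplex_retract_delta/simplex_retract_prodI/simplex_retract_simplex.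
  apply: (continuous_eq (g := fun w : (simplex R m * I) * I =>
    H (epaths_fun (s w.1.1) w.2, Irev w.1.2))) => [w|]; first by rewrite /= hsE.
  have cI := @Irev_continuous R; apply: continuous_fun_comp cH; continuity.
  apply: (@continuous_fun_comp _ (simplex R m * I)%type _
    (fun w : (simplex R m * I) * I => (w.1.1, w.2)) (fun z => epaths_fun (s z.1) z.2));
    last exact: epaths_uncurry.
  by continuity.
(* The homotopy is descended to traces as a map to a function space and uncurried afterwards, which
   avoids forming the quotient of a product. *)
pose Z : topologicalType := {compact-open, I -> Iplus_hom k (f a) (f b)}.
pose M (p : epaths (f a) (f b)) : Z := fun s => Itr k (hs (p, s)).
have cM : continuous M.
  apply: epaths_delta_continuous => m s cs.
  apply: (@continuous_curryI R _ _ (fun z : simplex R m * I => Itr k (hs (s z.1, z.2)))).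
  exact: (continuous_fun_comp (chs m s cs) (@Itr_continuous _ _ _ _ _)).
have sZ : top_separated R k Z by apply: top_separated_compact_open; exact: top_separated_Iplus.
have [|N [cN Nid Ntr]] := Iplus_lift (fun h => (fun=> Iid k h) : Z) sZ cM.
  move=> p q phi rphi qE; apply/funext => s; apply/esym/(Itr_reparam k rphi).
  by rewrite !hsE /= qE.
exists (fun z => N z.1 z.2); split.
- apply: continuous_uncurryI => //; elim/Iplus_ind => [h|p].
    by rewrite Nid; exact: cst_continuous.
  rewrite Ntr; apply: (continuous_fun_comp _ (@Itr_continuous _ _ _ _ _)).
  apply: epaths_curry; first exact/simplex_retract_delta/simplex_retract_I.
  apply: (continuous_eq (g := fun w : I * I => H (epaths_fun p w.2, Irev w.1))) => [w|].
    by rewrite hsE.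
  have [/epath_continuous cp _ _] := epathsP p; have cI := @Irev_continuous R.
  by continuity.
- elim/Iplus_ind => [h|p] /=; first by rewrite Nid Fid Gid; exact: Iid_irr.
  have [q qE qf] := Ftr p; have [q' q'E q'f] := Gtr q.
  rewrite Ntr qE q'E; congr (Itr k _); apply: epaths_fun_inj; rewrite hsE q'f qf.
  by apply/funext => t /=; rewrite Irev0 H1.
- elim/Iplus_ind => [h|p] /=; first by rewrite Nid.
  rewrite Ntr; congr (Itr k _); apply: epaths_fun_inj; rewrite hsE /=.
  by apply/funext => t; rewrite Irev1 H0.
Qed.

End PostMap.

(** * Arrows of W between states of F *)

Section WHoms.
Variables (R : realType) (k : topcat) (n : nat) (F : set (glob R (disk R n))).
Hypothesis F_interior : F `<=` ~` range (glob_incl R n).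
Variable D : Wdata k F.
Local Notation I := (unitI R).
Variables (rho : disk R n.+1 -> disk R n).
Hypothesis rho_continuous : continuous rho.
Hypothesis rho_hemi : forall z, rho (upper D z) = z /\ rho (lower D z) = z.

Let bump (t : R) : R := t * (1 - t).

(* ht is the height and w / bump ht the function v, which is thus constant along
   the execution paths; at the ends of W, where bump ht = 0, v is undefined *)
Lemma W_epath_monotone (v : disk R n.+1 -> I) : continuous v ->
  exists ht w : Wsp D -> R,
    [/\ forall x t, ht (w_glob D (glob_pt x t)) = \val t,
        forall x t, w (w_glob D (glob_pt x t)) = bump (\val t) * \val (v x) &
        forall p, epath (Wsp D) p ->
          (forall s t, \val s <= \val t -> ht (p s) <= ht (p t)) /\
          forall s t, w (p s) * bump (ht (p t)) = w (p t) * bump (ht (p s))].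
Proof.
move=> cv.
have [||h ch hE] := @W_lift R k n F D I snd (fun b => if b then I1 else I0) (I_in_top R k)
  (@snd_continuous _ _) => //.
have cb : continuous (fun z : disk R n.+1 * I => clampI (bump (\val z.2) * \val (v z.1))).
  by rewrite /bump; continuity.
have [x|x|m cm mE] := @W_lift R k n F D I _ (fun b => I0) (I_in_top R k) cb.
- by rewrite /bump /= mul0r mul0r clampI_le0.
- by rewrite /bump /= subrr mulr0 mul0r clampI_le0.
have mvE x t : \val (m (w_glob D (glob_pt x t))) = bump (\val t) * \val (v x).
  rewrite mE -[LHS]/(\val (clampI (bump (\val t) * \val (v x)))).
  have := I_ge0 t; have := I_le1 t; have := I_ge0 (v x); have := I_le1 (v x).
  rewrite /bump; move: (\val t) (\val (v x)) => a b b1 b0 a1 a0.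
  have h0 : 0 <= a * (1 - a) by rewrite mulr_ge0// subr_ge0.
  have h1 : a * (1 - a) <= 1 by apply: mulr_ile1 => //; lra.
  by apply: clampI_val; [exact: mulr_ge0|exact: mulr_ile1].
pose ht x : R := \val (h x); pose w x : R := \val (m x).
have htE x t : ht (w_glob D (glob_pt x t)) = \val t by rewrite /ht hE.
have ht0 x : 0 <= ht x by exact: I_ge0.
have ht1 x : ht x <= 1 by exact: I_le1.
exists ht, w; split => //.
(* The middle clause serves the induction: at an end of W the cross products of the last clause
   carry no information about v. *)
pose P (p : I -> Wsp D) := [/\ forall s t, \val s <= \val t -> ht (p s) <= ht (p t),
  forall t, bump (ht (p t)) = 0 -> w (p t) = 0 &
  forall s t, w (p s) * bump (ht (p t)) = w (p t) * bump (ht (p s))].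
suff [_ PP] : (forall x, states (Wsp D) x -> [set: Wsp D] x) /\
    (forall p, epath (Wsp D) p -> P p) by move=> p /PP[].
have Pcell x psi : nondecreasingI psi -> P (w_glob D \o (glob_pt x \o psi)).
  move=> nd; split => [s t st|t|s t]; rewrite /= /w ?mvE ?htE.
  - exact: nd.
  - by move=> ->; rewrite mul0r.
  - by ring.
apply: W_epath_ind => //.
- move=> p phi _ [p1 p2 p3] [_ nphi _]; split => [s t st|t|s t] /=.
  + exact/p1/nphi.
  + exact: p2.
  + exact: p3.
- move=> p q _ _ [p1 p2 p3] [q1 q2 q3] pq.
  have pu s : ht (p s) <= ht (p I1) by apply/p1/I_le1.
  have uq t : ht (p I1) <= ht (q t) by rewrite pq; apply/q1/I_ge0.
  (* A nonzero bump at the junction is cancelled. Otherwise the junction is at height 0 or 1, and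
     monotonicity confines p or q to that end, where both sides vanish. *)
  have cross s t : w (p s) * bump (ht (q t)) = w (q t) * bump (ht (p s)).
    have [B0|B0] := eqVneq (bump (ht (p I1))) 0; last first.
      have e1 := p3 s I1; have e2 := q3 I0 t; rewrite -pq in e2.
      apply: (mulIf B0); rewrite mulrAC e1 mulrAC e2.
      by rewrite mulrAC.
    have : (ht (p I1) == 0) || (1 == ht (p I1)).
      by rewrite -[1 == _]subr_eq0 -mulf_eq0; apply/eqP.
    move=> /orP[/eqP u0|/eqP u1].
      have s0 : bump (ht (p s)) = 0.
        have -> : ht (p s) = 0 by apply/le_anti; rewrite ht0 andbT -u0.
        by rewrite /bump mul0r.
      by rewrite s0 (p2 _ s0) mul0r mulr0.
    have t0 : bump (ht (q t)) = 0.
      have -> : ht (q t) = 1 by apply/le_anti; rewrite ht1 {1}u1 uq.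
      by rewrite /bump subrr mulr0.
    by rewrite t0 (q2 _ t0) mul0r mulr0.
  split => [s t|t|s t].
  + have [[s' ->]|[s' ->]] := I_halfP s; have [[t' ->]|[t' ->]] := I_halfP t;
      rewrite ?ncomp_Ileft ?ncomp_Iright// => st.
    * by apply: p1; move: st; rewrite !val_Ileft; lra.
    * by apply: le_trans (pu _) (uq _).
    * have [s0 t1] : \val s' = 0 /\ \val t' = 1.
        move: st; rewrite val_Ileft val_Iright; have := I_ge0 s'; have := I_le1 t'.
        by move=> ? ? ?; split; lra.
      have -> : s' = I0 by apply: I_inj.
      have -> : t' = I1 by apply: I_inj.
      by rewrite pq.
    * by apply: q1; move: st; rewrite !val_Iright; lra.
  + have [[t' ->]|[t' ->]] := I_halfP t; rewrite ?ncomp_Ileft ?ncomp_Iright//.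
      exact: p2.
    exact: q2.
  + have [[s' ->]|[s' ->]] := I_halfP s; have [[t' ->]|[t' ->]] := I_halfP t;
      rewrite ?ncomp_Ileft ?ncomp_Iright//.
- by move=> x phi [_ nphi _]; exact: Pcell.
- by move=> z psi _ nd _ _ _; exact: Pcell.
Qed.

Lemma Wstate_pt z t : Wstate D (glob_pt z t) = w_glob D (glob_pt (lower D z) t).
Proof. by rewrite /Wstate w_lower. Qed.

Lemma W_bump_gt0 (t : I) : 0 < \val t < 1 -> 0 < bump (\val t).
Proof. by move=> /andP[t0 t1]; rewrite mulr_gt0// subr_gt0. Qed.

Lemma coord_I (i : 'I_n) : exists2 v : disk R n.+1 -> I, continuous v &
  forall x, \val (v x) = (1 + diskval (rho x) ord0 i) / 2.
Proof.
exists (fun x => clampI ((1 + diskval (rho x) ord0 i) / 2)).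
  by continuity.
move=> x; have : -1 <= diskval (rho x) ord0 i <= 1.
  by rewrite -ler_norml; apply: le_trans (coord_le_enorm _ _) _; exact/disk_enorm/diskvalP.
by move=> /andP[? ?]; rewrite clampI_val; lra.
Qed.

(** [W_epath_monotone], applied to the coordinates of rho, shows that an arrow preserves z: the bump
    is nonzero at states of F. Conversely, the affine line from t to t' is an execution path if t <
    t'. *)
Lemma W_hom z t z' t' : F (glob_pt z t) -> F (glob_pt z' t') ->
  (exists _ : Iplus_hom k (Wstate D (glob_pt z t)) (Wstate D (glob_pt z' t')), True) <->
  z = z' /\ \val t <= \val t'.
Proof.
move=> Fz Fz'; have [_ /W_bump_gt0 b0] := F_bounds F_interior Fz.
have [_ /W_bump_gt0 b0'] := F_bounds F_interior Fz'.
split => [[y _]|[zz tt']]; last subst z'.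
  have key (v : disk R n.+1 -> I) : continuous v ->
      v (lower D z) = v (lower D z') /\ \val t <= \val t'.
    move=> cv; have [ht [w [hE wE ep]]] := W_epath_monotone cv.
    elim/Iplus_ind: y => [e|p].
      rewrite !Wstate_pt in e.
      have et : \val t = \val t' by rewrite -(hE (lower D z)) e hE.
      split; last by rewrite et.
      apply: I_inj; apply: (mulfI (lt0r_neq0 b0)).
      by rewrite -wE et -wE e.
    have [/ep[pm px] p0' p1'] := epathsP p.
    have p0 := etrans p0' (Wstate_pt z t); have p1 := etrans p1' (Wstate_pt z' t').
    have tt : \val t <= \val t'.
      by have := pm I0 I1; rewrite p0 p1 !hE; apply; rewrite /= ler01.
    split => //; have := px I0 I1; rewrite p0 p1 !wE !hE => e.
    apply: I_inj; apply: (mulfI (lt0r_neq0 b0)); apply: (mulIf (lt0r_neq0 b0')).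
    by rewrite e; ring.
  split; last by have [] := key (fun=> I0) (@cst_continuous _ _ _).
  apply: diskval_inj; apply/rowP => i; have [v cv vE] := coord_I i.
  have [/(congr1 (fun u : I => \val u)) + _] := key v cv.
  by rewrite !vE !(rho_hemi _).2; lra.
have [tt|ne] := eqVneq t t'; first by subst t'; exists (Iid k erefl).
have [p _] : exists p : epaths (Wstate D (glob_pt z t)) (Wstate D (glob_pt z t')),
    epaths_fun p = w_V D \o (v_globF D \o (glob_pt z \o affineI t t')).
  apply: epaths_mk; rewrite /= ?affineI0 ?affineI1//.
  apply: md_epath; apply: md_epath; split.
    exists z, (affineI t t'); split => //; first exact: affineI_continuous.
    exact: affineI_nondecreasing.
  rewrite /= affineI0 affineI1; split; [by right|by right|].
  by move=> /glob_pt_height e; rewrite e eqxx in ne.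
by exists (Itr k p).
Qed.

End WHoms.

(** * The equivalences *)

Section Numeric.
Variable R : realType.

(** The origin of the constant of the push: since t >= s0, the product c0 t th is at least (c0 s0)^2
    (1 - t), so the factor (c0 s0)^-2 reaches the top whatever t is. *)
Lemma push_ge (c0 s0 t th : R) : 0 < c0 -> 0 < s0 -> s0 <= t -> t <= 1 ->
  c0 * (s0 * (1 - t)) <= th -> 1 <= t + (c0 * s0) ^- 2 * c0 * t * th.
Proof.
move=> c00 s00 st t1 hth.
have w0 : 0 < c0 * s0 by exact: mulr_gt0.
have h : (c0 * s0) ^+ 2 * (1 - t) <= c0 * t * th.
  have -> : (c0 * s0) ^+ 2 * (1 - t) = (c0 * s0) * (c0 * (s0 * (1 - t))) by ring.
  have h0 : 0 <= c0 * (s0 * (1 - t)).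
    by rewrite mulr_ge0 ?(ltW c00)// mulr_ge0 ?(ltW s00)// subr_ge0.
  by apply: ler_pM => //; [exact: ltW|rewrite ler_wpM2l// ltW].
have : 1 - t <= (c0 * s0) ^- 2 * (c0 * t * th).
  rewrite mulrC ler_pdivlMr ?exprn_gt0//.
  by rewrite mulrC.
by rewrite !mulrA; lra.
Qed.

(** The image of [push_ge] under t -> 1 - t. *)
Lemma push_le (c0 s0 t th : R) : 0 < c0 -> s0 < 1 -> 0 <= t -> t <= s0 ->
  c0 * ((1 - s0) * t) <= th -> t - (c0 * (1 - s0)) ^- 2 * c0 * (1 - t) * th <= 0.
Proof.
move=> c00 s01 t0 ts hth.
have := @push_ge c0 (1 - s0) (1 - t) th c00; rewrite subKr => h.
by have := h _ _ _ hth; rewrite subr_gt0 lerD2l lerN2 gerBl => /(_ s01 ts t0); lra.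
Qed.

(** Factor by factor. Along a line starting at height s0, it bounds from below the running minimum
    of mu at height t. *)
Lemma concave_ge (s0 t u : R) : 0 <= s0 -> s0 <= u -> u <= t -> t <= 1 ->
  s0 * (1 - t) <= u * (1 - u).
Proof. by move=> s00 su ut t1; apply: ler_pM => //; lra. Qed.

(** A concave function is smallest at an end of the interval; the sign of 1 - s0 - u tells which end
    to compare with. *)
Lemma concave_min (s0 s1 u : R) : s0 <= u -> u <= s1 ->
  Num.min (s0 * (1 - s0)) (s1 * (1 - s1)) <= u * (1 - u).
Proof.
move=> su us; rewrite ge_min; have [h|h] := leP (s0 + u) 1.
  by apply/orP; left; nra.
by apply/orP; right; nra.
Qed.

End Numeric.

(** * Removal of the lines at states of F, and the two cases *)

Section Assembly.
Variables (R : realType) (k : topcat) (n : nat) (F : set (glob R (disk R n))).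
Hypothesis F_interior : F `<=` ~` range (glob_incl R n).
Variables (D : Wdata k F) (A X : mdspace R).
Variables (g : mdmap (glob_md R (disk R n)) A) (f : mdmap A X) (gh : mdmap (Wsp D) X).
Hypothesis X_pushout : is_pushout k (Wincl D) g gh f.
Hypothesis A_cellular : cellular k A.
Local Notation I := (unitI R).
Local Notation cell := (cell gh).
Local Notation lower := (lower D).

(** One choice of the maps on X, shared by all the lemmas below. The two pushes keep B as a
    parameter because it is determined by the state of F that is treated. *)
Record geometry := Geometry {
  ge_r : X -> A; ge_H : X * I -> X; ge_rho : disk R n.+1 -> disk R n;
  ge_c : disk R n.+1 -> I; ge_mu : X -> I; ge_m : A -> I;
  ge_r_continuous : continuous ge_r;
  ge_H_continuous : continuous ge_H;
  ge_rho_continuous : continuous ge_rho;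
  ge_rho_hemi : forall z, ge_rho (upper D z) = z /\ ge_rho (lower z) = z;
  ge_rf : forall y, ge_r (f y) = y;
  ge_rc : forall x t, ge_r (cell x t) = g (glob_pt (ge_rho x) t);
  ge_H0 : forall x, ge_H (x, I0) = x;
  ge_H1 : forall x, ge_H (x, I1) = f (ge_r x);
  ge_Hf : forall y s, ge_H (f y, s) = f y;
  ge_Hc : forall x s, exists x', forall t, ge_H (cell x t, s) = cell x' t;
  ge_neq : forall z (t : I) y, enorm (diskval z) < 1 -> 0 < \val t < 1 ->
    cell (lower z) t <> f y;
  ge_inj : forall z (t : I) z' (t' : I), enorm (diskval z) < 1 -> 0 < \val t < 1 ->
    cell (lower z) t = cell (lower z') t' -> z = z' /\ t = t';
  ge_c_lower : forall z, \val (ge_c (lower z)) = 1 - enorm (diskval z) ^+ 2;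
  ge_mu_continuous : continuous ge_mu;
  ge_mu_f : forall y, ge_mu (f y) = I0;
  ge_mu_cell : forall x t, \val (ge_mu (cell x t)) = cellmark ge_c x t;
  ge_marking : marking ge_m;
  ge_push_up : forall B : R, 0 <= B -> exists2 K : X * I -> X, continuous K &
    (forall x, K (x, I0) = x) /\ forall x t s, K (cell x t, s) =
      cell x (clampI (\val t + B * \val (ge_c x) * \val t * \val s));
  ge_push_down : forall B : R, 0 <= B -> exists2 K : X * I -> X, continuous K &
    (forall x, K (x, I0) = x) /\ forall x t s, K (cell x t, s) =
      cell x (clampI (\val t - B * \val (ge_c x) * (1 - \val t) * \val s))
}.

Lemma geometry_ex : exists _ : geometry, True.
Proof.
have Ak := cellular_in_top A_cellular.
have [m mm] := cellular_marking A_cellular.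
have [rho crho rhoE] := disk_fold (hemi_pushout D).
have [c cc cE] := disk_bump (hemi_pushout D).
have [r cr [rf rc]] := X_retraction X_pushout Ak crho rhoE.
have [H cH [H0 H1 Hf Hc]] := X_homotopy X_pushout Ak crho rhoE cr rf rc.
have [mu cmu [muf muc]] := X_mu X_pushout cc cE.
have c0 x : 0 <= \val (c x) by exact: I_ge0.
unshelve eexists; [|by []]; apply: (@Geometry r H rho c mu m cr cH crho rhoE rf rc H0 H1 Hf Hc
  (cell_lower_neq X_pushout cc cE) (cell_lower_inj X_pushout crho rhoE cc cE)
  (fun z => (cE z).2) cmu muf muc mm).
- move=> B B0; have [|||||K cK KE] := @X_push R k n F D A X g f gh X_pushout Ak (fun w =>
    clampI (\val w.1.2 + B * \val (c w.1.1) * \val w.1.2 * \val w.2)).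
  + by continuity.
  + by move=> x s; rewrite /= mulr0 mul0r addr0 clampI_le0.
  + by move=> x s; rewrite /= clampI_ge1// mulr1 lerDl !mulr_ge0// ?c0 ?I_ge0.
  + by move=> x t; rewrite /= mulr0 addr0 clampIK.
  + by move=> z t s; rewrite /= (cE z).1 /= mulr0 !mul0r addr0 clampIK.
  by exists K.
- move=> B B0; have [|||||K cK KE] := @X_push R k n F D A X g f gh X_pushout Ak (fun w =>
    clampI (\val w.1.2 - B * \val (c w.1.1) * (1 - \val w.1.2) * \val w.2)).
  + by continuity.
  + by move=> x s; rewrite /= clampI_le0// sub0r oppr_le0 subr0 mulr1 !mulr_ge0// ?c0 ?I_ge0.
  + by move=> x s; rewrite /= subrr mulr0 mul0r subr0 clampI_ge1.
  + by move=> x t; rewrite /= mulr0 subr0 clampIK.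
  + by move=> z t s; rewrite /= (cE z).1 /= mulr0 !mul0r subr0 clampIK.
  by exists K.
Qed.

Variable G : geometry.
Local Notation r := (ge_r G).
Local Notation H := (ge_H G).
Local Notation c := (ge_c G).
Local Notation mu := (ge_mu G).
Local Notation m := (ge_m G).
Let c_lower : forall z, \val (c (lower z)) = 1 - enorm (diskval z) ^+ 2 := ge_c_lower G.
Let mu_cell : forall x t, \val (mu (cell x t)) = cellmark c x t := ge_mu_cell G.
Let new_injG := new_inj F_interior (ge_inj G).

Lemma old_not_new a : old f a -> new gh a -> False.
Proof. exact: (old_new F_interior (ge_neq G)). Qed.

Lemma states_old_new a : states X a -> old f a \/ new gh a.
Proof.
exact: (X_decomposition F_interior X_pushout (ge_rf G) (ge_rc G) (ge_Hf G) (ge_Hc G)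
  (ge_neq G) (ge_inj G)).1.
Qed.

Let from_newP := epath_from_new F_interior X_pushout (ge_rf G) (ge_rc G) (ge_Hf G)
  (ge_Hc G) (ge_neq G) (ge_inj G).
Let from_oldP := epath_from_old F_interior X_pushout (ge_rf G) (ge_rc G) (ge_Hf G)
  (ge_Hc G) (ge_neq G) (ge_inj G).
Let fullP := epath_full F_interior X_pushout (ge_rf G) (ge_rc G) (ge_Hf G)
  (ge_Hc G) (ge_neq G) (ge_inj G).

Let omega (x : X) : I := m (r x).

Lemma omega_continuous : continuous omega.
Proof. by have [cm _ _] := ge_marking G; exact: continuous_fun_comp (@ge_r_continuous G) cm. Qed.

Lemma omega_end b : omega (f (g (glob_end R _ b))) = I0.
Proof.
have [_ sm _] := ge_marking G; rewrite /omega (ge_rf G); apply: sm.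
by apply: md_states; exists b.
Qed.

Let old_end b : old f (f (g (glob_end R _ b))).
Proof. by exists (g (glob_end R _ b)) => //; apply: md_states; exists b. Qed.

(** The loop joins states of A, so [fullP] makes its retraction an execution path of A, where the
    marking reaches 1. *)
Lemma omega_loop (b : bool) p : let e := f (g (glob_end R _ b)) in
  epath X p -> p I0 = e -> p I1 = e -> exists t, omega (p t) = I1.
Proof.
move=> e ep p0 p1.
have [_ er _ _] : full f r H p.
  by apply: fullP; rewrite // ?p0 ?p1; exact: old_end.
by have [_ _ em] := ge_marking G; exact: em _ er.
Qed.

Lemma c_lower_gt0 z s : F (glob_pt z s) -> 0 < \val (c (lower z)).
Proof.
move=> /(F_bounds F_interior)[z1 _]; rewrite c_lower.
by have := enorm_ge0 (diskval z); nra.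
Qed.

(** [mid] and [Tau] are left abstract to cover three situations: nothing splits off, the identity
    does, or the class of the line from the first state to the second does. *)
Lemma head_removal_cell z0 s0 (b : X) (mid : set (I -> X))
    (Tau : set (Iplus_hom k (cell (lower z0) s0) b)) (eps : R) :
  F (glob_pt z0 s0) -> 0 < eps ->
  (forall p phi, mid p -> reparam phi -> mid (p \o phi)) ->
  (forall p, mid p -> infI (fun t => \val (mu (p t))) = eps) ->
  (forall p, mid_path gh p -> p I0 = cell (lower z0) s0 -> p I1 = b -> mid p) ->
  (forall e, Tau (Iid k e)) ->
  (forall p : epaths (cell (lower z0) s0) b, mid (epaths_fun p) -> Tau (Itr k p)) ->
  (forall y, Tau y -> (exists e, y = Iid k e) \/
    exists2 p : epaths (cell (lower z0) s0) b, mid (epaths_fun p) & y = Itr k p) ->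
  (forall y y', Tau y -> Tau y' -> y = y') ->
  homeo (Iplus_hom k (cell (lower z0) s0) b)
    (coprod (set_type Tau) (Iplus_hom k (f (g (glob_end R _ true))) b)).
Proof.
move=> Fs eps0 midr mide mid_in Tid Tmid Tind Tuniq.
have [_ /andP[s00 s01]] := F_bounds F_interior Fs.
have c0 := c_lower_gt0 Fs.
set cc := \val (c (lower z0)) in c0.
have B0 : 0 <= (cc * \val s0) ^- 2 by rewrite invr_ge0 exprn_ge0// mulr_ge0 ?ltW.
have [K cK [K0 KE]] := ge_push_up G B0.
pose psi := affineI s0 I1; pose hd := cell (lower z0) \o psi.
have cpsi : continuous psi by exact: affineI_continuous.
have npsi : nondecreasingI psi by apply: affineI_nondecreasing; exact: I_le1.
have psi0 : psi I0 = s0 by exact: affineI0.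
have psi1 : psi I1 = I1 by exact: affineI1.
have psi_ge t : \val s0 <= \val (psi t) by rewrite -{1}psi0; apply/npsi/I_ge0.
have hhd : head_path gh hd by exists z0, psi; rewrite psi0 psi1.
have hd0 : hd I0 = cell (lower z0) s0 by rewrite /hd /= psi0.
have hd1 : hd I1 = f (g (glob_end R _ true)) by rewrite /hd /= psi1 (cell1 X_pushout).
(* The starting state determines the line, and on it every nondecreasing path from s0 to 1 is a
   reparametrization of the affine one. *)
have line_hd z psi' p : line gh z psi' p -> F (glob_pt z (psi' I0)) -> psi' I1 = I1 ->
    p I0 = cell (lower z0) s0 -> exists2 phi, reparam phi & p = hd \o phi.
  move=> [cp np ->] Fz p1; rewrite /= => p0.
  have [zz ps] := new_injG Fz p0; subst z.
  have [|phi rphi E] := nondecreasing_affineI cp np; first by rewrite ps p1.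
  by exists phi => //; rewrite E ps p1.
apply: (@head_removal R k X _ b _ hd mu K omega mid Tau eps) => //.
- exact: (head_epath F_interior hhd).
- exact: ge_mu_continuous.
- exact: ge_mu_f.
(* Up to height psi t the function mu is at least cc s0 (1 - psi t), so by [push_ge] the chosen B
   brings every point of [hd] to the top. *)
- move=> t; rewrite -(cell1 X_pushout (lower z0)) KE; congr cell.
  apply: clampI_ge1; apply: push_ge => //.
  + exact: I_le1.
  + apply: runmin_glb => [|u ut].
      apply/andP; split.
        by rewrite mulr_ge0 ?(ltW c0)// mulr_ge0 ?(ltW s00)// subr_ge0 I_le1.
      apply: mulr_ile1; rewrite ?I_le1 ?(ltW c0)//.
        by rewrite mulr_ge0 ?(ltW s00)// subr_ge0 I_le1.
      by apply: mulr_ile1; rewrite ?I_le1 ?I_ge0 ?subr_ge0 ?I_le1// gerBl I_ge0.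
    have -> : \val ((mu \o hd) u) = cc * (\val (psi u) * (1 - \val (psi u))).
      exact: mu_cell.
    rewrite ler_wpM2l ?(ltW c0)//; apply: concave_ge; rewrite ?(ltW s00) ?I_le1//.
    exact: npsi.
- exact: omega_continuous.
- exact: omega_end.
- by move=> e p ep p0 p1; exact: (@omega_loop true p).
- move=> p ep p0 p1.
  have [|mp|hp|[h [q [phi [hh fq hq rphi pE]]]]] := from_newP ep.
  + by rewrite p0; exists z0, s0.
  + by apply: Or31; exact: mid_in.
  + by apply: Or32; have [z [ps [l Fz p1']]] := hp; exact: line_hd l Fz p1' p0.
  + apply: Or33; have [z [ps [l Fz h1']]] := hh.
    have h0 : h I0 = cell (lower z0) s0 by rewrite -p0 pE /= reparam0// ncomp0.
    have [phi1 rphi1 hE] := line_hd z ps h l Fz h1' h0.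
    have q0 : q I0 = f (g (glob_end R _ true)) by rewrite -hq hE /= reparam1.
    exists q, (reparam_cat phi1 id \o phi); split => //.
    * exact: (from_old_epath F_interior fq).
    * by rewrite -p1 pE /= reparam1// ncomp1.
    * by apply: reparam_comp => //; apply: reparam_catP => //; exact: reparam_id.
    * rewrite pE hE -[q in LHS]/(q \o id) ncomp_reparam//; first exact: reparam_id.
      by rewrite hd1 q0.
Qed.

(** The mirror image of [head_removal_cell]; nothing splits off because one end is in A and the
    other in F. *)
Lemma tail_removal_cell (a : X) z1 s1 : old f a -> F (glob_pt z1 s1) ->
  homeo (Iplus_hom k a (cell (lower z1) s1))
    (Iplus_hom k a (f (g (glob_end R _ false)))).
Proof.
move=> olda Fs.
have [_ /andP[s10 s11]] := F_bounds F_interior Fs.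
have c0 := c_lower_gt0 Fs.
set cc := \val (c (lower z1)) in c0.
have B0 : 0 <= (cc * (1 - \val s1)) ^- 2.
  by rewrite invr_ge0 exprn_ge0// mulr_ge0 ?(ltW c0)// subr_ge0 ltW.
have [K cK [K0 KE]] := ge_push_down G B0.
pose psi := affineI I0 s1; pose tl := cell (lower z1) \o psi.
have cpsi : continuous psi by exact: affineI_continuous.
have npsi : nondecreasingI psi by apply: affineI_nondecreasing; exact: I_ge0.
have psi0 : psi I0 = I0 by exact: affineI0.
have psi1 : psi I1 = s1 by exact: affineI1.
have psi_le t : \val (psi t) <= \val s1 by rewrite -psi1; apply/npsi/I_le1.
have htl : tail_path gh tl by exists z1, psi; rewrite psi0 psi1.
have newb : new gh (cell (lower z1) s1) by exists z1, s1.
have line_tl z psi' p : line gh z psi' p -> F (glob_pt z (psi' I1)) -> psi' I0 = I0 ->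
    p I1 = cell (lower z1) s1 -> exists2 phi, reparam phi & p = tl \o phi.
  move=> [cp np ->] Fz p0; rewrite /= => p1.
  have [zz ps] := new_injG Fz p1; subst z.
  have [|phi rphi E] := nondecreasing_affineI cp np; first by rewrite ps p0.
  by exists phi => //; rewrite E ps p0.
apply: (@tail_removal R k X a _ _ tl mu K) => //.
- exact: (tail_epath F_interior htl).
- by rewrite /tl /= psi0 (cell0 X_pushout).
- by rewrite /tl /= psi1.
- exact: ge_mu_continuous.
- exact: ge_mu_f.
- move=> t; rewrite -(cell0 X_pushout (lower z1)) KE; congr cell.
  apply: clampI_le0; apply: push_le => //.
  + exact: I_ge0.
  + apply: runmin_glb => [|u ut].
      apply/andP; split.
        by rewrite mulr_ge0 ?(ltW c0)// mulr_ge0 ?I_ge0// subr_ge0 ltW.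
      apply: mulr_ile1; rewrite ?I_le1 ?(ltW c0)//.
        by rewrite mulr_ge0 ?I_ge0// subr_ge0 ltW.
      by apply: mulr_ile1; rewrite ?I_le1 ?I_ge0 ?subr_ge0 ?I_le1// gerBl I_ge0.
    have -> : \val ((mu \o tl \o @Irev R) u) =
        cc * (\val (psi (Irev u)) * (1 - \val (psi (Irev u)))) by exact: mu_cell.
    rewrite ler_wpM2l ?(ltW c0)// mulrC; apply: concave_ge; rewrite ?I_ge0 ?(ltW s11)//.
    by apply: npsi; rewrite !val_Irev lerD2l lerN2.
- by move=> e; rewrite e in olda; exact: old_not_new olda newb.
- exists omega; split; [exact: omega_continuous|exact: omega_end|].
  by move=> e p ep p0 p1; exact: (@omega_loop false p).
- move=> p ep p0 p1.
  have [|[_ _ _ [_ o1]]|tp|[q [l [phi [[eq _ _ _] tq ql rphi pE]]]]] := from_oldP ep.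
  + by rewrite p0.
  + by rewrite p1 in o1; case: (old_not_new o1 newb).
  + by left; have [z [ps [l p0' Fz]]] := tp; exact: line_tl l Fz p0' p1.
  + right; have [z [ps [ll l0' Fz]]] := tq.
    have l1 : l I1 = cell (lower z1) s1 by rewrite -p1 pE /= reparam1// ncomp1.
    have [phi1 rphi1 lE] := line_tl z ps l ll Fz l0' l1.
    have tl0 : tl I0 = f (g (glob_end R _ false)) by rewrite /tl /= psi0 (cell0 X_pushout).
    have q1 : q I1 = f (g (glob_end R _ false)) by rewrite ql lE /= reparam0.
    exists q, (reparam_cat id phi1 \o phi); split => //.
    * by rewrite -p0 pE /= reparam0// ncomp0.
    * by apply: reparam_comp => //; apply: reparam_catP => //; exact: reparam_id.
    * rewrite pE lE -[q in LHS]/(q \o id) ncomp_reparam//; first exact: reparam_id.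
      by rewrite q1 tl0.
Qed.

Lemma old_old_equivalence y y' : states A y -> states A y' ->
  homotopy_equivalent R (Iplus_hom k (f y) (f y')) (Iplus_hom k y y').
Proof.
move=> sy sy'; apply: (@Iplus_deformation_retract R k A X f r H) => //.
- exact: md_continuous.
- exact: ge_r_continuous.
- exact: ge_H_continuous.
- exact: ge_rf.
- exact: ge_H0.
- exact: ge_H1.
- exact: ge_Hf.
- exact: md_epath.
- move=> p ep p0 p1.
  have [_ er eH _] : full f r H p.
    by apply: fullP; rewrite // ?p0 ?p1; [exists y|exists y'].
  by [].
Qed.

(** The retraction makes f injective, so [xget] can only return y. *)
Lemma state_plus_old y : states A y -> state_plus g f (f y) = y.
Proof.
move=> sy; rewrite /state_plus; case: xgetP => [y' _ [_ /= e]|/(_ y)]; last by case.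
by rewrite -(ge_rf G y') e (ge_rf G).
Qed.

Lemma state_minus_old y : states A y -> state_minus g f (f y) = y.
Proof.
move=> sy; rewrite /state_minus; case: xgetP => [y' _ [_ /= e]|/(_ y)]; last by case.
by rewrite -(ge_rf G y') e (ge_rf G).
Qed.

Lemma state_plus_new a : new gh a -> state_plus g f a = g (glob_end R _ true).
Proof.
move=> na; rewrite /state_plus; apply: xgetPN => y [sy /= e].
by apply: (old_not_new _ na); exists y.
Qed.

Lemma state_minus_new a : new gh a -> state_minus g f a = g (glob_end R _ false).
Proof.
move=> na; rewrite /state_minus; apply: xgetPN => y [sy /= e].
by apply: (old_not_new _ na); exists y.
Qed.

Lemma old_any_equivalence y b : states A y -> old f b \/ new gh b ->
  homotopy_equivalent R (Iplus_hom k (f y) b) (Iplus_hom k y (state_minus g f b)).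
Proof.
move=> sy [[y' sy' ->]|nb].
  by rewrite state_minus_old//; exact: old_old_equivalence.
rewrite (state_minus_new nb); have [z [s [Fs ->]]] := nb.
apply: homeo_homotopy_equivalent; first by apply: tail_removal_cell => //; exists y.
by apply: old_old_equivalence => //; apply: md_states; exists false.
Qed.

Lemma old_statesP a : old_states f a <-> old f a.
Proof. by split => [[y sy <-]|[y sy ->]]; exists y. Qed.

Lemma new_not_old a : new gh a -> ~ old_states f a.
Proof. by move=> na /old_statesP oa; exact: old_not_new oa na. Qed.

Lemma new_case_cell z s z' s' : F (glob_pt z s) -> F (glob_pt z' s') ->
  new_case f gh (cell (lower z) s) (cell (lower z') s') <-> z = z' /\ \val s <= \val s'.
Proof.
move=> Fs Fs'; rewrite -(W_hom F_interior (@ge_rho_continuous G) (ge_rho_hemi G) Fs Fs').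
split; last first.
  move=> h; split; first by apply: new_not_old; exists z, s.
    by apply: new_not_old; exists z', s'.
  by exists (glob_pt z s), (glob_pt z' s'); rewrite !gh_Wstate; split.
move=> [_ _ [x [y []]]].
elim/glob_ind: x => [b /(F_end F_interior)//|z1 s1 F1]; elim/glob_ind: y => [b /(F_end F_interior)//|z2 s2 F2].
rewrite !gh_Wstate => e1 e2.
have [-> ->] := new_injG F1 e1.
by have [-> ->] := new_injG F2 e2.
Qed.

(** In the two other normal forms the head reaches g(1), which is a state of A. *)
Lemma avoiding_mid p : epath X p -> new gh (p I0) -> (forall t, ~ old_states f (p t)) ->
  mid_path gh p.
Proof.
move=> ep p0 av.
case: (from_newP ep p0) => //.
  by move=> /(head_ends X_pushout)[_ o1]; case: (av I1); exact/old_statesP.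
move=> [h [q [phi [/(head_ends X_pushout)[_ h1] _ hq [_ _ sphi] pE]]]].
have [t tE] := sphi (Ileft I1); case: (av t); apply/old_statesP.
by rewrite pE /= tE ncomp_Ileft.
Qed.

Lemma mid_path_cell z s z' s' p : F (glob_pt z s) -> F (glob_pt z' s') ->
  mid_path gh p -> p I0 = cell (lower z) s -> p I1 = cell (lower z') s' ->
  [/\ z = z', \val s < \val s' & exists psi, [/\ line gh z psi p, psi I0 = s & psi I1 = s']].
Proof.
move=> Fs Fs' [z1 [psi [[c nd ->] F0 F1 ne]]] /= p0 p1.
have [zz0 e0] := new_injG F0 p0; subst z.
have [zz1 e1] := new_injG F1 p1; subst z'.
split => //; last by exists psi.
rewrite lt_neqAle; apply/andP; split; last by rewrite -e0 -e1; apply/nd/I_ge0.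
by apply/eqP => e; apply: ne; rewrite e0 e1; exact: I_inj.
Qed.

(** A middle path or an identity from the given state to b would make the pair a new case. Hence
    [Tau] is empty, and eps = 1 is a placeholder. *)
Lemma other_case_new z s b : F (glob_pt z s) -> states X b ->
  ~ new_case f gh (cell (lower z) s) b ->
  homotopy_equivalent R (Iplus_hom k (cell (lower z) s) b)
    (Iplus_hom k (g (glob_end R _ true)) (state_minus g f b)).
Proof.
move=> Fs sb nn.
apply: homeo_homotopy_equivalent; last first.
  apply: old_any_equivalence; last exact: states_old_new.
  by apply: md_states; exists true.
apply: homeo_trans.
  apply: (head_removal_cell (mid := set0) (Tau := set0) (eps := 1)) => //.
  - move=> p mp p0 p1; have [_ [z1 [s1 [F1 bE]]]] := mid_ends mp.
    rewrite p1 in bE.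
    apply: nn; rewrite bE; apply/new_case_cell => //.
    by have [-> /ltW h _] := mid_path_cell Fs F1 mp p0 (etrans p1 bE).
  - move=> e; apply: nn; rewrite -e; exact/new_case_cell.
by apply: homeo_coprod0 => -[y /set_mem].
Qed.

(** Along a line mu is a constant times u (1 - u), so the minimum depends on the two ends only. This
    gives one eps for all the lines between two given states. *)
Lemma infI_line z psi p : line gh z psi p ->
  infI (fun t => \val (ge_mu G (p t))) = \val (ge_c G (lower z)) *
    Num.min (\val (psi I0) * (1 - \val (psi I0))) (\val (psi I1) * (1 - \val (psi I1))).
Proof.
move=> [c nd ->].
have muE t : \val (ge_mu G ((cell (lower z) \o psi) t)) =
    \val (ge_c G (lower z)) * (\val (psi t) * (1 - \val (psi t))) by exact: ge_mu_cell.
have cq : continuous (fun t => \val (ge_mu G ((cell (lower z) \o psi) t))).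
  by apply: (continuous_eq muE); continuity.
have [t tE tmin] := infI_min cq; rewrite tE muE.
apply/le_anti/andP; split.
  rewrite -muE minr_pMr ?I_ge0//; rewrite le_min -!muE.
  by rewrite !tmin.
rewrite ler_wpM2l ?I_ge0//; apply: concave_min; first exact/nd/I_ge0.
exact/nd/I_le1.
Qed.

(** tau is the identity if s = s', and otherwise the class of the affine line: all paths that avoid
    A^0 run along this line and are reparametrizations of it. *)
Lemma new_case_new z s s' : F (glob_pt z s) -> F (glob_pt z s') -> \val s <= \val s' ->
  let a := cell (lower z) s in let b := cell (lower z) s' in
  exists tau : Iplus_hom k a b, unique (avoiding f (k := k) (a := a) (b := b)) tau /\
    homeo (Iplus_hom k a b) (coprod (set_type [set y : Iplus_hom k a b | y = tau])
      (Iplus_hom k (f (g (glob_end R _ true))) b)).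
Proof.
move=> Fs Fs' ss a b.
have na : new gh a by exists z, s.
have avm (p : epaths a b) : (forall t, ~ old_states f (epaths_fun p t)) ->
    \val s < \val s' /\ exists psi, [/\ line gh z psi (epaths_fun p), psi I0 = s & psi I1 = s'].
  move=> av; have [ep p0 p1] := epathsP p.
  have mp : mid_path gh (epaths_fun p) by apply: avoiding_mid => //; rewrite p0.
  by have [_] := mid_path_cell Fs Fs' mp p0 p1.
have uniq_set (tau y y' : Iplus_hom k a b) : [set u | u = tau] y -> [set u | u = tau] y' -> y = y'.
  by move=> /= -> ->.
move: ss; rewrite le_eqVlt => /orP[/eqP/I_inj es|slt].
  have e : a = b by rewrite /a /b es.
  exists (Iid k e); split.
    split; first exact: new_not_old.
    elim/Iplus_ind => [e'|p0]; first by move=> _; exact: Iid_irr.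
    move=> [p _ /avm[]].
    by rewrite es ltxx.
  (* A middle path strictly increases the height, so none returns to its starting state. *)
  apply: (head_removal_cell (mid := set0) (eps := 1)) => //.
  - move=> p mp p0 p1; have [_] := mid_path_cell Fs Fs' mp p0 p1.
    by rewrite es ltxx.
  - by move=> e'; exact: Iid_irr.
  - by move=> y /= ->; left; exists e.
  - exact: uniq_set.
pose psi := affineI s s'.
have cpsi : continuous psi by exact: affineI_continuous.
have npsi : nondecreasingI psi by apply: affineI_nondecreasing; exact: ltW.
have psi0 : psi I0 = s by exact: affineI0.
have psi1 : psi I1 = s' by exact: affineI1.
have lpsi : line gh z psi (cell (lower z) \o psi) by [].
have mpsi : mid_path gh (cell (lower z) \o psi).
  by exists z, psi; rewrite psi0 psi1; split => // e; rewrite e ltxx in slt.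
have [p0 p0E] : exists p : epaths a b, epaths_fun p = cell (lower z) \o psi.
  by apply: epaths_mk; [exact: mid_epath mpsi|rewrite /= psi0|rewrite /= psi1].
have ne : a <> b.
  move=> /(new_injG Fs)[_ e].
  by rewrite e ltxx in slt.
have tr (p : epaths a b) psi' : line gh z psi' (epaths_fun p) -> psi' I0 = s -> psi' I1 = s' ->
    Itr k p = Itr k p0.
  move=> [c' nd' pE] e0 e1.
  have [|phi rphi E] := nondecreasing_affineI c' nd'; first by rewrite e0 e1.
  by apply: (Itr_reparam k rphi); rewrite p0E pE E e0 e1.
pose mid : set (I -> X) := [set p | exists psi', [/\ line gh z psi' p, psi' I0 = s & psi' I1 = s']].
exists (Itr k p0); split.
  split.
    exists p0 => // t; rewrite p0E => /old_statesP[y _].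
    have [z1 /andP[s0 _]] := F_bounds F_interior Fs.
    have [_ /andP[_ s1]] := F_bounds F_interior Fs'.
    apply: (ge_neq G) => //; apply/andP; split.
      by apply: lt_le_trans s0 _; rewrite -psi0; apply/npsi/I_ge0.
    by apply: le_lt_trans _ s1; rewrite -psi1; apply/npsi/I_le1.
  elim/Iplus_ind => [e|p1]; first by case: ne.
  move=> [p pE /avm[_ [psi' [l e0 e1]]]].
  transitivity (Itr k p); first by apply/esym; exact: tr l e0 e1.
  by rewrite /Itr -pE.
have [_ /andP[s0 s1]] := F_bounds F_interior Fs.
have [_ /andP[s0' s1']] := F_bounds F_interior Fs'.
apply: (head_removal_cell (mid := mid) (eps := \val (ge_c G (lower z)) *
    Num.min (\val s * (1 - \val s)) (\val s' * (1 - \val s')))) => //.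
- rewrite mulr_gt0 ?(c_lower_gt0 Fs)//.
  by rewrite lt_min !mulr_gt0// subr_gt0.
- move=> p phi [psi' [l e0 e1]] rphi; exists (psi' \o phi); split.
  + exact: line_reparam.
  + by rewrite /= reparam0.
  + by rewrite /= reparam1.
- by move=> p [psi' [l e0 e1]]; rewrite (infI_line l) e0 e1.
- by move=> p mp q0 q1; have [_ _] := mid_path_cell Fs Fs' mp q0 q1.
- by move=> p [psi' [l e0 e1]]; exact: tr l e0 e1.
- move=> y /= ->; right; exists p0 => //.
  by exists psi; rewrite p0E.
- exact: uniq_set.
Qed.

End Assembly.

Theorem theorem8p9 (R : realType) (k : topcat) (n : nat)
    (F : set (glob R (disk R n))) (finF : finite_set F)
    (F_interior : F `<=` ~` range (glob_incl R n))
    (D : Wdata k F) (A X : mdspace R)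
    (g : mdmap (glob_md R (disk R n)) A) (f : mdmap A X)
    (gh : mdmap (Wsp D) X)
    (cellA : cellular k A) (X_pushout : is_pushout k (Wincl D) g gh f)
    (a b : X) (Xa : states X a) (Xb : states X b) :
  (new_case f gh a b ->
     exists tau : Iplus_hom k a b,
       unique (avoiding f (k := k) (a := a) (b := b)) tau /\
       homotopy_equivalent R (Iplus_hom k a b)
         (coprod (set_type [set y : Iplus_hom k a b | y = tau])
            (Iplus_hom k (state_plus g f a) (state_minus g f b)))) /\
  (~ new_case f gh a b ->
     homotopy_equivalent R (Iplus_hom k a b)
       (Iplus_hom k (state_plus g f a) (state_minus g f b))).
Proof.
have [G _] := geometry_ex X_pushout cellA.
have goal_end b' : states A (g (glob_end R (disk R n) b')) by apply: md_states; exists b'.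
have stX := states_old_new F_interior X_pushout G.
split => [nc|nn].
  have [_ _ [x [y [Fx Fy xa yb _]]]] := nc.
  elim/glob_ind: x Fx xa => [b' /(F_end F_interior)//|z s Fs]; elim/glob_ind: y Fy yb => [b' /(F_end F_interior)//|z' s' Fs'].
  rewrite !gh_Wstate => bE aE; subst a b.
  have [zz ss] := (new_case_cell F_interior G Fs Fs').1 nc; subst z'.
  have na : new gh (cell gh (lower D z) s) by exists z, s.
  have nb : new gh (cell gh (lower D z) s') by exists z, s'.
  have [tau [tauP hh]] := new_case_new F_interior X_pushout G Fs Fs' ss.
  (* Once the head is removed, the other summand starts at g(1), a state of A, and is handled by
     [old_any_equivalence]. *)
  exists tau; split => //; apply: homeo_homotopy_equivalent hh _.
  apply: homotopy_equivalent_coprodr; rewrite (state_plus_new F_interior G na).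
  by apply: (old_any_equivalence F_interior X_pushout G) => //; right.
have [[y sy aE]|na] := stX a Xa.
  rewrite aE (state_plus_old G sy).
  exact: (old_any_equivalence F_interior X_pushout G sy (stX b Xb)).
rewrite (state_plus_new F_interior G na); have [z [s [Fs aE]]] := na.
by subst a; exact: (other_case_new F_interior X_pushout G Fs Xb nn).
Qed.
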